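(* Let $F:\mathbb{C}\to\mathbb{C}$ be an entire function, $F\not\equiv 0$, and let $a\in\mathbb{C}$ be an equilibrium of $\dot x=F(x)$ of order $m\in\mathbb{N}\setminus\{1\}$. Let $\mathcal{S}:=\mathcal{S}(\Xi)$ be the global elliptic sector of $F$ in $a$ generated by a sector-forming orbit $\Xi$ in $a$. Then $\partial\mathcal{S}$ consists of $a$, two separatrices $\Gamma_1,\Gamma_2$ satisfying $\omega_-(\Gamma_1)=\omega_+(\Gamma_2)=\{a\}$, and at most countably many further separatrices, i.e. there exist an index set $\mathcal{Q}\subset\mathbb{N}$ and separatrices $C_n\subset\partial\mathcal{S}$, $n\in\mathcal{Q}$, such that $$\partial\mathcal{S}=\{a\}\cup\Gamma_1\cup\Gamma_2\cup\bigcup_{n\in\mathcal{Q}}C_n .$$ In particular, $\Gamma_1$ is a positive separatrix and $\Gamma_2$ is a negative separatrix. Moreover, for every $n\in\mathcal{Q}$ the orbit $C_n$ is a double-sided separatrix.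
   Context: Setting: for an entire function $F$, consider the planar ODE $\dot x=F(x)$, $x\in\mathbb{C}$, with real time $t$. For $x_0\in\mathbb{C}$ let $I(x_0)\subset\mathbb{R}$ be the maximal interval of existence of the solution $\Phi(\cdot,x_0)$ with $\Phi(0,x_0)=x_0$; the orbit through $x_0$ is $\Gamma(x_0)=\Phi(I(x_0),x_0)$. Equilibria are the zeros of $F$; the order of an equilibrium is its order as a zero of $F$. Limit sets: for an orbit $\Gamma=\Gamma(x_0)$, $\omega_{+}(\Gamma)$ (resp. $\omega_-(\Gamma)$) is the set of all $v\in\mathbb{C}$ for which there is a sequence $(t_k)\subset I(x_0)$ with $t_k\to+\infty$ (resp. $t_k\to-\infty$) and $\Phi(t_k,x_0)\to v$. It is independent of the choice of $x_0\in\Gamma$ and is empty if $I(x_0)$ is bounded above (resp. below). For a closed Jordan curve $J\subset\mathbb{C}$, $\mathrm{Int}(J)$ denotes the bounded component of $\mathbb{C}\setminus J$. Homoclinic and sector-forming orbits: an orbit $\Xi\subset\mathbb{C}\setminus\{a\}$ is homoclinic in $a$ if $\omega_+(\Xi)=\omega_-(\Xi)=\{a\}$; then $\Xi\cup\{a\}$ is a closed Jordan curve. A homoclinic orbit $\Xi$ in $a$ is a sector-forming orbit in $a$ if for all $z\in\mathrm{Int}(\Xi\cup\{a\})$ the orbit $\Gamma(z)$ is also homoclinic in $a$. Global elliptic sector: for a sector-forming orbit $\Xi$ in $a$, $$\mathcal{S}(\Xi):=\Xi\cup\mathrm{Int}(\Xi\cup\{a\})\cup\mathcal{S}'(\Xi),$$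 $$\mathcal{S}'(\Xi):=\{x\in\mathbb{C}:\Gamma(x)\text{ is homoclinic in }a\text{ and }\Xi\subset\mathrm{Int}(\Gamma(x)\cup\{a\})\}.$$ Separatrix: an orbit $\Gamma$, with $x_0\in\Gamma$, is a positive separatrix if $I(x_0)\cap[0,\infty)$ is bounded, a negative separatrix if $I(x_0)\cap(-\infty,0]$ is bounded, and a double-sided separatrix if $I(x_0)$ is bounded (all independent of $x_0\in\Gamma$). A separatrix is an orbit that is a positive or a negative separatrix. *)

(* Defs.v *)
From HB Require Import structures.
From mathcomp Require Import all_boot all_order all_algebra.
From mathcomp Require Import complex.
From mathcomp Require Import all_classical all_reals all_analysis.

Set Implicit Arguments.
Unset Strict Implicit.
Unset Printing Implicit Defensive.

Import Order.TTheory GRing.Theory Num.Theory.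
Import numFieldNormedType.Exports.

Local Open Scope classical_set_scope.
Local Open Scope ring_scope.

(* The complex plane, packed as a [numClosedFieldType] because the norm topology
   of a numeric field is keyed on the structure: [R[i]] alone has no topology. *)
Definition Cplx (R : realType) : numClosedFieldType := R[i].

Section PlanarODE.
Variable R : realType.
Local Notation C := (Cplx R).
Implicit Types (F : C -> C) (a x : C) (G Xi J : set C).

(* The direction 1 is taken in the field C, so this is complex differentiability. *)
Definition entire F := forall z : C, derivable F z 1.

Definition zero_of_order F a (m : nat) :=
  exists g : C -> C,
    [/\ entire g, g a != 0 & forall z, F z = (z - a) ^+ m * g z].

Definition equilibrium F a := F a = 0.

Definition solution_on F x (I : set R) (y : R -> C) :=
  [/\ open I, is_interval I, I 0, y 0 = x &
      forall t, I t ->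
        is_derive t 1 (fun s => complex.Re (y s)) (complex.Re (F (y t))) /\
        is_derive t 1 (fun s => complex.Im (y s)) (complex.Im (F (y t)))].

(* The maximal interval of existence is the union of all intervals carrying a
   solution; by uniqueness, these solutions glue to the flow. *)
Definition Imax F x : set R :=
  [set t | exists I y, solution_on F x I y /\ I t].

(* The value is meaningful for t in [Imax F x] only. *)
Definition flow F (t : R) x : C :=
  xget 0 [set v | exists I y, [/\ solution_on F x I y, I t & y t = v]].

Definition flow_orbit F x : set C := [set flow F t x | t in Imax F x].

Definition is_orbit F G := exists x, G = flow_orbit F x.

Definition omega_pos F G : set C :=
  [set v | exists2 x, G x & exists t : nat -> R,
     [/\ forall k, Imax F x (t k), t k @[k --> \oo] --> +oo &
         flow F (t k) x @[k --> \oo] --> v]].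

Definition omega_neg F G : set C :=
  [set v | exists2 x, G x & exists t : nat -> R,
     [/\ forall k, Imax F x (t k), t k @[k --> \oo] --> -oo &
         flow F (t k) x @[k --> \oo] --> v]].

(* The union of the bounded components of the complement: for a closed Jordan
   curve there is exactly one. *)
Definition Int J : set C :=
  [set z | ~ J z /\ bounded_set (connected_component (~` J) z)].

Definition homoclinic F a Xi :=
  [/\ is_orbit F Xi, ~ Xi a, omega_pos F Xi = [set a] & omega_neg F Xi = [set a]].

Definition sector_forming F a Xi :=
  homoclinic F a Xi /\
  forall z, Int (Xi `|` [set a]) z -> homoclinic F a (flow_orbit F z).

Definition outer_sector F a Xi : set C :=
  [set x | homoclinic F a (flow_orbit F x) /\ Xi `<=` Int (flow_orbit F x `|` [set a])].

Definition global_elliptic_sector F a Xi : set C :=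
  Xi `|` Int (Xi `|` [set a]) `|` outer_sector F a Xi.

Definition positive_separatrix F G :=
  exists x, G = flow_orbit F x /\ bounded_set (Imax F x `&` [set t | 0 <= t]).

Definition negative_separatrix F G :=
  exists x, G = flow_orbit F x /\ bounded_set (Imax F x `&` [set t | t <= 0]).

Definition double_sided_separatrix F G :=
  exists x, G = flow_orbit F x /\ bounded_set (Imax F x).

Definition separatrix F G := positive_separatrix F G \/ negative_separatrix F G.

Definition boundary (A : set C) : set C := closure A `\` interior A.

End PlanarODE.

(* Main.v *)
Require Import Defs.
From mathcomp Require Import all_boot all_order all_algebra.
From mathcomp Require Import complex.
From mathcomp Require Import all_classical all_reals all_analysis.
From mathcomp Require Import ring lra.
Import Order.TTheory GRing.Theory Num.Theory.
Import numFieldNormedType.Exports.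
Local Open Scope classical_set_scope.
Local Open Scope ring_scope.
Set Implicit Arguments.
Unset Strict Implicit.
Unset Printing Implicit Defensive.

(**
Let Phi be the real flow of F and Psi the real flow of d F, where d = i or d = - i; the
two flows commute as long as the strip between the orbits is filled.  Let z0 lie on Xi.
The orbits of the points Psi(s, z0), for s in the maximal interval L around 0 on which
they stay homoclinic, sweep out an injectively parametrised open sheet
U = {Phi(t, Psi(s, z0))}.

Two consecutive orbits of the sheet are separated by the loop formed by the orbit in
between and a.  This case of the Jordan curve theorem is obtained from continuous square
roots of (z - p) / (z - q) along curves.  A set V that does not contain a and is open,
with V and a together compact, is empty (consider the extremal real parts).  Hence
exactly one side of every loop is bounded, and d can be chosen so that the interior of
the loop of Xi is the part s > 0 of U, where L is unbounded.  If U were bounded then L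
would be R by a uniform lower bound for the existence times, and L = R would make U and a
together compact.  So U is unbounded, which gives S(Xi) = U and L = (h, oo) with h finite.

A boundary point of U other than a is pushed by Psi(kap, -) to the orbit at level
h + kap, so the boundary is a together with the image of
beta(t) = Psi(- kap, Phi(t, Psi(h + kap, z0))) on the open set A of all t where this is
defined.  The components of A correspond to the orbits in the boundary.  For small kap
the set A contains both ends of the line, with beta -> a there, and A <> R since
otherwise h would be in L.  The two unbounded components give the two one-sided
separatrices, the bounded ones, which are enumerated by rationals, the double-sided ones.
*)

(** Solutions are obtained from complex analysis: where F does not vanish, a primitive of 1 / F is a
    local chart in which the flow of every multiple c F is translation by t c. The same chart yields
    uniqueness, makes the two flows commute and turns (t, s) into local coordinates of the sheet. At
    zeros of F there is no chart. There the linear bound of F keeps every solution slow, and near a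
    this gives a time span that is common to all orbits and all scales. Separation by one loop needs
    only the parity of winding numbers: (z - p) / (z - q) has a continuous root along a closed curve
    exactly if the curve winds around p and q with the same parity. Boundary orbits are separatrices
    for the following reason. An orbit pushed down from level h + kap to level h may blow up on the
    way, but commutation keeps t as the real time along the limiting orbit. A gap of A at a finite t
    is therefore a blow-up at a finite real time. *)

Ltac ilra := intros; lra.

(** * The complex norm with real values *)

Section ComplexNorm.
Variable R : realType.
Local Notation C := (Cplx R).
Implicit Types (x y z : C).

(** The norm of the field [C] takes its values in [C], where the order is only partial. A
    real-valued copy is totally ordered and open to [lra]. *)
Definition nm z : R := ComplexField.Normc.normc z.
Definition rc (x : R) : C := Complex x 0.

Lemma nm_norm z : `|z| = rc (nm z).
Proof. by []. Qed.

Lemma nm_ge0 z : 0 <= nm z.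
Proof. by rewrite /nm; case: z => a b /=; exact: sqrtr_ge0. Qed.

Lemma nmM x y : nm (x * y) = nm x * nm y.
Proof. exact: ComplexField.Normc.normcM. Qed.

Lemma nm0 : nm 0 = 0.
Proof. exact: ComplexField.Normc.normc0. Qed.

Lemma nm1 : nm 1 = 1.
Proof. exact: ComplexField.Normc.normc1. Qed.

Lemma nm_eq0 z : (nm z == 0) = (z == 0).
Proof.
apply/eqP/eqP => [|->]; last exact: nm0.
exact: ComplexField.Normc.eq0_normc.
Qed.

Lemma nm_gt0 z : (0 < nm z) = (z != 0).
Proof. by rewrite lt_def nm_ge0 nm_eq0 andbT. Qed.

Lemma nmV x : nm x^-1 = (nm x)^-1.
Proof. exact: ComplexField.Normc.normcV. Qed.

Lemma le_rc (a b : R) : (rc a <= rc b) = (a <= b).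
Proof. by rewrite /rc /Order.le /= eqxx. Qed.

Lemma lt_rc (a b : R) : (rc a < rc b) = (a < b).
Proof. by rewrite /rc /Order.lt /= eqxx. Qed.

Lemma rcD (a b : R) : rc (a + b) = rc a + rc b.
Proof. by rewrite /rc /GRing.add /= addr0. Qed.

Lemma rcN (a : R) : rc (- a) = - rc a.
Proof. by rewrite /rc {2}/GRing.opp /= oppr0. Qed.

Lemma rcB (a b : R) : rc (a - b) = rc a - rc b.
Proof. by rewrite rcD rcN. Qed.

Lemma rcM (a b : R) : rc (a * b) = rc a * rc b.
Proof. by rewrite /rc {2}/GRing.mul /= !(mul0r, mulr0, subr0, addr0). Qed.

Lemma rc0 : rc 0 = 0. Proof. by []. Qed.
Lemma rc1 : rc 1 = 1. Proof. by []. Qed.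

Lemma nmD x y : nm (x + y) <= nm x + nm y.
Proof. by rewrite -le_rc rcD -!nm_norm ler_normD. Qed.

Lemma nmN x : nm (- x) = nm x.
Proof. by have /(congr1 (@complex.Re R)) := normrN x. Qed.

Lemma nmBC x y : nm (x - y) = nm (y - x).
Proof. by rewrite -nmN opprB. Qed.

Lemma nmB x y : nm (x - y) <= nm x + nm y.
Proof. by rewrite -(nmN y) nmD. Qed.

Lemma nm_tri x y z : nm (x - z) <= nm (x - y) + nm (y - z).
Proof. by rewrite -[x - z](subrKA y) nmD. Qed.

Lemma nm_rc (a : R) : nm (rc a) = `|a|.
Proof. by rewrite /nm /= expr0n /= addr0 sqrtr_sqr. Qed.

Lemma ReD x y : complex.Re (x + y) = complex.Re x + complex.Re y.
Proof. by case: x => a b; case: y. Qed.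

Lemma ImD x y : complex.Im (x + y) = complex.Im x + complex.Im y.
Proof. by case: x => a b; case: y. Qed.

Lemma ReN x : complex.Re (- x) = - complex.Re x.
Proof. by case: x => a b. Qed.

Lemma ImN x : complex.Im (- x) = - complex.Im x.
Proof. by case: x => a b. Qed.

Lemma ReM x y : complex.Re (x * y) =
  complex.Re x * complex.Re y - complex.Im x * complex.Im y.
Proof. by case: x => a b; case: y. Qed.

Lemma ImM x y : complex.Im (x * y) =
  complex.Re x * complex.Im y + complex.Im x * complex.Re y.
Proof. by case: x => a b; case: y. Qed.

Lemma ler_Re x : `|complex.Re x| <= nm x.
Proof.
case: x => a b; rewrite /nm /= -sqrtr_sqr ler_wsqrtr //.
by rewrite lerDl sqr_ge0.
Qed.

Lemma ler_Im x : `|complex.Im x| <= nm x.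
Proof.
case: x => a b; rewrite /nm /= -sqrtr_sqr ler_wsqrtr //.
by rewrite lerDr sqr_ge0.
Qed.

Definition ci : C := Complex 0 1.

Lemma nm_ci : nm ci = 1.
Proof. by rewrite /nm /= expr0n /= add0r expr1n sqrtr1. Qed.

Lemma mkE (a b : R) : Complex a b = rc a + ci * rc b :> C.
Proof. by apply/eqP; rewrite eq_complex !(ReD, ImD, ReM, ImM) /=; apply/andP; split; apply/eqP; ring. Qed.

Lemma ReIm z : z = rc (complex.Re z) + ci * rc (complex.Im z).
Proof. by rewrite -mkE; case: z. Qed.

Lemma nm_le_ReIm z : nm z <= `|complex.Re z| + `|complex.Im z|.
Proof.
rewrite {1}(ReIm z) (le_trans (nmD _ _)) // nmM nm_ci mul1r !nm_rc.
by [].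
Qed.

Lemma eq_Cplx x y : complex.Re x = complex.Re y -> complex.Im x = complex.Im y -> x = y.
Proof. by case: x => a b; case: y => c d /= -> ->. Qed.

Lemma conj_nm z : z * conjc z = rc (nm z ^+ 2).
Proof.
apply: eq_Cplx; rewrite ?ReM ?ImM; case: z => a b /=.
  by rewrite sqr_sqrtr ?addr_ge0 ?sqr_ge0 //; ring.
by ring.
Qed.

Lemma nm_conj z : nm (conjc z) = nm z.
Proof. by case: z => a b; rewrite /nm /= sqrrN. Qed.

Lemma nbhs_nmP z (A : set C) :
  nbhs z A <-> exists2 e : R, 0 < e & forall y, nm (y - z) < e -> A y.
Proof.
split.
  move=> /nbhs_ballP[e /= e0 eA]; have : rc 0 < e by [].
  rewrite ltcE /= => /andP[/eqP ime re0].
  exists (complex.Re e) => // y ye; apply: eA; rewrite /ball /= nm_norm.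
  rewrite nmBC (_ : e = rc (complex.Re e)) ?lt_rc //.
  by apply: eq_Cplx.
move=> [e e0 eA]; apply/nbhs_ballP; exists (rc e) => /=; first by rewrite -rc0 lt_rc.
by move=> y; rewrite /ball /= nm_norm lt_rc nmBC => /eA.
Qed.

End ComplexNorm.

(** Inside each [V] the property passes in both directions, so the points of [A] with [P] and those
    without it are both relatively open. On an interval this is continuous induction along a
    curve. *)
Lemma connected_ind (T : topologicalType) (A : set T) (P : T -> Prop) (x0 : T) :
  connected A -> A x0 -> P x0 ->
  (forall x, A x -> exists2 V, nbhs x V &
     forall y z, A y -> A z -> V y -> V z -> P y -> P z) ->
  forall x, A x -> P x.
Proof.
move=> cA Ax0 Px0 loc x Ax.
pose B := A `&` P.
suff BA : B = A by move: Ax; rewrite -BA => -[].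
apply: cA; first by exists x0.
  - exists (\bigcup_(V in [set V : set T | open V /\ forall y z, A y -> A z -> V y -> V z -> P y -> P z] `&` [set V | exists2 y, V y & B y]) V).
      by apply: bigcup_open => V [[]].
    apply/seteqP; split=> y.
      move=> By; split; first by case: By.
      have [V] := loc _ By.1; rewrite nbhsE => -[W [oW Wy] WV] h.
      exists W => //; split; last by exists y.
      by split=> // u v Au Av /WV Wu /WV; exact: h.
    move=> [Ay [V [[oV h] [u Vu [Au Pu]]] Vy]]; split=> //; exact: (h u).
  - exists (~` \bigcup_(V in [set V : set T | open V /\ forall y z, A y -> A z -> V y -> V z -> P y -> P z] `&` [set V | exists2 y, V y & A y /\ ~ P y]) V).
      by apply: open_closedC; apply: bigcup_open => V [[]].
    apply/seteqP; split=> y.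
      move=> [Ay Py]; split=> // -[V [[oV h] [u Vu [Au Pu]]] Vy].
      by apply: Pu; exact: (h y).
    move=> [Ay ny]; split=> //; apply: contrapT => nPy; apply: ny.
    have [V] := loc _ Ay; rewrite nbhsE => -[W [oW Wy] WV] h.
    exists W => //; split; last by exists y.
    by split=> // u v Au Av /WV Wu /WV; exact: h.
Qed.

(** * Epsilon forms of open and closed sets, accumulation points, compactness *)

Section Top.
Variable R : realType.
Local Notation C := (Cplx R).
Implicit Types (x y z : C) (A K : set C).

Lemma interval_ind (I : set R) (P : R -> Prop) (t0 : R) :
  is_interval I -> I t0 -> P t0 ->
  (forall t, I t -> exists2 d, 0 < d &
     forall u v, I u -> I v -> `|u - t| < d -> `|v - t| < d -> P u -> P v) ->
  forall t, I t -> P t.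
Proof.
move=> /connected_intervalP cI I0 P0 loc; apply: (connected_ind cI I0 P0) => t It.
have [d d0 h] := loc _ It; exists (ball t d); first exact: nbhsx_ballx.
by move=> u v Iu Iv; rewrite /ball /= ![`|t - _|]distrC; exact: h.
Qed.

Lemma open_nmP A : open A <->
  forall z, A z -> exists2 e : R, 0 < e & forall y, nm (y - z) < e -> A y.
Proof.
rewrite openE; split=> h z Az; first by apply/nbhs_nmP; exact: h.
by apply/nbhs_nmP/h.
Qed.

Lemma closure_nmP A z : closure A z <->
  forall e : R, 0 < e -> exists2 y, A y & nm (y - z) < e.
Proof.
split=> [cz e e0|h B /nbhs_nmP[e e0 eB]].
  have [|y [Ay]] := cz [set y | nm (y - z) < e]; first by apply/nbhs_nmP; exists e.
  by exists y.
by have [y Ay yz] := h _ e0; exists y; split => //; exact: eB.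
Qed.

Lemma closed_nmP A : closed A <->
  forall z, (forall e : R, 0 < e -> exists2 y, A y & nm (y - z) < e) -> A z.
Proof. by split=> [cA z h|h z /closure_nmP]; [apply/cA/closure_nmP|exact: h]. Qed.

Definition bdd A := exists M : R, forall z, A z -> nm z <= M.

Lemma bdd_boundedP A : bounded_set A <-> bdd A.
Proof.
split.
  move=> [M [Mr h]].
  have Me : M = rc (complex.Re M).
    apply: eq_Cplx => //=; move: Mr; rewrite realE lecE => /orP[/andP[/eqP//]|].
    by rewrite lecE => /andP[/eqP].
  have [M' MM'] : exists M' : R, M < rc M'.
    by exists (complex.Re M + 1); rewrite {1}Me lt_rc ltrDl.
  exists M' => z Az; have /= := h _ MM' _ Az; rewrite nm_norm le_rc; exact.
move=> [M h]; exists (rc M); split; first by rewrite realE -rc0 !le_rc; case: ltgtP.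
move=> x Mx z Az /=; rewrite nm_norm.
apply: (le_trans _ (ltW Mx)); rewrite le_rc; exact: h.
Qed.

Lemma bddR_boundedP (A : set R) : bounded_set A <-> exists M : R, forall t, A t -> `|t| <= M.
Proof.
split=> [[M [_ h]]|[M h]].
  by exists (M + 1) => t At; apply: (h (M + 1)) => //; rewrite ltrDl.
exists M; split => [|x Mx t At]; first exact: num_real.
by apply: (le_trans _ (ltW Mx)); exact: h.
Qed.

(** Bolzano-Weierstrass, drawn from the compactness of a square in [R * R]. *)
Lemma accu (u : nat -> C) (M : R) : (forall n, nm (u n) <= M) ->
  exists z, forall e, 0 < e -> forall N, exists2 n, (N <= n)%N & nm (u n - z) < e.
Proof.
move=> uM.
have cK : compact (`[- M, M]%classic `*` `[- M, M]%classic : set (R * R)).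
  by apply: compact_setX; exact: segment_compact.
pose v n := (complex.Re (u n), complex.Im (u n)).
have [|[a b] [_ cl]] := cK (v @ \oo) _.
  exists 0%N => // n _; split; rewrite /= in_itv /= -ler_norml.
    by apply: (le_trans (ler_Re _)); exact: uM.
  by apply: (le_trans (ler_Im _)); exact: uM.
exists (Complex a b) => e e0 N.
have [] := cl (v @` [set n | (N <= n)%N]) ((ball a (e / 2)) `*` (ball b (e / 2))).
- by exists N => // n /= Nn; exists n.
- by exists (ball a (e/2), ball b (e/2)) => //=; split; apply: nbhsx_ballx; rewrite divr_gt0.
move=> _ [[n /= Nn <-]] [/= ba bb]; exists n => //.
rewrite (le_lt_trans (nm_le_ReIm _)) // !(ReD, ImD, ReN, ImN) /= (splitr e).
by rewrite ltrD // distrC.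
Qed.

Lemma accuK (K : set C) (u : nat -> C) : closed K -> bdd K -> (forall n, K (u n)) ->
  exists2 z, K z & forall e, 0 < e -> forall N, exists2 n, (N <= n)%N & nm (u n - z) < e.
Proof.
move=> cK [M KM] Ku; have [z hz] := accu (fun n => KM _ (Ku n)).
exists z => //; move/closed_nmP: cK; apply => e e0.
by have [n _ ne] := hz _ e0 0%N; exists (u n).
Qed.

Lemma invn_lt (e : R) : 0 < e -> exists N, forall n, (N <= n)%N -> n.+1%:R^-1 < e.
Proof.
move=> e0; exists (Num.truncn e^-1) => n Nn.
rewrite invf_plt ?posrE //; apply: (lt_le_trans (truncnS_gt _)).
by rewrite ler_nat ltnS.
Qed.

(** Points where the constants [1 / (n + 1)] fail would accumulate in [K], against the local choice
    of a constant at the accumulation point. *)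
Lemma uniform_on K (P : R -> C -> Prop) : closed K -> bdd K ->
  (forall d d' y, d' <= d -> P d y -> P d' y) ->
  (forall x, K x -> exists2 r, 0 < r & exists2 d, 0 < d & forall y, K y -> nm (y - x) < r -> P d y) ->
  exists2 d, 0 < d & forall y, K y -> P d y.
Proof.
move=> cK bK mono loc; apply: contrapT => H.
have {}H n : exists y, K y /\ ~ P n.+1%:R^-1 y.
  apply: contrapT => H1; apply: H; exists n.+1%:R^-1 => // y Ky.
  by apply: contrapT => nP; apply: H1; exists y.
have [u hu] := choice H.
have [z Kz hz] := accuK cK bK (fun n => (hu n).1).
have [r r0 [d d0 h]] := loc _ Kz.
have [N hN] := invn_lt d0.
have [n Nn un] := hz _ r0 N.
by apply: (hu n).2; apply: (mono d); [rewrite ltW ?hN|apply: h => //; exact: (hu n).1].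
Qed.

Definition ccontR (f : C -> R) x :=
  forall e, 0 < e -> exists2 d, 0 < d & forall y, nm (y - x) < d -> `|f y - f x| < e.

Lemma min_attained K (f : C -> R) : closed K -> bdd K -> K !=set0 ->
  (forall x, K x -> ccontR f x) ->
  exists2 z, K z & forall y, K y -> f z <= f y.
Proof.
move=> cK bK [x0 Kx0] cf.
(* The lower bound is written [- d^-1], so that a smaller [d] makes a weaker claim, as [uniform_on]
   demands. *)
have [d d0 hd] : exists2 d, 0 < d & forall y, K y -> 0 < d -> - d^-1 <= f y.
  apply: (@uniform_on K (fun d y => 0 < d -> - d^-1 <= f y)) => //.
    move=> d d' y dd h d'0; have d0 := lt_le_trans d'0 dd.
    by apply: (le_trans _ (h d0)); rewrite lerN2 lef_pV2 ?posrE.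
  move=> x Kx; have [r r0 hr] := cf _ Kx 1 ltr01.
  have a0 : 0 < 1 + `|f x| by rewrite ltr_pwDl.
  exists r => //; exists (1 + `|f x|)^-1; first by rewrite invr_gt0.
  move=> y Ky /hr; rewrite ltr_norml => /andP[h _] _; rewrite invrK.
  by have h2 : - `|f x| <= f x := lerNnormlW (lexx _); lra.
have inff : has_inf (f @` K).
  by split; [exists (f x0), x0|exists (- d^-1) => _ [y Ky <-]; exact: hd].
pose m := inf (f @` K).
have mle y : K y -> m <= f y by move=> Ky; apply: ge_inf; [exact: inff.2|exists y].
have H n : exists y, K y /\ f y < m + n.+1%:R^-1.
  have [|_ [y Ky <-] yl] := @inf_adherent _ (f @` K) n.+1%:R^-1 _ inff.
    by rewrite invr_gt0.
  by exists y.
have [u hu] := choice H.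
have [z Kz hz] := accuK cK bK (fun n => (hu n).1).
exists z => // y Ky; apply: (le_trans _ (mle _ Ky)).
apply/ler_addgt0Pr => e e0; have e2 : 0 < e / 2 by rewrite divr_gt0.
have [r r0 hr] := cf _ Kz _ e2.
have [N hN] := invn_lt e2.
have [n Nn /hr] := hz _ r0 N; rewrite ltr_norml => /andP[h1 h2].
have := hN _ Nn; have := (hu n).2; clearbody m; move: n.+1%:R^-1 => w; ilra.
Qed.
End Top.

(** * Derivatives of curves and of holomorphic functions *)

Section Deriv.
Variable R : realType.
Local Notation C := (Cplx R).
Implicit Types (x y z : C).

(** The difference quotient is multiplied out, which admits [h = 0]. In [cder] the increment is real
    and the value complex, in [hol] both are complex; the estimates are otherwise the same. *)
Definition rder (f : R -> R) (t v : R) := forall e : R, 0 < e ->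
  exists2 d : R, 0 < d & forall h : R, `|h| < d -> `|f (t + h) - f t - h * v| <= e * `|h|.

Definition cder (f : R -> C) (t : R) (v : C) := forall e : R, 0 < e ->
  exists2 d : R, 0 < d & forall h : R, `|h| < d ->
    nm (f (t + h) - f t - rc h * v) <= e * `|h|.

Definition hol (f : C -> C) (z l : C) := forall e : R, 0 < e ->
  exists2 d : R, 0 < d & forall h : C, nm h < d ->
    nm (f (z + h) - f z - h * l) <= e * nm h.

Lemma is_derive_rder (f : R -> R) (t v : R) : is_derive t 1 f v <-> rder f t v.
Proof.
split=> [[df Df] e e0|h].
  have : (fun h : R => h^-1 *: (f (h *: 1 + t) - f t)) @ 0^' --> v.
    by rewrite -Df; exact: df.
  move=> /cvgrPdist_le /(_ _ e0) => /nbhs_ballP[d /= d0 hd].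
  exists d => // h hlt; have [->|hn0] := eqVneq h 0.
    by rewrite addr0 mul0r subrr subr0 normr0 mulr0.
  have /= := hd h; rewrite /ball /= sub0r normrN => /(_ hlt hn0).
  rewrite scaler1 [h + t]addrC distrC /GRing.scale /= => H.
  have -> : f (t + h) - f t - h * v = h * (h^-1 * (f (t + h) - f t) - v).
    by rewrite mulrBr mulVKf.
  by rewrite normrM mulrC ler_wpM2r.
have cv : (fun h : R => h^-1 *: (f (h *: 1 + t) - f t)) @ 0^' --> v.
  apply/cvgrPdist_le => e e0; have [d d0 hd] := h _ e0.
  apply/nbhs_ballP; exists d => //= k.
  rewrite /ball /= sub0r normrN => kd kn0.
  rewrite scaler1 [k + t]addrC distrC /GRing.scale /=.
  have -> : k^-1 * (f (t + k) - f t) - v = k^-1 * (f (t + k) - f t - k * v).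
    by rewrite [RHS]mulrBr mulKf.
  have k0 : 0 < `|k| by rewrite normr_gt0.
  rewrite normrM normfV ler_pdivrMl // [leRHS]mulrC; exact: hd.
split; first by apply/cvg_ex; exists v.
exact: (cvg_lim _ cv).
Qed.

Lemma derivable_hol (F : C -> C) z : derivable F z 1 -> exists l, hol F z l.
Proof.
move=> /cvg_ex[l /= H]; exists l => e e0.
have /H : nbhs l [set y | nm (y - l) < e] by apply/nbhs_nmP; exists e.
move=> /= H1.
have /nbhs_nmP[d d0 hd] : nbhs (0 : C) [set h : C | h != 0 -> nm (h^-1 *: (F (h *: 1 + z) - F z) - l) < e].
  exact: H1.
exists d => // h hlt; have [->|hn0] := eqVneq h 0.
  by rewrite addr0 mul0r subrr subr0 nm0 mulr0.
have /= := hd h; rewrite subr0 => /(_ hlt hn0).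
rewrite scaler1 [h + z]addrC /GRing.scale /= => /ltW {}H.
have -> : F (z + h) - F z - h * l = h * (h^-1 * (F (z + h) - F z) - l).
  by rewrite mulrBr mulVKf.
by rewrite nmM mulrC ler_wpM2r // nm_ge0.
Qed.

(** The factor [c] selects a real direction: [- i] gives the imaginary part, and the conjugate of an
    increment gives the component along that increment. *)
Lemma cder_Re (f : R -> C) t v (c : C) : cder f t v ->
  rder (fun s => complex.Re (c * f s)) t (complex.Re (c * v)).
Proof.
move=> H e e0; have n0 : 0 < nm c + 1 by rewrite ltr_wpDl ?nm_ge0.
have [d d0 hd] := H (e / (nm c + 1)) (divr_gt0 e0 n0).
exists d => // h /hd H1.
have -> : complex.Re (c * f (t + h)) - complex.Re (c * f t) - h * complex.Re (c * v) =
   complex.Re (c * (f (t + h) - f t - rc h * v)).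
  by rewrite !(ReM, ReD, ReN, ImM, ImD, ImN) /=; ring.
rewrite (le_trans (ler_Re _)) // nmM.
apply: (@le_trans _ _ ((nm c + 1) * (e / (nm c + 1) * `|h|))).
  by rewrite ler_pM ?nm_ge0 // lerDl.
by rewrite mulrA [_ * (e / _)]mulrC divfK // gt_eqF.
Qed.

Lemma cder_curve (f : R -> C) (t : R) (v : C) :
  (is_derive t 1 (fun s => complex.Re (f s)) (complex.Re v) /\
   is_derive t 1 (fun s => complex.Im (f s)) (complex.Im v)) <-> cder f t v.
Proof.
split=> [[/is_derive_rder H1 /is_derive_rder H2] e e0|H].
  have e2 : 0 < e / 2 by rewrite divr_gt0.
  have [d1 d10 h1] := H1 _ e2; have [d2 d20 h2] := H2 _ e2.
  exists (Num.min d1 d2); first by rewrite lt_min d10.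
  move=> h; rewrite lt_min => /andP[/h1 {}h1 /h2 {}h2].
  rewrite (le_trans (nm_le_ReIm _)) // !(ReM, ReD, ReN, ImM, ImD, ImN) /=.
  by rewrite !mul0r subr0 addr0 (splitr e) mulrDl lerD.
split; apply/is_derive_rder.
  have := cder_Re 1 H; rewrite mul1r; congr (rder _ _ _).
  by apply/funext => s; rewrite mul1r.
have := cder_Re (- ci R) H.
have E u : complex.Re (- ci R * u) = complex.Im u.
  by rewrite ReM ReN ImN /=; ring.
by rewrite E; congr (rder _ _ _); apply/funext => s; rewrite E.
Qed.

Definition ccont (f : R -> C) (t : R) := forall e : R, 0 < e ->
  exists2 d : R, 0 < d & forall s : R, `|s - t| < d -> nm (f s - f t) < e.

Definition zcont (f : C -> C) (z : C) := forall e : R, 0 < e ->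
  exists2 d : R, 0 < d & forall y, nm (y - z) < d -> nm (f y - f z) < e.

Lemma hol_cont f z l : hol f z l -> zcont f z.
Proof.
move=> H e e0; have [d d0 hd] := H 1 ltr01.
have n0 : 0 < nm l + 1 by rewrite ltr_wpDl ?nm_ge0.
have n1 : 0 < nm l + 1 + 1 by rewrite ltr_pwDl // ltW.
exists (Num.min d (e / (nm l + 1 + 1))); first by rewrite lt_min d0 divr_gt0.
move=> y; rewrite lt_min => /andP[yd ye].
have := hd _ yd; rewrite subrKC mul1r => H1.
have H2 : nm (f y - f z) <= nm (f y - f z - (y - z) * l) + nm ((y - z) * l).
  by have := nmD (f y - f z - (y - z) * l) ((y - z) * l); rewrite subrK.
apply: (le_lt_trans H2); rewrite nmM.
move: ye; rewrite ltr_pdivlMr // => ye.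
by have := nm_ge0 (y - z); ilra.
Qed.

Lemma cder_cont f t v : cder f t v -> ccont f t.
Proof.
move=> H e e0; have [d d0 hd] := H 1 ltr01.
have n0 : 0 < nm v + 1 by rewrite ltr_wpDl ?nm_ge0.
have n1 : 0 < nm v + 1 + 1 by rewrite ltr_pwDl // ltW.
exists (Num.min d (e / (nm v + 1 + 1))); first by rewrite lt_min d0 divr_gt0.
move=> y; rewrite lt_min => /andP[yd ye].
have := hd _ yd; rewrite subrKC mul1r => H1.
have H2 : nm (f y - f t) <= nm (f y - f t - rc (y - t) * v) + nm (rc (y - t) * v).
  by have := nmD (f y - f t - rc (y - t) * v) (rc (y - t) * v); rewrite subrK.
apply: (le_lt_trans H2); rewrite nmM nm_rc.
move: ye; rewrite ltr_pdivlMr // => ye.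
have h3 : 0 <= `|y - t| by [].
ilra.
Qed.

Lemma rder_MVT (f df : R -> R) (a b : R) : a <= b ->
  (forall t, a <= t <= b -> rder f t (df t)) ->
  exists2 c, a <= c <= b & f b - f a = df c * (b - a).
Proof.
move=> ab H; have [| |c cab ->] := @MVT_segment R f df a b ab.
- by move=> t; rewrite in_itv /= => /andP[/ltW h1 /ltW h2]; apply/is_derive_rder/H; rewrite h1.
- apply: derivable_within_continuous => t; rewrite in_itv /= => h.
  by have /is_derive_rder[] := H _ h.
by exists c.
Qed.

Lemma cder_MVI (f df : R -> C) (a b M : R) : a <= b ->
  (forall t, a <= t <= b -> cder f t (df t)) ->
  (forall t, a <= t <= b -> nm (df t) <= M) -> nm (f b - f a) <= M * (b - a).
Proof.
move=> ab H HM; set D := f b - f a.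
have [->|D0] := eqVneq D 0.
  rewrite nm0 mulr_ge0 ?subr_ge0 //; apply: (le_trans (nm_ge0 _) (HM a _)).
  by rewrite lexx.
(* The real mean value theorem is applied to the component along the increment [D] itself, whose
   total change is [nm D ^ 2]. *)
have [c cab] := rder_MVT ab (fun t tab => cder_Re (conjc D) (H _ tab)).
have -> : complex.Re (conjc D * f b) - complex.Re (conjc D * f a) = nm D * nm D.
  transitivity (complex.Re (D * conjc D)).
    by rewrite /D; case: (f b) (f a) => [? ?] [? ?] /=; ring.
  by rewrite conj_nm expr2.
move=> E; have nD : 0 < nm D by rewrite nm_gt0.
rewrite -(ler_pM2l nD) E mulrA ler_wpM2r ?subr_ge0 //.
rewrite (le_trans (ler_norm _)) // (le_trans (ler_Re _)) // nmM nm_conj.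
by rewrite ler_wpM2l ?nm_ge0 // HM.
Qed.

Lemma cderN f t v : cder f t v -> cder (fun s => - f s) t (- v).
Proof.
move=> H e e0; have [d d0 hd] := H _ e0; exists d => // h /hd.
by rewrite -nmN; congr (nm _ <= _); ring.
Qed.

Lemma cderD f g t v w : cder f t v -> cder g t w -> cder (fun s => f s + g s) t (v + w).
Proof.
move=> H1 H2 e e0; have e2 : 0 < e / 2 by rewrite divr_gt0.
have [d1 d10 h1] := H1 _ e2; have [d2 d20 h2] := H2 _ e2.
exists (Num.min d1 d2); first by rewrite lt_min d10.
move=> h; rewrite lt_min => /andP[/h1 {}h1 /h2 {}h2].
rewrite (splitr e) mulrDl (le_trans _ (lerD h1 h2)) // (le_trans _ (nmD _ _)) //.
by rewrite le_eqVlt; apply/orP; left; apply/eqP; congr nm; ring.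
Qed.

Lemma cder_lin (c w : C) t : cder (fun s => rc s * c + w) t c.
Proof.
move=> e e0; exists 1 => // h _; rewrite rcD.
rewrite (_ : _ - _ - _ = 0) ?nm0; last by ring.
by rewrite mulr_ge0 // ltW.
Qed.

Lemma cder_comp (f : C -> C) (g : R -> C) t l v :
  hol f (g t) l -> cder g t v -> cder (fun s => f (g s)) t (v * l).
Proof.
move=> H1 H2 e e0.
have l0 : 0 < nm l + 1 by rewrite ltr_wpDl ?nm_ge0.
have v0 : 0 < nm v + 1 by rewrite ltr_wpDl ?nm_ge0.
have e1 : 0 < e / 2 / (nm v + 1) by rewrite !divr_gt0.
have e2 : 0 < Num.min 1 (e / 2 / (nm l + 1)) by rewrite lt_min ltr01 !divr_gt0.
have [d1 d10 h1] := H1 _ e1; have [d2 d20 h2] := H2 _ e2.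
have [d3 d30 h3] := cder_cont H2 d10.
exists (Num.min d2 d3); first by rewrite lt_min d20.
move=> h; rewrite lt_min => /andP[/h2 {}h2 hd3].
have {}hd3 : nm (g (t + h) - g t) < d1 by apply: h3; rewrite addrC addKr.
have := h1 _ hd3; rewrite subrKC; set k := g (t + h) - g t => H.
have kb : nm k <= (nm v + 1) * `|h|.
  have := nmD (k - rc h * v) (rc h * v); rewrite subrK nmM nm_rc => A.
  apply: (le_trans A); rewrite mulrDl mul1r addrC mulrC lerD2l.
  by apply: (le_trans h2); rewrite ler_piMl // ge_min lexx.
have A : nm (f (g (t + h)) - f (g t) - rc h * (v * l)) <=
   nm (f (g (t + h)) - f (g t) - k * l) + nm (k - rc h * v) * nm l.
  rewrite -nmM (le_trans _ (nmD _ _)) // le_eqVlt; apply/orP; left; apply/eqP.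
  by congr nm; ring.
apply: (le_trans A); rewrite (splitr e) [(_ / 2 + _) * _]mulrDl lerD //.
  apply: (le_trans H); apply: (@le_trans _ _ (e / 2 / (nm v + 1) * ((nm v + 1) * `|h|))).
    by rewrite ler_wpM2l // ltW.
  by rewrite mulrA divfK // gt_eqF.
apply: (@le_trans _ _ (e / 2 / (nm l + 1) * `|h| * (nm l + 1))).
  rewrite ler_pM ?nm_ge0 //; last by rewrite lerDl.
  by apply: (le_trans h2); rewrite ler_wpM2r // ge_min lexx orbT.
by rewrite mulrAC divfK // gt_eqF.
Qed.

Lemma cder_shift f t (s : R) v : cder f (t + s) v -> cder (fun u => f (u + s)) t v.
Proof.
move=> H e e0; have [d d0 hd] := H _ e0; exists d => // h /hd.
by rewrite [t + h + s]addrAC.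
Qed.

Lemma cder_near (f g : R -> C) (t : R) (v : C) : (exists2 d : R, 0 < d & forall s, `|s - t| < d -> f s = g s) ->
  cder f t v -> cder g t v.
Proof.
move=> [d d0 fg] H e e0; have [d1 d10 h1] := H _ e0.
exists (Num.min d d1); first by rewrite lt_min d0.
move=> h; rewrite lt_min => /andP[hd /h1].
rewrite -!fg //; first by rewrite subrr normr0.
by rewrite addrC addKr.
Qed.

Lemma hol_mulc f (c : C) z l : hol f z l -> hol (fun y => c * f y) z (c * l).
Proof.
move=> H e e0; have n0 : 0 < nm c + 1 by rewrite ltr_wpDl ?nm_ge0.
have [d d0 hd] := H (e / (nm c + 1)) (divr_gt0 e0 n0).
exists d => // h /hd H1.
have -> : c * f (z + h) - c * f z - h * (c * l) = c * (f (z + h) - f z - h * l) by ring.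
rewrite nmM; apply: (@le_trans _ _ ((nm c + 1) * (e / (nm c + 1) * nm h))).
  by rewrite ler_pM ?nm_ge0 // lerDl.
by rewrite mulrA [_ * (e / _)]mulrC divfK // gt_eqF.
Qed.

Lemma hol_inv f z l : hol f z l -> f z != 0 -> hol (fun y => (f y)^-1) z (- l / f z ^+ 2).
Proof.
move=> H fz0.
have nz0 : 0 < nm (f z) by rewrite nm_gt0.
move=> e e0; set m := nm (f z).
have m2 : 0 < m / 2 by rewrite divr_gt0.
have m3 : 0 < m ^+ 2 by rewrite exprn_gt0.
have l0 : 0 < nm l + 1 by rewrite ltr_wpDl ?nm_ge0.
have e1 : 0 < e / 2 * m ^+ 2 / 2 by rewrite !(divr_gt0, mulr_gt0).
have e3 : 0 < e / 2 * m * m ^+ 2 / 2 / (nm l + 1) by rewrite !(divr_gt0, mulr_gt0).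
have [d1 d10 h1] := H _ e1.
have [d2 d20 h2] := hol_cont H m2.
have [d3 d30 h3] := hol_cont H e3.
exists (Num.min d1 (Num.min d2 d3)); first by rewrite !lt_min d10 d20.
move=> h; rewrite !lt_min => /and3P[/h1 {}h1 hd2 hd3].
have {}h2 : nm (f (z + h) - f z) < m / 2 by apply: h2; rewrite addrC addKr.
have {}h3 : nm (f (z + h) - f z) < e / 2 * m * m ^+ 2 / 2 / (nm l + 1).
  by apply: h3; rewrite addrC addKr.
have fb : m / 2 <= nm (f (z + h)).
  have := nmB (f (z + h)) (f (z + h) - f z).
  rewrite opprB addrC subrK -/m => A.
  by rewrite -(lerD2r (m / 2)) -splitr (le_trans A) // lerD2l ltW.
have fn0 : f (z + h) != 0.
  by rewrite -nm_gt0 (lt_le_trans m2).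
set g := f (z + h) in h1 h2 h3 fb fn0 *; set w := f z in fz0 nz0 h1 h2 h3 *.
have -> : g^-1 - w^-1 - h * (- l / w ^+ 2) =
   - (g - w - h * l) / (g * w) + h * l * (g - w) / (g * w ^+ 2).
  by field; rewrite fn0 fz0.
rewrite (le_trans (nmD _ _)) // (splitr e) mulrDl lerD //.
  rewrite nmM nmN nmV nmM -/m ler_pdivrMr ?mulr_gt0 ?nm_gt0 //.
  apply: (le_trans h1).
  have -> : e / 2 * m ^+ 2 / 2 * nm h = e / 2 * nm h * (m / 2 * m) by field.
  by rewrite ler_wpM2l ?mulr_ge0 ?nm_ge0 ?(ltW e0) // ler_wpM2r ?nm_ge0.
rewrite nmM nmV !nmM -/m ler_pdivrMr ?mulr_gt0 ?nm_gt0 //.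
have -> : e / 2 * nm h * (nm g * (m * m)) = nm h * (e / 2 * (m * m) * nm g) by ring.
rewrite -mulrA ler_wpM2l ?nm_ge0 //.
apply: (@le_trans _ _ ((nm l + 1) * (e / 2 * m * m ^+ 2 / 2 / (nm l + 1)))).
  by rewrite ler_pM ?nm_ge0 ?ltW // ltrDl.
have -> : (nm l + 1) * (e / 2 * m * m ^+ 2 / 2 / (nm l + 1)) = e / 2 * (m * m) * (m / 2).
  by field; rewrite gt_eqF.
by rewrite ler_wpM2l // !mulr_ge0 ?nm_ge0 ?(ltW e0).
Qed.

Lemma rder_anti (f : R -> R) (a b : R) : a < b ->
  (forall t, a <= t <= b -> {for t, continuous f}) ->
  exists G : R -> R, forall t, a < t < b -> rder G t (f t).
Proof.
move=> ab cf.
have fi : lebesgue_measure.-integrable `[a, b] (EFin \o f).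
  apply: continuous_compact_integrable; first exact: segment_compact.
  apply: continuous_in_subspaceT => t; rewrite inE /= in_itv /= => /cf; exact.
exists (fun u : R => (\int[lebesgue_measure]_(t in `[a, u]) (f t))%R) => t /andP[at_ tb].
have [|d1 d2] := @continuous_FTC1_closed R f a t b tb fi at_.
  by apply: cf; rewrite !ltW.
move: d1 d2; set G := (X in derivable X) => d1 d2.
apply/is_derive_rder; split; first exact: d1.
by rewrite -derive1E; exact: d2.
Qed.

Lemma ccont_Re f t : ccont f t -> {for t, continuous (fun s => complex.Re (f s))}.
Proof.
move=> H; apply/cvgrPdist_lt => e e0; have [d d0 hd] := H _ e0.
apply/nbhs_ballP; exists d => // s; rewrite /ball /= distrC => /hd.
by rewrite nmBC; apply: le_lt_trans; rewrite -ReN -ReD; exact: ler_Re.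
Qed.

Lemma ccont_Im f t : ccont f t -> {for t, continuous (fun s => complex.Im (f s))}.
Proof.
move=> H; apply/cvgrPdist_lt => e e0; have [d d0 hd] := H _ e0.
apply/nbhs_ballP; exists d => // s; rewrite /ball /= distrC => /hd.
by rewrite nmBC; apply: le_lt_trans; rewrite -ImN -ImD; exact: ler_Im.
Qed.

Lemma cder_anti (f : R -> C) (a b : R) : a < b ->
  (forall t, a <= t <= b -> ccont f t) ->
  exists G : R -> C, forall t, a < t < b -> cder G t (f t).
Proof.
move=> ab cf.
have [G1 H1] := rder_anti ab (fun t tab => ccont_Re (cf t tab)).
have [G2 H2] := rder_anti ab (fun t tab => ccont_Im (cf t tab)).
exists (fun t => Complex (G1 t) (G2 t)) => t tab; apply/cder_curve.
by split; apply/is_derive_rder; [exact: H1|exact: H2].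
Qed.

End Deriv.

(** * Primitives in a square (Goursat) *)

Section Goursat.
Variable R : realType.
Local Notation C := (Cplx R).
Implicit Types (z : C).

Lemma cder_MVI2 (f df : R -> C) (t h M : R) (w : C) :
  (forall s : R, `|s - t| <= `|h| -> cder f s (df s) /\ nm (df s - w) <= M) ->
  nm (f (t + h) - f t - rc h * w) <= M * `|h|.
Proof.
move=> H.
have K (a b : R) : a <= b -> (forall s, a <= s <= b -> `|s - t| <= `|h|) ->
    nm (f b - f a - rc (b - a) * w) <= M * (b - a).
  move=> ab I.
  have := @cder_MVI R (fun s => f s + (rc s * - w + 0)) (fun s => df s - w) a b M ab.
  have -> : f b + (rc b * - w + 0) - (f a + (rc a * - w + 0)) = f b - f a - rc (b - a) * w.
    by rewrite rcB; ring.
  apply => s /I /H[] //; move=> d _; apply: cderD => //; exact: cder_lin.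
case: (lerP 0 h) => h0.
  have := K t (t + h); rewrite lerDl [t + h - t]addrC addKr (ger0_norm h0) => /(_ h0); apply.
  move=> s /andP[s1 s2]; rewrite ger0_norm ?subr_ge0 //.
  by rewrite lerBlDl.
have := K (t + h) t; rewrite gerDl => /(_ (ltW h0)).
have -> : t - (t + h) = - h by rewrite opprD addrA subrr add0r.
have -> : nm (f t - f (t + h) - rc (- h) * w) = nm (f (t + h) - f t - rc h * w).
  by rewrite -nmN; congr nm; rewrite rcN; ring.
rewrite (ltr0_norm h0) => ->; rewrite // => s /andP[s1 s2].
by rewrite ler0_norm ?subr_le0 //; lra.
Qed.

Lemma nested_intervals (a b : nat -> R) :
  (forall n, a n <= a n.+1 /\ b n.+1 <= b n) -> (forall n, a n <= b n) ->
  exists x, forall n, a n <= x <= b n.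
Proof.
move=> mono ab.
have amono m n : (m <= n)%N -> a m <= a n.
  elim: n => [|n IH]; first by rewrite leqn0 => /eqP ->.
  rewrite leq_eqVlt => /orP[/eqP -> //|/IH h]; exact: (le_trans h (mono n).1).
have bmono m n : (m <= n)%N -> b n <= b m.
  elim: n => [|n IH]; first by rewrite leqn0 => /eqP ->.
  rewrite leq_eqVlt => /orP[/eqP -> //|/IH]; exact: (le_trans (mono n).2).
have amb m n : a m <= b n.
  have := amono m (maxn m n) (leq_maxl _ _); have := bmono n (maxn m n) (leq_maxr _ _).
  by move=> h1 h2; apply: (le_trans h2); apply: (le_trans (ab _)).
have hs : has_sup (range a).
  by split; [exists (a 0%N), 0%N|exists (b 0%N) => _ [n _ <-]].
exists (sup (range a)) => n; apply/andP; split.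
  by apply: ub_le_sup; [exact: hs.2|exists n].
by apply: ge_sup; [exact: hs.1|move=> _ [m _ <-]].
Qed.

Section Rect.
Variables (f : C -> C) (q : C) (rho : R).
Hypothesis rho0 : 0 < rho.
Let pt (x y : R) : C := q + (rc x + ci R * rc y).
Hypothesis fhol : forall x y : R, `|x| <= rho + rho -> `|y| <= rho + rho ->
  exists l, hol f (pt x y) l.

Let ptB x y x' y' : nm (pt x y - pt x' y') <= `|x - x'| + `|y - y'|.
Proof.
have -> : pt x y - pt x' y' = Complex (x - x') (y - y').
  by rewrite mkE !rcB /pt; ring.
exact: nm_le_ReIm.
Qed.

Let fcontx x y : `|x| <= rho + rho -> `|y| <= rho + rho -> ccont (fun s => f (pt s y)) x.
Proof.
move=> hx hy e e0; have [l /hol_cont/(_ _ e0)[d d0 hd]] := fhol hx hy.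
by exists d => // s sx; apply: hd; rewrite (le_lt_trans (ptB _ _ _ _)) // subrr normr0 addr0.
Qed.

Let fconty x y : `|x| <= rho + rho -> `|y| <= rho + rho -> ccont (fun s => f (pt x s)) y.
Proof.
move=> hx hy e e0; have [l /hol_cont/(_ _ e0)[d d0 hd]] := fhol hx hy.
by exists d => // s sx; apply: hd; rewrite (le_lt_trans (ptB _ _ _ _)) // subrr normr0 add0r.
Qed.

Let rr0 : - (rho + rho) < rho + rho.
Proof. by rewrite gtrN // addr_gt0. Qed.

Let exA (y : R) : exists G : R -> C, `|y| <= rho + rho ->
  forall x : R, `|x| < rho + rho -> cder G x (f (pt x y)).
Proof.
have [hy|hy] := pselect (`|y| <= rho + rho); last by exists (fun _ => 0).
have [|G HG] := @cder_anti R (fun s => f (pt s y)) _ _ rr0.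
  by move=> t; rewrite -ler_norml => ht; exact: fcontx.
by exists G => _ x; rewrite ltr_norml; exact: HG.
Qed.

Let exB (x : R) : exists G : R -> C, `|x| <= rho + rho ->
  forall y : R, `|y| < rho + rho -> cder G y (f (pt x y)).
Proof.
have [hx|hx] := pselect (`|x| <= rho + rho); last by exists (fun _ => 0).
have [|G HG] := @cder_anti R (fun s => f (pt x s)) _ _ rr0.
  by move=> t; rewrite -ler_norml => ht; exact: fconty.
by exists G => _ y; rewrite ltr_norml; exact: HG.
Qed.

Let A : R -> R -> C := projT1 (choice exA).
Let B : R -> R -> C := projT1 (choice exB).

Let hA x y : `|x| < rho + rho -> `|y| < rho + rho -> cder (A y) x (f (pt x y)).
Proof. by move=> hx hy; apply: (projT2 (choice exA) y _ x hx); exact: ltW. Qed.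

Let hB x y : `|x| < rho + rho -> `|y| < rho + rho -> cder (B x) y (f (pt x y)).
Proof. by move=> hx hy; apply: (projT2 (choice exB) x _ y hy); exact: ltW. Qed.

Let rect := (R * R * (R * R))%type.

(** The counterclockwise integral of [f] along the boundary of the rectangle [[a, b] x [c, d]], read
    off from antiderivatives: [A y] on the horizontal line at height [y], [B x] on the vertical line
    at [x]. These are chosen independently on each line; only differences along one line occur, so
    the constants drop out. *)
Definition rect_integral (T : rect) : C :=
  let: (a, b, (c, d)) := T in
  (A c b - A c a) + ci R * (B b d - B b c) - (A d b - A d a) - ci R * (B a d - B a c).
Let W := rect_integral.

Let quarter (i j : bool) (T : rect) : rect :=
  let: (a, b, (c, d)) := T in
  let u := (a + b) / 2 in let v := (c + d) / 2 in
  ((if i then a else u), (if i then u else b), ((if j then c else v), (if j then v else d))).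

Let W_split T : W T = W (quarter true true T) + W (quarter true false T) +
  W (quarter false true T) + W (quarter false false T).
Proof. case: T => [[a b] [c d]] /=; ring. Qed.

Let step T : exists T', (exists i j, T' = quarter i j T) /\ nm (W T) <= 4 * nm (W T').
Proof.
apply: contrapT => H.
have K i j : 4 * nm (W (quarter i j T)) < nm (W T).
  rewrite ltNge; apply/negP => h; apply: H; exists (quarter i j T); split=> //.
  by exists i, j.
have := nmD (W (quarter true true T) + W (quarter true false T) +
  W (quarter false true T)) (W (quarter false false T)).
have := nmD (W (quarter true true T) + W (quarter true false T)) (W (quarter false true T)).
have := nmD (W (quarter true true T)) (W (quarter true false T)).
rewrite -W_split.
have := K true true; have := K true false; have := K false true; have := K false false.
ilra.
Qed.

Let good (T : rect) (s : R) := let: (a, b, (c, d)) := T in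
  [/\ - s <= a, a <= b, b <= s & [/\ - s <= c, c <= d & d <= s]].

(** The quadratic polynomial [p] is a primitive of the linear expansion of [f] at [(x, y)], so its
    contributions cancel around the rectangle. What remains is at most [e * l'] times the perimeter
    [2 * l']. *)
Let W_small T s (x y : R) (l : C) (e l' : R) : good T s -> s < rho + rho -> 0 <= e ->
  let: (a, b, (c, d)) := T in
  l' = (b - a) + (d - c) ->
  a <= x <= b -> c <= y <= d ->
  (forall z, nm (z - pt x y) <= l' -> nm (f z - f (pt x y) - (z - pt x y) * l) <= e * l') ->
  nm (W T) <= 2 * e * l' ^+ 2.
Proof.
case: T => [[a b] [c d]] /= [sa ab bs [sc cd ds]] sr e0 lE /andP[ax xb] /andP[cy yd] H.
pose z0 := pt x y.
pose p z := f z0 * (z - z0) + l * (z - z0) ^+ 2 / 2.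
have px (v t : R) : cder (fun s => p (pt s v)) t (f z0 + l * (pt t v - z0)).
  move=> k k0; exists (k / (nm l + 1)).
    by rewrite divr_gt0 // ltr_wpDl // nm_ge0.
  move=> h; rewrite ltr_pdivlMr; last by rewrite ltr_wpDl // nm_ge0.
  move=> hk; have -> : p (pt (t + h) v) - p (pt t v) - rc h * (f z0 + l * (pt t v - z0)) =
    l * (rc h * rc h) / 2 by rewrite /p /pt rcD; field.
  rewrite !nmM nmV !nm_rc (_ : (2 : C) = rc 2) ?nm_rc; last by rewrite -[2]/(1 + 1) rcD.
  rewrite (ger0_norm (ler0n R 2)).
  have -> : nm l * (`|h| * `|h|) / 2 = (nm l / 2 * `|h|) * `|h| by field.
  rewrite ler_wpM2r //.
  have := nm_ge0 l; have : 0 <= `|h| by []; move: hk.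
  move: (nm l) `|h| => u w hk w0 u0.
  have : 0 <= u * w by rewrite mulr_ge0.
  ilra.
have py (v t : R) : cder (fun s => p (pt v s)) t (ci R * (f z0 + l * (pt v t - z0))).
  move=> k k0; exists (k / (nm l + 1)).
    by rewrite divr_gt0 // ltr_wpDl // nm_ge0.
  move=> h; rewrite ltr_pdivlMr; last by rewrite ltr_wpDl // nm_ge0.
  move=> hk; have -> : p (pt v (t + h)) - p (pt v t) - rc h * (ci R * (f z0 + l * (pt v t - z0))) =
    l * (rc h * rc h) / 2 * (ci R * ci R) by rewrite /p /pt rcD; field.
  rewrite !nmM nmV !nm_rc nm_ci !mulr1 (_ : (2 : C) = rc 2) ?nm_rc; last by rewrite -[2]/(1 + 1) rcD.
  rewrite (ger0_norm (ler0n R 2)).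
  have -> : nm l * (`|h| * `|h|) / 2 = (nm l / 2 * `|h|) * `|h| by field.
  rewrite ler_wpM2r //.
  have := nm_ge0 l; have : 0 <= `|h| by []; move: hk.
  move: (nm l) `|h| => u w hk w0 u0.
  have : 0 <= u * w by rewrite mulr_ge0.
  ilra.
have near (u v : R) : a <= u <= b -> c <= v <= d -> nm (pt u v - z0) <= l'.
  move=> /andP[au ub] /andP[cv vd]; rewrite (le_trans (ptB _ _ _ _)) // lE lerD //.
    by rewrite ler_norml; lra.
  by rewrite ler_norml; lra.
have lt1 (u : R) : - s <= u -> u <= s -> `|u| < rho + rho.
  by move=> h1 h2; apply: le_lt_trans sr; rewrite ler_norml h1.
have Ha v : c <= v <= d ->
   nm ((A v b - p (pt b v)) - (A v a - p (pt a v))) <= e * l' * (b - a).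
  move=> cvd; have [cv vd] := andP cvd.
  apply: (@cder_MVI R (fun t => A v t - p (pt t v)) (fun t => f (pt t v) - (f z0 + l * (pt t v - z0)))) => //.
    move=> t /andP[at_ tb]; apply: cderD; last exact: cderN.
    by apply: hA; apply: lt1; lra.
  move=> t tab; rewrite opprD addrA [l * _]mulrC; apply: H; exact: near.
have Hb v : a <= v <= b ->
   nm ((ci R * B v d - p (pt v d)) - (ci R * B v c - p (pt v c))) <= e * l' * (d - c).
  move=> cvd; have [cv vd] := andP cvd.
  apply: (@cder_MVI R (fun t => ci R * B v t - p (pt v t)) (fun t => ci R * f (pt v t) - ci R * (f z0 + l * (pt v t - z0)))) => //.
    move=> t /andP[at_ tb]; apply: cderD; last exact: cderN.
    rewrite [ci R * f _]mulrC; apply: (@cder_comp R (fun z => ci R * z) (B v) t (ci R)).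
      have := @hol_mulc R id (ci R) (B v t) 1; rewrite mulr1; apply.
      move=> k k0; exists 1 => // h _; rewrite mulr1 (_ : _ - h = 0) ?nm0 ?mulr_ge0 ?nm_ge0 ?(ltW k0) //.
      by ring.
    by apply: hB; apply: lt1; lra.
  move=> t tab; rewrite -mulrBr nmM nm_ci mul1r opprD addrA [l * _]mulrC; apply: H; exact: near.
set WW := (X in nm X <= _).
have -> : WW =
  ((A c b - p (pt b c)) - (A c a - p (pt a c))) +
  ((ci R * B b d - p (pt b d)) - (ci R * B b c - p (pt b c))) +
  - ((A d b - p (pt b d)) - (A d a - p (pt a d))) +
  - ((ci R * B a d - p (pt a d)) - (ci R * B a c - p (pt a c))).
  by rewrite /WW; ring.
rewrite (le_trans (nmD _ _)) //.
have := nmD ((A c b - p (pt b c)) - (A c a - p (pt a c)) +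
  ((ci R * B b d - p (pt b d)) - (ci R * B b c - p (pt b c))))
  (- ((A d b - p (pt b d)) - (A d a - p (pt a d)))).
have := nmD ((A c b - p (pt b c)) - (A c a - p (pt a c)))
  ((ci R * B b d - p (pt b d)) - (ci R * B b c - p (pt b c))).
rewrite !(nmN (_ - _ - _)).
have := Ha c; have := Ha d; have := Hb a; have := Hb b; rewrite !lexx ab cd /=.
move=> /(_ isT) + /(_ isT) + /(_ isT) + /(_ isT).
have -> : 2 * e * l' ^+ 2 = e * l' * (b - a) + e * l' * (d - c) + (e * l' * (b - a) + e * l' * (d - c)).
  by rewrite lE; ring.
ilra.
Qed.

(** Goursat's bisection. After [n] quarterings the integral has shrunk at most by [4 ^ n], while the
    bound at the common point of the nested rectangles shrinks by [4 ^ n] as well, with an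
    arbitrarily small factor in front. *)
Let W0 T s : good T s -> s < rho + rho -> W T = 0.
Proof.
move=> gT sr; apply/eqP; rewrite -nm_eq0; apply/eqP/le_anti; rewrite nm_ge0 andbT.
have [st hst] := choice step.
pose Tn n := iter n st T.
pose an n := (Tn n).1.1; pose bn n := (Tn n).1.2.
pose cn n := (Tn n).2.1; pose dn n := (Tn n).2.2.
have TnE n : Tn n = (an n, bn n, (cn n, dn n)).
  by rewrite /an /bn /cn /dn; case: (Tn n) => [[? ?] [? ?]].
have stepn n : [/\ an n <= bn n, cn n <= dn n, - s <= an n /\ bn n <= s & - s <= cn n /\ dn n <= s].
  elim: n => [|n]; first by rewrite /an /bn /cn /dn /=; move: gT; case: (T) => [[? ?] [? ?]] /= [? ? ? [? ? ?]].
  have [[i [j E]] _] := hst (Tn n).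
  have : Tn n.+1 = quarter i j (an n, bn n, (cn n, dn n)) by rewrite -TnE -E.
  rewrite (TnE n.+1) => -[-> -> -> ->]; move: (an n) (bn n) (cn n) (dn n) => x1 x2 x3 x4.
  move=> [h1 h2 [h3 h4] [h5 h6]]; case: i {E}; case: j; split; try split; lra.
have nest n : [/\ an n <= an n.+1, bn n.+1 <= bn n, cn n <= cn n.+1 & dn n.+1 <= dn n].
  have [h1 h2 _ _] := stepn n.
  have [[i [j E]] _] := hst (Tn n).
  have : Tn n.+1 = quarter i j (an n, bn n, (cn n, dn n)) by rewrite -TnE -E.
  rewrite (TnE n.+1) => -[-> -> -> ->]; move: h1 h2.
  move: (an n) (bn n) (cn n) (dn n) => x1 x2 x3 x4 h1 h2; case: i {E}; case: j; split; lra.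
pose L n := (bn n - an n) + (dn n - cn n).
have LS n : L n.+1 = L n / 2.
  have [[i [j E]] _] := hst (Tn n).
  have : Tn n.+1 = quarter i j (an n, bn n, (cn n, dn n)) by rewrite -TnE -E.
  rewrite (TnE n.+1) /L => -[-> -> -> ->].
  by case: i {E}; case: j; field.
have Ln n : L n = L 0%N / 2 ^+ n.
  elim: n => [|n IH]; first by rewrite expr0 divr1.
  by rewrite LS IH exprS; field; rewrite expf_neq0.
have Wn n : nm (W T) <= 4 ^+ n * nm (W (Tn n)).
  elim: n => [|n IH]; first by rewrite expr0 mul1r.
  apply: (le_trans IH); rewrite exprSr -mulrA ler_wpM2l ?exprn_ge0 //.
  exact: (hst (Tn n)).2.
have L0 : 0 <= L 0%N by have [h1 h2 _ _] := stepn 0%N; rewrite /L addr_ge0 // subr_ge0.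
have [x hx] : exists x, forall n, an n <= x <= bn n.
  apply: nested_intervals => n; first by have [] := nest n.
  by have [] := stepn n.
have [y hy] : exists y, forall n, cn n <= y <= dn n.
  apply: nested_intervals => n; first by have [] := nest n.
  by have [] := stepn n.
have [_ _ [sx1 sx2] [sy1 sy2]] := stepn 0%N.
have /andP[hx1 hx2] := hx 0%N; have /andP[hy1 hy2] := hy 0%N.
have [l hl] : exists l, hol f (pt x y) l.
  by apply: fhol; apply: ltW; apply: le_lt_trans sr; rewrite ler_norml; lra.
apply/ler_addgt0Pr => k k0; rewrite add0r.
(* With this accuracy the final bound, [2 * L 0 ^ 2] times it, is at most [k]. The summand 1 avoids
   a division by 0 for a degenerate rectangle. *)
have e0 : 0 < k / (2 * (L 0%N + 1) ^+ 2).
  by rewrite divr_gt0 // mulr_gt0 // exprn_gt0 // ltr_wpDl.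
have [d d0 hd] := hl _ e0.
have [n nd] : exists n, L n < d.
  have [N hN] := @invn_lt R (d / (L 0%N + 1)) (divr_gt0 d0 (ltr_wpDl L0 ltr01)).
  exists N; rewrite Ln; apply: (@le_lt_trans _ _ ((L 0%N + 1) * N.+1%:R^-1)).
    rewrite ler_pM ?invr_ge0 ?exprn_ge0 // ?lerDl //.
    by rewrite lef_pV2 ?posrE ?exprn_gt0 // -natrX ler_nat ltn_expl.
  by rewrite mulrC -ltr_pdivlMr ?hN // ltr_wpDl.
apply: (le_trans (Wn n)).
have gn : good (Tn n) s by rewrite TnE; have [h1 h2 [h3 h4] [h5 h6]] := stepn n; split.
have := W_small x y l (L n) gn sr (ltW e0).
rewrite [X in let: (a, b, (c, d)) := X in _](TnE n) => /(_ erefl (hx n) (hy n)) H.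
have {}H : nm (W (Tn n)) <= 2 * (k / (2 * (L 0%N + 1) ^+ 2)) * L n ^+ 2.
  apply: H => z zl.
  have := hd (z - pt x y) (le_lt_trans zl nd); rewrite subrKC => h.
  by apply: (le_trans h); rewrite ler_wpM2l // ltW.
apply: (@le_trans _ _ (4 ^+ n * (2 * (k / (2 * (L 0%N + 1) ^+ 2)) * L n ^+ 2))).
  by rewrite ler_wpM2l // exprn_ge0.
have -> : 4 ^+ n * (2 * (k / (2 * (L 0%N + 1) ^+ 2)) * L n ^+ 2) = k * (L 0%N ^+ 2 / (L 0%N + 1) ^+ 2).
  rewrite (Ln n) (_ : 4 = 2 ^+ 2 :> R); last by ring.
  have l1 : L 0%N + 1 != 0 by rewrite gt_eqF // ltr_wpDl.
  have t1 : (2 : R) ^+ n != 0 by rewrite expf_neq0.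
  rewrite exprAC; move: (L 0%N) (2 ^+ n : R) l1 t1 => l0 t l1 t1.
  by field; rewrite l1 t1.
rewrite ler_piMr ?(ltW k0) // ler_pdivrMr ?exprn_gt0 ?ltr_wpDl // mul1r.
move: (L 0%N) L0 => u u0; rewrite -subr_ge0 (_ : (u + 1) ^+ 2 - u ^+ 2 = u + u + 1); last by ring.
by rewrite !addr_ge0.
Qed.

(** [P1] integrates along the bottom and then upwards, [P2] along the left side and then to the
    right; they agree because the boundary integral vanishes. In an increment the horizontal part is
    computed with [P2] and the vertical part with [P1]. *)
Lemma primitive_rect : exists P : C -> C, forall x y : R, `|x| < rho -> `|y| < rho ->
  hol P (pt x y) (f (pt x y)).
Proof.
pose P1 (x y : R) := (A (- rho) x - A (- rho) (- rho)) + ci R * (B x y - B x (- rho)).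
pose P2 (x y : R) := ci R * (B (- rho) y - B (- rho) (- rho)) + (A y x - A y (- rho)).
have rr : rho < rho + rho by rewrite ltrDl.
have P12 x y : `|x| < rho -> `|y| < rho -> P1 x y = P2 x y.
  rewrite !ltr_norml => /andP[x1 x2] /andP[y1 y2].
  have := @W0 (- rho, x, (- rho, y)) rho.
  have g : good (- rho, x, (- rho, y)) rho by split; rewrite ?lexx ?(ltW x1) ?(ltW x2) ?(ltW y1) ?(ltW y2).
  move=> /(_ g rr); rewrite /W /= => E; apply/eqP; rewrite -subr_eq0; apply/eqP.
  by rewrite -[RHS]E /P1 /P2; ring.
exists (fun z => P1 (complex.Re (z - q)) (complex.Im (z - q))) => x y hx hy e e0.
have e4 : 0 < e / 4 by rewrite divr_gt0.
have hx2 : `|x| < rho + rho := lt_trans hx rr.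
have hy2 : `|y| < rho + rho := lt_trans hy rr.
have [d1 d10 h1] := hA hx2 hy2 e4.
have [l /hol_cont/(_ _ e4)[d2 d20 h2]] := fhol (ltW hx2) (ltW hy2).
pose d := Num.min (Num.min d1 (d2 / 2)) (Num.min (rho - `|x|) (rho - `|y|)).
exists d; first by rewrite !lt_min d10 !subr_gt0 hx hy !divr_gt0.
move=> h; rewrite !lt_min => /andP[/andP[hd1 hd2] /andP[hd3 hd4]].
have ReE : complex.Re (pt x y - q) = x.
  by rewrite /pt addrC addKr -mkE.
have ImE : complex.Im (pt x y - q) = y.
  by rewrite /pt addrC addKr -mkE.
have -> : pt x y + h - q = (pt x y - q) + h by ring.
rewrite ReD ImD ReE ImE.
set u := complex.Re h; set v := complex.Im h.
have un : `|u| <= nm h := ler_Re h.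
have vn : `|v| <= nm h := ler_Im h.
have xu : `|x + u| < rho by have := ler_normD x u; ilra.
have yv : `|y + v| < rho by have := ler_normD y v; ilra.
have E1 : P1 (x + u) y - P1 x y = A y (x + u) - A y x.
  by rewrite !P12 // /P2; ring.
have -> : P1 (x + u) (y + v) - P1 x y - h * f (pt x y) =
   (A y (x + u) - A y x - rc u * f (pt x y)) +
   ci R * (B (x + u) (y + v) - B (x + u) y - rc v * f (pt x y)).
  have hE : h = rc u + ci R * rc v := ReIm h.
  by rewrite -E1 {1}hE /P1; ring.
rewrite (le_trans (nmD _ _)) // nmM nm_ci mul1r.
have H1 := h1 u (le_lt_trans un hd1).
have H2 : nm (B (x + u) (y + v) - B (x + u) y - rc v * f (pt x y)) <= e / 4 * `|v|.
  apply: (@cder_MVI2 _ (fun t => f (pt (x + u) t))) => s hs; split.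
    apply: hB; first exact: lt_trans xu rr.
    by have := ler_normD (s - y) y; rewrite subrK; ilra.
  apply/ltW/h2; rewrite (le_lt_trans (ptB _ _ _ _)) // [x + u]addrC addrK.
  by move: hd2; ilra.
have : e / 4 * `|u| <= e / 4 * nm h by rewrite ler_wpM2l // ltW.
have : e / 4 * `|v| <= e / 4 * nm h by rewrite ler_wpM2l // ltW.
have : 0 <= e * nm h by rewrite mulr_ge0 ?nm_ge0 // ltW.
ilra.
Qed.

End Rect.

(** The previous result requires holomorphy on a square of half-side [r / 4], and this square lies
    in the disc of radius [r]. *)
Lemma primitive_ball (f : C -> C) (q : C) (r : R) : 0 < r ->
  (forall z, nm (z - q) < r -> exists l, hol f z l) ->
  exists P : C -> C, forall z, nm (z - q) < r / 8 -> hol P z (f z).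
Proof.
move=> r0 H; have r8 : 0 < r / 8 by rewrite divr_gt0.
have [|P HP] := @primitive_rect f q (r / 8) r8.
  move=> x y hx hy; apply: H; rewrite addrC addKr -mkE.
  by rewrite (le_lt_trans (nm_le_ReIm _)) //=; lra.
exists P => z zq; have := HP (complex.Re (z - q)) (complex.Im (z - q)).
rewrite -ReIm subrKC; apply; first exact: le_lt_trans (ler_Re _) zq.
exact: le_lt_trans (ler_Im _) zq.
Qed.

End Goursat.

(** * Flow boxes *)

Section Box.
Variable R : realType.
Local Notation C := (Cplx R).
Implicit Types (z q w : C) (F T chi : C -> C).

Lemma closed_disc q (r : R) : closed [set z : C | nm (z - q) <= r].
Proof.
apply/closed_nmP => z H /=; apply/ler_addgt0Pr => e e0.
have [y /= yr yz] := H _ e0.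
by have := nm_tri z y q; rewrite (nmBC z y); ilra.
Qed.

Lemma bdd_disc q (r : R) : bdd [set z : C | nm (z - q) <= r].
Proof.
exists (r + nm q) => z /= zr; have := nmD (z - q) q; rewrite subrK; ilra.
Qed.

Lemma hol_exists F : entire F -> forall z, exists l, hol F z l.
Proof. by move=> eF z; apply: derivable_hol; exact: eF. Qed.

(* T is a primitive of 1/F near q and chi its local inverse: in the chart T every flow
   of c F is the translation by t c. *)
Definition box F q (rho d : R) T chi := [/\ 0 < rho, 0 < d,
  forall z, nm (z - q) < rho -> F z != 0 /\ hol T z (F z)^-1,
  (forall z z', nm (z - q) < rho -> nm (z' - q) < rho -> T z = T z' -> z = z') &
  [/\ T q = 0, (forall w, nm w < d -> nm (chi w - q) < rho /\ T (chi w) = w) &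
   forall w, nm w < d -> hol chi w (F (chi w))]].

Lemma hol_MVI T (f : C -> C) q (rho M : R) (l : C) :
  (forall z, nm (z - q) < rho -> hol T z (f z) /\ nm (f z - l) <= M) ->
  forall z z', nm (z - q) < rho -> nm (z' - q) < rho ->
    nm (T z - T z' - (z - z') * l) <= M * nm (z - z').
Proof.
move=> H z z' zq z'q.
have K (s : R) : 0 <= s <= 1 -> nm (z' + rc s * (z - z') - q) < rho.
  move=> /andP[s0 s1].
  have -> : z' + rc s * (z - z') - q = rc s * (z - q) + rc (1 - s) * (z' - q).
    by rewrite rcB rc1; ring.
  rewrite (le_lt_trans (nmD _ _)) // !nmM !nm_rc !ger0_norm ?subr_ge0 //.
  have [->|sn0] := eqVneq s 0; first by rewrite mul0r subr0 mul1r add0r.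
  have {}s0 : 0 < s by rewrite lt_neqAle eq_sym sn0.
  have : s * nm (z - q) < s * rho by rewrite ltr_pM2l.
  have : (1 - s) * nm (z' - q) <= (1 - s) * rho by rewrite ler_wpM2l ?subr_ge0 // ltW.
  ilra.
have := @cder_MVI R (fun s => T (z' + rc s * (z - z')) + (rc s * (- ((z - z') * l)) + 0))
  (fun s => (z - z') * f (z' + rc s * (z - z')) + - ((z - z') * l)) 0 1 (M * nm (z - z')) ler01.
rewrite subr0 mulr1.
have -> : T (z' + rc 1 * (z - z')) + (rc 1 * - ((z - z') * l) + 0) -
  (T (z' + rc 0 * (z - z')) + (rc 0 * - ((z - z') * l) + 0)) = T z - T z' - (z - z') * l.
  by rewrite rc0 rc1 !mul0r !addr0 mul1r subrKC; ring.
apply.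
  move=> t tb; apply: cderD; last exact: cder_lin.
  apply: (@cder_comp R T (fun s => z' + rc s * (z - z'))); first by have [] := H _ (K _ tb).
  by have := cder_lin (z - z') z' t; congr (cder _ _ _); apply/funext => s; rewrite addrC.
move=> t tb; rewrite -mulrBr nmM mulrC ler_wpM2r ?nm_ge0 //.
by have [] := H _ (K _ tb).
Qed.

(** The derivative of [T] stays within [L / 2] of its value [lam] at [q], where [L = nm lam]; hence
    [T] expands distances at least by [L / 2] and is injective. For surjectivity [nm (T z - w)] is
    minimised on the closed disc of radius [rho / 2]. On its rim [T] has norm at least [2 * d], so
    the minimum is interior, and there it must be 0. *)
Lemma box_exists F q : entire F -> F q != 0 ->
  exists rho d T chi, box F q rho d T chi.
Proof.
move=> eF Fq.
have [l0 hl0] := hol_exists eF q.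
have nq : 0 < nm (F q) by rewrite nm_gt0.
have [r1 r10 h1] := hol_cont hl0 nq.
have Fn0 z : nm (z - q) < r1 -> F z != 0.
  move=> /h1 h; rewrite -nm_gt0; have := nm_tri (F q) (F z) 0; rewrite !subr0 nmBC.
  by ilra.
pose f z := (F z)^-1.
have fhol z : nm (z - q) < r1 -> exists l, hol f z l.
  by move=> zq; have [l hl] := hol_exists eF z; exists (- l / F z ^+ 2); apply: hol_inv => //; exact: Fn0.
have [P HP] := primitive_ball r10 fhol.
pose lam := f q; pose L := nm lam.
have L0 : 0 < L by rewrite nm_gt0 invr_eq0.
have [lf /hol_cont hlf] := fhol q ltac:(by rewrite subrr nm0).
have L2 : 0 < L / 2 by rewrite divr_gt0.
have [r2 r20 h2] := hlf _ L2.
pose rho := Num.min (r1 / 8) r2.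
have rho0 : 0 < rho by rewrite lt_min r20 divr_gt0.
have rr1 : rho <= r1 / 8 by rewrite ge_min lexx.
have rr2 : rho <= r2 by rewrite ge_min lexx orbT.
clearbody rho.
pose T z := P z - P q.
have Tq : T q = 0 by rewrite /T subrr.
have Thol z : nm (z - q) < rho -> hol T z (f z).
  move=> zq e e0; have [|d d0 hd] := HP z _ e e0; first exact: lt_le_trans zq rr1.
  by exists d => // h /hd; rewrite /T; congr (nm _ <= _); ring.
have Tmv z z' : nm (z - q) < rho -> nm (z' - q) < rho ->
    nm (T z - T z' - (z - z') * lam) <= L / 2 * nm (z - z').
  apply: (@hol_MVI T f q rho (L / 2) lam) => y yq; split; first exact: Thol.
  by apply/ltW/h2; exact: lt_le_trans yq rr2.
have Tlow z z' : nm (z - q) < rho -> nm (z' - q) < rho ->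
    L / 2 * nm (z - z') <= nm (T z - T z').
  move=> hz hz'; have := Tmv _ _ hz hz'.
  have := nmB (T z - T z') (T z - T z' - (z - z') * lam).
  have -> : T z - T z' - (T z - T z' - (z - z') * lam) = (z - z') * lam by ring.
  rewrite nmM -/L; move: (nm (z - z')) (nm (T z - T z' - _)) (nm (T z - _)) => u v w; ilra.
have Tinj z z' : nm (z - q) < rho -> nm (z' - q) < rho -> T z = T z' -> z = z'.
  move=> hz hz' E; have := Tlow _ _ hz hz'; rewrite E subrr nm0 pmulr_rle0 // => h.
  by apply/eqP; rewrite -subr_eq0 -nm_eq0 eq_le h nm_ge0.
have rho2 : rho / 2 < rho by rewrite ltr_pdivrMr // ltr_pMr // ltr1n.
pose d := L * rho / 8.
have d0 : 0 < d by rewrite divr_gt0 // mulr_gt0.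
have dd : L / 2 * (rho / 2) = d + d by rewrite /d; field.
clearbody d.
have surj w : nm w < d -> exists z, nm (z - q) < rho /\ T z = w.
  move=> wd.
  have [||z /= zK zmin] := @min_attained R [set z | nm (z - q) <= rho / 2] (fun z => nm (T z - w))
     (@closed_disc q (rho / 2)) (@bdd_disc q (rho / 2)).
  - by exists q; rewrite /= subrr nm0 divr_ge0 // ltW.
  - move=> x /= xK e e0; have [|d1 d10 hd1] := hol_cont (Thol x _) e0.
      exact: le_lt_trans xK rho2.
    exists d1 => // y /hd1; apply: le_lt_trans.
    rewrite ler_norml; apply/andP; split.
      have := nm_tri (T x) (T y) w; rewrite (nmBC (T x) (T y)); ilra.
    have := nm_tri (T y) (T x) w; ilra.
  exists z; have zr : nm (z - q) < rho := le_lt_trans zK rho2.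
  split => //.
  have := zmin q; rewrite /= subrr nm0 Tq sub0r nmN => /(_ (ltW (divr_gt0 rho0 (ltr0Sn R 1)))) zw.
  have zint : nm (z - q) < rho / 2.
    rewrite lt_neqAle zK andbT; apply/eqP => zE.
    have := Tlow z q zr; rewrite subrr nm0 Tq subr0 zE => /(_ rho0) h.
    have := nmB (T z) (T z - w); rewrite opprB addrC subrK => h'.
    have := nmD (T z - w) w; rewrite subrK => h3.
    by move: h h' h3 zw wd dd; clear; ilra.
  apply: contrapT => nTw.
  (* A short step from [z] in the direction [D / f z] moves [T z] towards [w], with an error of at
     most half the distance gained, so [z] would not be minimal. *)
  pose D := w - T z.
  have D0 : D != 0 by rewrite subr_eq0 eq_sym; apply/eqP.
  have nD : 0 < nm D by rewrite nm_gt0.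
  have [fz0 Hz] : f z != 0 /\ hol T z (f z).
    by split; [rewrite invr_eq0; apply: Fn0; lra|exact: Thol].
  have nf : 0 < nm (f z) by rewrite nm_gt0.
  have [dl dl0 hdl] := Hz (nm (f z) / 2) (divr_gt0 nf (ltr0Sn R 1)).
  pose k := D / f z.
  have nk : 0 <= nm k := nm_ge0 k.
  have k1 : 0 < nm k + 1 by rewrite ltr_wpDl.
  pose ep := Num.min 1 (Num.min (dl / (nm k + 1) / 2) ((rho / 2 - nm (z - q)) / (nm k + 1))).
  have ep0 : 0 < ep by rewrite !lt_min ltr01 !divr_gt0 // subr_gt0.
  have ep1 : ep <= 1 by rewrite ge_min lexx.
  have ep2 : ep * (nm k + 1) <= dl / 2.
    by rewrite -ler_pdivlMr // mulrAC !ge_min lexx orbT.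
  have ep3 : ep * (nm k + 1) <= rho / 2 - nm (z - q).
    by rewrite -ler_pdivlMr // !ge_min lexx !orbT.
  clearbody ep.
  pose h := rc ep * k.
  have nh : nm h = ep * nm k by rewrite nmM nm_rc ger0_norm // ltW.
  have hdl' : nm h < dl.
    by rewrite nh; move: dl0 ep0 ep2; clear; ilra.
  have := hdl _ hdl'.
  have hl : h * f z = rc ep * D by rewrite /h /k; field.
  rewrite hl => H1.
  have := zmin (z + h); rewrite /=.
  have hK : nm (z + h - q) <= rho / 2.
    by have := nmD (z - q) h; rewrite nh addrAC; move: ep0 ep3; clear; ilra.
  move=> /(_ hK).
  have H2 : nm (T (z + h) - w) <= nm (T (z + h) - T z - rc ep * D) + nm (rc (1 - ep) * D).
    rewrite -nmN -(nmN (_ - _ - _)) (le_trans _ (nmD _ _)) // le_eqVlt; apply/orP; left.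
    by apply/eqP; congr nm; rewrite /D rcB rc1; ring.
  rewrite (nmBC (T z)) -/D.
  have H3 : nm (rc (1 - ep) * D) = (1 - ep) * nm D by rewrite nmM nm_rc ger0_norm // subr_ge0.
  have H4 : nm (f z) / 2 * nm h = ep * nm D / 2.
    by rewrite nh /k nmM nmV; field; rewrite gt_eqF.
  have : 0 < ep * nm D by rewrite mulr_gt0.
  by move: H1 H2; rewrite H3 H4; clear; ilra.
have chs w : exists z, nm w < d -> nm (z - q) < rho /\ T z = w.
  have [/surj[z hz]|h] := pselect (nm w < d); first by exists z.
  by exists 0.
have [chi hchi] := choice chs.
exists rho, d, T, chi; split=> //.
  by move=> z zq; split; [apply: Fn0; lra|exact: Thol].
split=> // w wd e e0; have [cq Tc] := hchi _ wd.
set z := chi w in cq Tc *.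
have Fz : F z != 0 by apply: Fn0; lra.
have nF : 0 < nm (F z) by rewrite nm_gt0.
have e1 : 0 < e * (L / 2) / nm (F z) by rewrite divr_gt0 // mulr_gt0.
have [d1 d10 hd1] := Thol _ cq _ e1.
exists (Num.min (d - nm w) (d1 * (L / 2))); first by rewrite lt_min subr_gt0 wd mulr_gt0.
move=> h; rewrite lt_min => /andP[hd hd'].
have [cq' Tc'] : nm (chi (w + h) - q) < rho /\ T (chi (w + h)) = w + h.
  by apply: hchi; have := nmD w h; move: hd; clear; ilra.
set z' := chi (w + h) in cq' Tc' *.
have lowh := Tlow _ _ cq' cq; rewrite Tc' Tc (_ : w + h - w = h) in lowh; last by ring.
have kd : nm (z' - z) < d1.
  by rewrite -(ltr_pM2r L2) mulrC (le_lt_trans lowh).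
have := hd1 _ kd; rewrite subrKC Tc' Tc (_ : w + h - w = h); last by ring.
move=> H.
have -> : z' - z - h * F z = - ((h - (z' - z) * f z) * F z).
  by rewrite /f; field.
rewrite nmN nmM -ler_pdivlMr //; apply: (le_trans H).
have -> : e * (L / 2) / nm (F z) * nm (z' - z) = e / nm (F z) * (L / 2 * nm (z' - z)).
  by field; rewrite gt_eqF.
apply: (@le_trans _ _ (e / nm (F z) * nm h)); last by rewrite mulrAC.
by rewrite ler_wpM2l ?divr_ge0 ?nm_ge0 ?(ltW e0).
Qed.

(** The chain rule gives [T o y] the derivative [c * F (y t) * (F (y t))^-1 = c]. *)
Lemma box_curve F q rho d T chi (c : C) (I : set R) (y : R -> C) :
  box F q rho d T chi -> is_interval I ->
  (forall t, I t -> nm (y t - q) < rho /\ cder y t (c * F (y t))) ->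
  forall s t, I s -> I t -> T (y t) = T (y s) + rc (t - s) * c.
Proof.
move=> [_ _ bx _ _] iI H.
suff K s t : s <= t -> I s -> I t -> T (y t) = T (y s) + rc (t - s) * c.
  move=> s t Is It; have [st|/ltW ts] := lerP s t; first exact: K.
  by rewrite (K t s) // -(opprB t s) rcN; ring.
move=> st Is It.
have h : nm (T (y t) + (rc t * - c + 0) - (T (y s) + (rc s * - c + 0))) <= 0.
  rewrite -(mul0r (t - s)).
  apply: (@cder_MVI R (fun u => T (y u) + (rc u * (- c) + 0)) (fun=> 0)) => // [u|]; last by rewrite nm0.
  move=> /andP[su ut]; have Iu : I u by apply: (iI s t) => //; rewrite su ut.
  have [yq yd] := H _ Iu; have [Fn Th] := bx _ yq.
  rewrite -(_ : c * F (y u) * (F (y u))^-1 + - c = 0); last by field.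
  by apply: cderD; [exact: cder_comp|exact: cder_lin].
have : nm (T (y t) + (rc t * - c + 0) - (T (y s) + (rc s * - c + 0))) == 0.
  by rewrite eq_le h nm_ge0.
rewrite nm_eq0 => /eqP E; rewrite rcB -[LHS]subr0 -E; ring.
Qed.

End Box.

(** * Real-time flows of c F *)

Section Flow.
Variable R : realType.
Local Notation C := (Cplx R).
Variable F : C -> C.
Hypothesis eF : entire F.
Implicit Types (z q w x b c : C) (I : set R) (y : R -> C).

Definition fl c (t : R) x := flow (fun z => c * F z) t x.
Definition dm c x : set R := Imax (fun z => c * F z) x.

Lemma solE c x I y : solution_on (fun z => c * F z) x I y <->
  [/\ open I, is_interval I, I 0, y 0 = x & forall t, I t -> cder y t (c * F (y t))].
Proof.
by split=> -[? ? ? ? H]; split=> // t It; apply/cder_curve; exact: H.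
Qed.

Lemma cder_rev y (t : R) (v : C) : cder y (- t) v -> cder (fun s => y (- s)) t (- v).
Proof.
move=> H e e0; have [d d0 hd] := H _ e0; exists d => // h.
rewrite -normrN => /hd; rewrite opprD; congr (nm _ <= _).
by rewrite rcN; ring.
Qed.

Lemma is_interval_opp I : is_interval I -> is_interval [set t | I (- t)].
Proof.
move=> iI s t /= Is It u /andP[su ut]; apply: (iI _ _ It Is).
by rewrite !lerN2 ut.
Qed.

Lemma is_interval_shift I (s : R) : is_interval I -> is_interval [set t | I (s + t)].
Proof.
move=> iI u v /= Iu Iv w /andP[uw wv]; apply: (iI _ _ Iu Iv).
by rewrite !lerD2l uw.
Qed.

Lemma is_intervalI I J : is_interval I -> is_interval J -> is_interval (I `&` J).
Proof.
by move=> iI iJ s t [Is Js] [It Jt] u h; split; [exact: (iI s t)|exact: (iJ s t)].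
Qed.

Lemma open_R I : open I <-> forall t, I t -> exists2 d : R, 0 < d & forall s, `|s - t| < d -> I s.
Proof.
rewrite openE; split=> h t It.
  have /nbhs_ballP[d /= d0 hd] := h _ It; exists d => // s st; apply: hd.
  by rewrite /ball /= distrC.
have [d d0 hd] := h _ It; apply/nbhs_ballP; exists d => // s; rewrite /ball /= distrC.
exact: hd.
Qed.

(** Near [b] the field is bounded by [K * nm (z - b)]. While the distance is below [e], the time
    [(4 * K)^-1] allows a displacement of at most [e / 4]; starting from [e / 2] and with two errors
    [e / 16] from continuity the distance stays below [e], so continuous induction applies. Since
    [tau] does not depend on [e], letting [e] tend to 0 shows that solutions through [b] are
    stationary. *)
Lemma near_equilibrium b : F b = 0 ->
  exists2 tau : R, 0 < tau & exists2 r0 : R, 0 < r0 &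
  forall c I y (t0 t e : R), nm c <= 1 -> is_interval I ->
    (forall u, I u -> cder y u (c * F (y u))) -> I t0 -> I t ->
    `|t - t0| <= tau -> e <= r0 -> nm (y t0 - b) < e / 2 -> nm (y t - b) < e.
Proof.
move=> Fb; have [l hl] := hol_exists eF b.
have [r0 r00 hr] := hl 1 ltr01.
pose K := nm l + 1.
have K0 : 0 < K by rewrite ltr_wpDl ?nm_ge0.
have HK z : nm (z - b) < r0 -> nm (F z) <= K * nm (z - b).
  move=> /hr; rewrite subrKC Fb subr0 mul1r => h.
  have := nmD (F z - (z - b) * l) ((z - b) * l); rewrite subrK nmM /K; ilra.
have tau0 : 0 < (4 * K)^-1 by rewrite invr_gt0 mulr_gt0.
exists (4 * K)^-1 => //; exists r0 => //.
have fwd c I y (t0 t e : R) : nm c <= 1 -> is_interval I ->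
    (forall u, I u -> cder y u (c * F (y u))) -> I t0 -> I t ->
    t0 <= t -> t - t0 <= (4 * K)^-1 -> e <= r0 -> nm (y t0 - b) < e / 2 -> nm (y t - b) < e.
  move=> c1 iI yI I0 It t0t ttau er0 ye.
  have e0 : 0 < e by have := nm_ge0 (y t0 - b); ilra.
  pose I' := [set u | t0 <= u <= t].
  have I'I u : I' u -> I u by move=> /= h; exact: (iI t0 t).
  have iI' : is_interval I'.
    by move=> u v /andP[u1 u2] /andP[v1 v2] s /andP[s1 s2] /=; apply/andP; split; lra.
  suff H u : I' u -> forall s, t0 <= s <= u -> nm (y s - b) < e.
    by apply: (H t); rewrite /I' /= lexx t0t.
  apply: (@interval_ind R I' (fun u => forall s, t0 <= s <= u -> nm (y s - b) < e) t0 iI').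
  - by rewrite /I' /= lexx t0t.
  - by move=> s; rewrite -eq_le => /eqP <-; lra.
  move=> {}u I'u; have e16 : 0 < e / 16 by rewrite divr_gt0.
  have [d d0 hd] := cder_cont (yI _ (I'I _ I'u)) e16.
  exists d => // u1 u2 I'1 I'2 d1 d2 P1 s /andP[s0 s2].
  have [su1|u1s] := lerP s u1; first by apply: P1; rewrite s0.
  have hs : `|s - u| < d.
    by move: d1 d2; rewrite !ltr_norml => /andP[? ?] /andP[? ?]; apply/andP; split; lra.
  have := hd _ hs; have := hd _ d1.
  have /andP[t01 u1t] := I'1.
  have : nm (y u1 - y t0) <= K * e * (u1 - t0).
    apply: (@cder_MVI R y (fun u => c * F (y u))) => // v hv.
      by move: hv => /andP[v0 v1]; apply/yI/I'I; rewrite /I' /= v0 (le_trans v1).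
    have ve := P1 _ hv; rewrite nmM.
    have h1 := HK _ (lt_le_trans ve er0).
    apply: (@le_trans _ _ (1 * nm (F (y v)))); first by rewrite ler_wpM2r ?nm_ge0.
    by rewrite mul1r (le_trans h1) // ler_wpM2l ?(ltW K0) // ltW.
  have : K * e * (u1 - t0) <= e / 4.
    apply: (@le_trans _ _ (K * e * (4 * K)^-1)).
      by rewrite ler_wpM2l ?mulr_ge0 ?(ltW K0) ?(ltW e0) //; lra.
    by rewrite le_eqVlt; apply/orP; left; apply/eqP; field; rewrite gt_eqF.
  have := nm_tri (y s) (y u) b; have := nm_tri (y u) (y u1) b; have := nm_tri (y u1) (y t0) b.
  rewrite (nmBC (y u) (y u1)); ilra.
move=> c I y t0 t e c1 iI yI I0 It; have [tt0|tt0] := lerP t0 t.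
  exact: (fwd c I).
move=> h er0 ye.
have := @fwd (- c) [set t | I (- t)] (fun s => y (- s)) (- t0) (- t) e.
rewrite /= !opprK nmN lerN2; apply => //.
- exact: is_interval_opp.
- by move=> u /yI; rewrite mulNr; exact: cder_rev.
- exact: ltW.
- by rewrite addrC.
Qed.

Lemma eq0_of_small z : (forall e : R, 0 < e -> nm z < e) -> z = 0.
Proof.
move=> h; apply/eqP; rewrite -nm_eq0; apply/eqP; apply: le_anti; rewrite nm_ge0 andbT.
by apply/ler_addgt0Pr => e e0; rewrite add0r ltW ?h.
Qed.

(** Equality is propagated locally. If the solutions differ at [t], they differ nearby by
    continuity. If they agree at an equilibrium, both are stationary. Otherwise a chart turns both
    into the same translation. *)
Lemma sol_uniq c I y1 y2 (t0 : R) : nm c <= 1 -> is_interval I ->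
  (forall u, I u -> cder y1 u (c * F (y1 u))) ->
  (forall u, I u -> cder y2 u (c * F (y2 u))) ->
  I t0 -> y1 t0 = y2 t0 -> forall t, I t -> y1 t = y2 t.
Proof.
move=> c1 iI h1 h2 I0 E0; apply: (interval_ind iI I0 E0) => t It.
have [E|nE] := eqVneq (y1 t) (y2 t); last first.
  have n0 : 0 < nm (y1 t - y2 t) by rewrite nm_gt0 subr_eq0.
  have [d1 d10 hd1] := cder_cont (h1 _ It) (divr_gt0 n0 (ltr0Sn R 1)).
  have [d2 d20 hd2] := cder_cont (h2 _ It) (divr_gt0 n0 (ltr0Sn R 1)).
  exists (Num.min d1 d2); first by rewrite lt_min d10.
  move=> u v _ _; rewrite lt_min => /andP[/hd1 k1 /hd2 k2] _ Eu.
  have h3 := nm_tri (y1 t) (y1 u) (y2 t).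
  by rewrite (nmBC (y1 t) (y1 u)) Eu in h3; rewrite Eu in k1; exfalso; lra.
have [Fq|Fq] := eqVneq (F (y1 t)) 0.
  have [tau tau0 [r0 r00 H]] := near_equilibrium Fq.
  exists tau => // u v Iu Iv ut vt _.
  have K y : (forall u, I u -> cder y u (c * F (y u))) -> y t = y1 t -> y v = y1 t.
    move=> hy yt; apply/eqP; rewrite -subr_eq0; apply/eqP; apply: eq0_of_small => e e0.
    apply: (@lt_le_trans _ _ (Num.min e r0)); last by rewrite ge_min lexx.
    apply: (H c I y t v) => //; first exact: ltW.
      by rewrite ge_min lexx orbT.
    by rewrite yt subrr nm0 divr_gt0 // lt_min e0.
  by rewrite (K y1) // (K y2).
have [rho [d [T [chi bx]]]] := box_exists eF Fq.
have [rho0 _ _ Tinj _] := bx.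
have [d1 d10 hd1] := cder_cont (h1 _ It) rho0.
have [d2 d20 hd2] := cder_cont (h2 _ It) rho0.
exists (Num.min d1 d2); first by rewrite lt_min d10.
move=> u v Iu Iv; rewrite !lt_min => /andP[u1 u2] /andP[v1 v2] Eu.
pose J := I `&` [set s | `|s - t| < d1] `&` [set s | `|s - t| < d2].
have iJ : is_interval J.
  apply: is_intervalI; first apply: is_intervalI => //.
    move=> s s' /=; rewrite !ltr_norml => /andP[? ?] /andP[? ?] w /andP[? ?].
    by rewrite /= ltr_norml; apply/andP; split; lra.
  move=> s s' /=; rewrite !ltr_norml => /andP[? ?] /andP[? ?] w /andP[? ?].
  by rewrite /= ltr_norml; apply/andP; split; lra.
have B1 : forall s, J s -> nm (y1 s - y1 t) < rho /\ cder y1 s (c * F (y1 s)).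
  by move=> s [[Is s1] s2]; split; [exact: hd1|exact: h1].
have B2 : forall s, J s -> nm (y2 s - y1 t) < rho /\ cder y2 s (c * F (y2 s)).
  by move=> s [[Is s1] s2]; split; [rewrite E; exact: hd2|exact: h2].
have Ju : J u by [].
have Jv : J v by [].
apply: Tinj; [by have [] := B1 _ Jv|by have [] := B2 _ Jv|].
by rewrite (box_curve bx iJ B1 Ju Jv) (box_curve bx iJ B2 Ju Jv) Eu.
Qed.

Lemma box_sol q rho d T chi c w (t : R) : box F q rho d T chi ->
  nm (w + rc t * c) < d -> cder (fun s => chi (w + rc s * c)) t (c * F (chi (w + rc t * c))).
Proof.
move=> [_ _ _ _ [_ _ hchi]] /hchi h.
apply: (@cder_comp R chi (fun s => w + rc s * c)) => //.
by have := cder_lin c w t; congr (cder _ _ _); apply/funext => s; rewrite addrC.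
Qed.

Lemma itv_ball (t d : R) : is_interval [set s | `|s - t| < d].
Proof.
move=> s s' /=; rewrite !ltr_norml => /andP[? ?] /andP[? ?] w /andP[? ?].
by rewrite /= ltr_norml; apply/andP; split; lra.
Qed.

Lemma open_ballR (t d : R) : open [set s : R | `|s - t| < d].
Proof.
apply/open_R => s /= sd; exists (d - `|s - t|); first by rewrite subr_gt0.
by move=> u us; have := ler_distD s u t; ilra.
Qed.

Lemma flE c x I y (t : R) : nm c <= 1 -> solution_on (fun z => c * F z) x I y -> I t ->
  fl c t x = y t.
Proof.
move=> c1 sy It; rewrite /fl /flow.
set A := (X in xget _ X).
have : A (xget 0 A) by apply: xgetPex; exists (y t); exists I, y.
move=> [I' [y' [sy' I't <-]]].
move: sy sy' => /solE[oI iI I0 y0 hI] /solE[oI' iI' I'0 y'0 hI'].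
apply: (@sol_uniq c (I `&` I') y' y 0) => //.
- exact: is_intervalI.
- by move=> u [_ /hI'].
- by move=> u [/hI].
by rewrite y0.
Qed.

Lemma fl_max c x I y : nm c <= 1 -> open I -> is_interval I -> I 0 -> y 0 = x ->
  (forall t, I t -> cder y t (c * F (y t))) ->
  forall t, I t -> dm c x t /\ fl c t x = y t.
Proof.
move=> c1 oI iI I0 y0 hI t It.
have s : solution_on (fun z => c * F z) x I y by apply/solE.
by split; [exists I, y|exact: (flE c1 s)].
Qed.

Lemma fl_eq c x (t : R) : nm c <= 1 -> F x = 0 -> dm c x t /\ fl c t x = x.
Proof.
move=> c1 Fx; apply: (@fl_max c x setT (fun=> x)) => //; first exact: openT.
move=> u _; rewrite Fx mulr0.
by have := cder_lin 0 x u; congr (cder _ _ _); apply/funext => s; rewrite mulr0 add0r.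
Qed.

Lemma box_dm c q rho d T chi w (t : R) : nm c <= 1 -> box F q rho d T chi ->
  nm w + `|t| < d -> dm c (chi w) t /\ fl c t (chi w) = chi (w + rc t * c).
Proof.
move=> c1 bx wt.
have H (s : R) : `|s| < d - nm w -> nm (w + rc s * c) < d.
  move=> sd; rewrite (le_lt_trans (nmD _ _)) // nmM nm_rc.
  have : `|s| * nm c <= `|s| * 1 by rewrite ler_wpM2l.
  ilra.
apply: (@fl_max c (chi w) [set s : R | `|s - 0| < d - nm w] (fun s => chi (w + rc s * c))) => //.
- exact: open_ballR.
- exact: itv_ball.
- by rewrite /= subrr normr0 subr_gt0; have : 0 <= `|t| by []; ilra.
- by rewrite rc0 mul0r addr0.
- by move=> s /=; rewrite subr0 => /H; exact: box_sol bx.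
by rewrite /= subr0; lra.
Qed.

Lemma dm0 c x : nm c <= 1 -> dm c x 0.
Proof.
move=> c1; have [Fx|Fx] := eqVneq (F x) 0; first by have [] := fl_eq 0 c1 Fx.
have [rho [d [T [chi bx]]]] := box_exists eF Fx.
have [rho0 d0 _ Tinj [Tq h _]] := bx.
have [|] := @box_dm c x rho d T chi 0 0 c1 bx; first by rewrite nm0 normr0 addr0.
suff -> : chi 0 = x by [].
have [] := h 0; rewrite ?nm0 // => hc T0; apply: Tinj; rewrite ?subrr ?nm0 //.
by rewrite T0.
Qed.

Lemma fl_sol c x : nm c <= 1 ->
  [/\ open (dm c x), is_interval (dm c x), dm c x 0, fl c 0 x = x &
      forall t, dm c x t -> cder (fl c ^~ x) t (c * F (fl c t x))].
Proof.
move=> c1; have d0 := dm0 x c1; split=> //.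
- apply/open_R => t [I [y [sy It]]]; have /solE[oI _ _ _ _] := sy.
  have /open_R/(_ _ It)[d dd hd] := oI; exists d => // s /hd Is.
  by exists I, y.
- move=> s t [I [y [sI Is]]] [J [y' [sJ Jt]]] u /andP[su ut].
  have /solE[_ iI I0 _ _] := sI; have /solE[_ iJ J0 _ _] := sJ.
  have [u0|u0] := lerP 0 u.
    by exists J, y'; split => //; apply: (iJ 0 t) => //; rewrite u0.
  by exists I, y; split => //; apply: (iI s 0) => //; rewrite su ltW.
- have [I [y [sI I0]]] := d0; rewrite (flE c1 sI) //.
  by have /solE[] := sI.
move=> t [I [y [sI It]]]; rewrite (flE c1 sI) //.
have /solE[/open_R/(_ _ It)[d d00 hd] _ _ _ /(_ _ It)] := sI.
by apply: cder_near; exists d => // s /hd Is; rewrite (flE c1 sI).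
Qed.

Lemma fl_shift c x (s t : R) : nm c <= 1 -> dm c x s -> dm c x (s + t) ->
  dm c (fl c s x) t /\ fl c t (fl c s x) = fl c (s + t) x.
Proof.
move=> c1 ds dst; have [oI iI I0 f0 hf] := fl_sol x c1.
apply: (@fl_max c (fl c s x) [set u | dm c x (s + u)] (fun u => fl c (s + u) x)) => //.
- apply/open_R => u /= hu; have /open_R/(_ _ hu)[d d0 hd] := oI.
  by exists d => // v vu; apply: hd; rewrite opprD addrACA subrr add0r.
- exact: is_interval_shift.
- by rewrite /= addr0.
- by rewrite addr0.
move=> u /= /hf; rewrite [s + u]addrC => h.
have := cder_shift h; congr (cder _ _ _).
by apply/funext => v; rewrite addrC.
Qed.

Lemma fl0 c x : nm c <= 1 -> fl c 0 x = x.
Proof. by move=> c1; have [] := fl_sol x c1. Qed.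

Lemma fl_inv c x (s : R) : nm c <= 1 -> dm c x s ->
  dm c (fl c s x) (- s) /\ fl c (- s) (fl c s x) = x.
Proof.
move=> c1 ds; have := @fl_shift c x s (- s) c1 ds.
by rewrite subrr fl0 // => /(_ (dm0 x c1)).
Qed.

Lemma fl_shiftr c x (s t : R) : nm c <= 1 -> dm c x s -> dm c (fl c s x) t -> dm c x (s + t).
Proof.
move=> c1 ds dt; have [d1 E1] := fl_inv c1 ds.
have := @fl_shift c (fl c s x) (- s) (s + t) c1 d1.
by rewrite E1 addKr => /(_ dt)[].
Qed.

Lemma fl_rev c x (t : R) : nm c <= 1 -> dm c x t ->
  dm (- c) x (- t) /\ fl (- c) (- t) x = fl c t x.
Proof.
move=> c1 dt; have [oI iI I0 f0 hf] := fl_sol x c1.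
have := @fl_max (- c) x [set u | dm c x (- u)] (fun u => fl c (- u) x).
rewrite nmN => /(_ c1); rewrite /= oppr0 => H.
have := H _ _ _ f0 _ (- t); rewrite opprK; apply => //.
- apply/open_R => u /= hu; have /open_R/(_ _ hu)[d d0 hd] := oI.
  by exists d => // v vu; apply: hd; rewrite -opprD normrN.
- exact: is_interval_opp.
by move=> u /hf; rewrite mulNr; exact: cder_rev.
Qed.

Lemma fl_neq c x (t : R) : nm c <= 1 -> F x != 0 -> dm c x t -> F (fl c t x) != 0.
Proof.
move=> c1 Fx dt; apply/eqP => F0; have [d1 E1] := fl_inv c1 dt.
have [_ E2] := fl_eq (- t) c1 F0; move: Fx; rewrite -E1 E2 F0 eqxx //.
Qed.

Lemma dm_itv c x (s t u : R) : nm c <= 1 -> dm c x s -> dm c x t -> s <= u <= t -> dm c x u.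
Proof. by move=> c1 ds dt; have [_ iI _ _ _] := fl_sol x c1; exact: iI. Qed.

Lemma fl_der c x (t : R) : nm c <= 1 -> dm c x t -> cder (fl c ^~ x) t (c * F (fl c t x)).
Proof. by move=> c1 dt; have [_ _ _ _] := fl_sol x c1; apply. Qed.

Lemma fl_cont c x (t : R) : nm c <= 1 -> dm c x t -> ccont (fl c ^~ x) t.
Proof. move=> c1 dt; exact: cder_cont (fl_der c1 dt). Qed.

Lemma box_nbhd q rho d T chi (e : R) : box F q rho d T chi -> 0 < e ->
  exists2 r, 0 < r & forall z, nm (z - q) < r -> [/\ nm (z - q) < rho, nm (T z) < e & nm (T z) < d -> chi (T z) = z].
Proof.
move=> [rho0 d0 bx Tinj [Tq h _]] e0.
have [|_ /hol_cont/(_ _ e0)[r r0 hr]] := bx q; first by rewrite subrr nm0.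
exists (Num.min r rho); first by rewrite lt_min r0.
move=> z; rewrite lt_min => /andP[/hr]; rewrite Tq subr0 => zr zrho; split=> // Td.
by have [h1 h2] := h _ Td; exact: Tinj.
Qed.

Lemma local_time_neq q : F q != 0 -> exists2 r : R, 0 < r & exists2 tau : R, 0 < tau &
  forall c x (t : R), nm c <= 1 -> nm (x - q) < r -> `|t| < tau -> dm c x t.
Proof.
move=> Fq; have [rho [d [T [chi bx]]]] := box_exists eF Fq.
have d0 : 0 < d by case: bx.
have [r r0 hr] := box_nbhd bx (divr_gt0 d0 (ltr0Sn R 1)).
exists r => //; exists (d / 2); first by rewrite divr_gt0.
move=> c x t c1 /hr[_ Tx Tc] td.
rewrite -Tc; last by lra.
by have [|] := @box_dm c q rho d T chi (T x) t c1 bx; first lra.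
Qed.

(** Suppose the solution stops at [S <= T]. Being bounded, it accumulates at some [z] as time tends
    to [S]. If [F z != 0], existence times are bounded below near [z] and the solution passes [S].
    If [F z = 0], the confinement near [z], used backwards in time, shows that the solution was at
    [z] already before [S], which is impossible for a point that is not an equilibrium. *)
Lemma escape c x (M T : R) : nm c <= 1 -> 0 <= T ->
  (forall t, 0 <= t -> t < T -> dm c x t -> nm (fl c t x) <= M) -> dm c x T.
Proof.
move=> c1 T0 HM; apply: contrapT => nT.
have [Fx|Fx] := eqVneq (F x) 0; first by apply: nT; have [] := fl_eq T c1 Fx.
have [oI iI I0 f0 hf] := fl_sol x c1.
pose A := dm c x `&` [set t | 0 <= t].
have AT t : A t -> t < T.
  move=> [dt /= t0]; rewrite ltNge; apply/negP => Tt; apply: nT.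
  by apply: (iI 0 t) => //; rewrite T0.
have hs : has_sup A.
  split; first by exists 0; split => //=.
  by exists T => t /AT /ltW.
pose S := sup A.
have A0 : A 0 by split => //=.
have S0 : 0 <= S by apply: ub_le_sup => //; exact: hs.2.
have ST : S <= T by apply: ge_sup; [exact: hs.1|move=> t /AT /ltW].
have ltS t : 0 <= t -> t < S -> A t.
  move=> t0 tS; split => //=.
  have [u [du u0] tu] := @sup_adherent _ A (S - t) ltac:(by rewrite subr_gt0) hs.
  by apply: (iI 0 u) => //; rewrite t0 /=; move: tu; rewrite -/S; ilra.
have nS : ~ dm c x S.
  move=> /[dup] dS; have /open_R/[apply][[d d0 hd]] := oI.
  have : A (S + d / 2).
    split; last by rewrite /= addr_ge0 // divr_ge0 // ltW.
    by apply: hd; rewrite addrC addKr gtr0_norm ?divr_gt0 // ltr_pdivrMr // ltr_pMr // ltr1n.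
  move=> /(ub_le_sup hs.2); rewrite -/S; lra.
have Spos : 0 < S.
  by rewrite lt_neqAle S0 andbT; apply/eqP => S00; apply: nS; rewrite -S00.
pose t_ (n : nat) := S - S / n.+1%:R.
have tn n : 0 <= t_ n /\ t_ n < S.
  split; last by rewrite ltrBlDr ltrDl divr_gt0.
  by rewrite subr_ge0 ler_pdivrMr // ler_peMr // ler1n.
have tlim (e : R) : 0 < e -> exists N, forall n, (N <= n)%N -> S - e < t_ n.
  move=> e0; have [N hN] := @invn_lt R (e / S) (divr_gt0 e0 Spos).
  exists N => n /hN; rewrite ltr_pdivlMr // mulrC => h.
  by rewrite /t_ ltrD2l ltrN2.
have [z hz] := @accu R (fun n => fl c (t_ n) x) M
  (fun n => HM _ (tn n).1 (lt_le_trans (tn n).2 ST) (ltS _ (tn n).1 (tn n).2).1).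
have [Fz|Fz] := eqVneq (F z) 0; last first.
  have [r r0 [tau tau0 H]] := local_time_neq Fz.
  have [N hN] := tlim _ tau0.
  have [n /hN Nn zn] := hz _ r0 N.
  apply: nS; have := @fl_shiftr c x (t_ n) (S - t_ n) c1; rewrite subrKC; apply.
    by have [] := ltS _ (tn n).1 (tn n).2.
  apply: (H c) => //; rewrite ger0_norm; have := (tn n).2; ilra.
have [tau tau0 [r0 r00 H]] := near_equilibrium Fz.
(* A fixed time in the domain, within [tau] of all times [t_ n] close to [S]. *)
pose ts := Num.max 0 (S - tau).
have ts0 : 0 <= ts by rewrite le_max lexx.
have tsS : ts < S by rewrite gt_max Spos ltrBlDr ltrDl tau0.
have tsT : S - tau <= ts by rewrite le_max lexx orbT.
have dts := (ltS _ ts0 tsS).1.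
have [N hN] := tlim (S - ts) ltac:(by rewrite subr_gt0).
have E : fl c ts x = z.
  apply/eqP; rewrite -subr_eq0; apply/eqP; apply: eq0_of_small => e e0.
  have m0 : 0 < Num.min e r0 by rewrite lt_min e0.
  have [n /hN Nn zn] := hz _ (divr_gt0 m0 (ltr0Sn R 1)) N.
  apply: (@lt_le_trans _ _ (Num.min e r0)); last by rewrite ge_min lexx.
  apply: (H c (dm c x) (fl c ^~ x) (t_ n) ts) => //.
  - by have [] := ltS _ (tn n).1 (tn n).2.
  - by rewrite ler0_norm; have := (tn n).2; ilra.
  by rewrite ge_min lexx orbT.
by have := fl_neq c1 Fx dts; rewrite E Fz eqxx.
Qed.

Lemma escape_neg c x (M T : R) : nm c <= 1 -> T <= 0 ->
  (forall t, t <= 0 -> T < t -> dm c x t -> nm (fl c t x) <= M) -> dm c x T.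
Proof.
move=> c1 T0 H.
have c1' : nm (- c) <= 1 by rewrite nmN.
have := @escape (- c) x M (- T) c1'; rewrite oppr_ge0 => /(_ T0) K.
rewrite -(opprK T) -(opprK c); apply: (fl_rev c1' _).1; apply: K => t t0 tT dt.
have [d1 E1] := fl_rev c1' dt; rewrite opprK in d1 E1.
by rewrite -E1; apply: H => //; lra.
Qed.

(** At an equilibrium there is no chart; there [near_equilibrium] confines the solutions and
    [escape] turns confinement into existence. *)
Lemma local_time q : exists2 r : R, 0 < r & exists2 tau : R, 0 < tau &
  forall c x (t : R), nm c <= 1 -> nm (x - q) < r -> `|t| <= tau -> dm c x t.
Proof.
have [Fq|Fq] := eqVneq (F q) 0; last first.
  have [r r0 [tau tau0 H]] := local_time_neq Fq.
  exists r => //; exists (tau / 2); first by rewrite divr_gt0.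
  by move=> c x t c1 xr tt; apply: (H c) => //; lra.
have [tau tau0 [r0 r00 H]] := near_equilibrium Fq.
exists (r0 / 2); first by rewrite divr_gt0.
exists tau => // c x t c1 xr tt.
have B s : dm c x s -> `|s| <= tau -> nm (fl c s x) <= r0 + nm q.
  move=> ds st; have [_ iI I0 f0 hf] := fl_sol x c1.
  have := @H c (dm c x) (fl c ^~ x) 0 s r0 c1 iI hf I0 ds.
  rewrite subr0 f0 => /(_ st (lexx _) xr); have := nmD (fl c s x - q) q; rewrite subrK; ilra.
have [t0|t0] := lerP 0 t.
  apply: (@escape c x (r0 + nm q) t c1 t0) => s s0 st ds; apply: B => //.
  by rewrite ger0_norm //; move: tt; rewrite ger0_norm //; ilra.
apply: (@escape_neg c x (r0 + nm q) t c1 (ltW t0)) => s s0 st ds; apply: B => //.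
by rewrite ler0_norm //; move: tt; rewrite ltr0_norm //; ilra.
Qed.

End Flow.

(** * Commuting flows *)

Section Commute.
Variable R : realType.
Local Notation C := (Cplx R).
Variable F : C -> C.
Hypothesis eF : entire F.
Implicit Types (z q w x b c : C) (I : set R) (y : R -> C).
Local Notation fl := (fl F).
Local Notation dm := (dm F).

Lemma box_at q rho d T chi : box F q rho d T chi -> chi 0 = q.
Proof.
move=> [rho0 d0 _ Tinj [Tq h _]]; have [|hc T0] := h 0; first by rewrite nm0.
by apply: Tinj; rewrite ?subrr ?nm0 // T0.
Qed.

(** Within one chart both flows are translations, so commutation at a time [u] passes to a nearby
    time [v]. Each passage may shrink [eta], hence [eta] depends on [t]. *)
Lemma comm_local c c' x (t : R) : nm c <= 1 -> nm c' <= 1 -> F x != 0 -> dm c x t ->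
  exists2 eta : R, 0 < eta & forall s : R, `|s| < eta ->
    [/\ dm c' x s, dm c' (fl c t x) s, dm c (fl c' s x) t &
        fl c t (fl c' s x) = fl c' s (fl c t x)].
Proof.
move=> c1 c'1 Fx; have [oI iI I0 f0 hf] := fl_sol eF x c1.
pose P (t : R) := exists2 eta : R, 0 < eta & forall s : R, `|s| < eta ->
    [/\ dm c' x s, dm c' (fl c t x) s, dm c (fl c' s x) t &
        fl c t (fl c' s x) = fl c' s (fl c t x)].
apply: (@interval_ind R _ P 0 iI I0).
  have [r r0 [tau tau0 H]] := local_time eF x.
  exists tau => // s stau; have ds : dm c' x s.
    by apply: H; rewrite ?subrr ?nm0 // ltW.
  by rewrite !fl0 //; split=> //; exact: dm0.
move=> {}t dt; have Fq := fl_neq eF c1 Fx dt.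
have [rho [d [T [chi bx]]]] := box_exists eF Fq.
have d0 : 0 < d by case: bx.
have rb c0 (s : R) : nm c0 <= 1 -> nm (rc s * c0) <= `|s|.
  by move=> h; rewrite nmM nm_rc ler_piMr.
have near u : `|u - t| < d / 8 -> dm c x u /\ fl c u x = chi (rc (u - t) * c).
  move=> ut; have [|d1 E] := @box_dm R F eF c (fl c t x) rho d T chi 0 (u - t) c1 bx.
    by rewrite nm0; lra.
  rewrite (box_at bx) add0r in d1 E.
  have := fl_shiftr eF c1 dt d1; rewrite subrKC => du; split=> //.
  by have [|_] := @fl_shift R F eF c x t (u - t) c1 dt; rewrite subrKC // => <-.
exists (d / 8); first by rewrite divr_gt0.
move=> u v du dv ut vt [eta eta0 H].
exists (Num.min eta (d / 8)); first by rewrite lt_min eta0 divr_gt0.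
move=> s; rewrite lt_min => /andP[/H[h1 h2 h3 h4] sd].
have [_ Eu] := near _ ut; have [_ Ev] := near _ vt.
have bu : nm (rc (u - t) * c) + `|s| < d.
  by have := rb c (u - t) c1; lra.
have bv : nm (rc (v - t) * c) + `|s| < d.
  by have := rb c (v - t) c1; lra.
have [_ fu] := box_dm eF c'1 bx bu.
have [dv' fv] := box_dm eF c'1 bx bv.
rewrite Ev; split=> //.
  have uv : `|v - u| < d / 4 by have := ler_distD t v u; rewrite (distrC t u); lra.
  have [|d3 E3] := @box_dm R F eF c (fl c t x) rho d T chi (rc (u - t) * c + rc s * c') (v - u) c1 bx.
    by have := nmD (rc (u - t) * c) (rc s * c'); have := rb c (u - t) c1; have := rb c' s c'1; ilra.
  rewrite -fu -Eu -h4 in d3.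
  by have := fl_shiftr eF c1 h3 d3; rewrite subrKC.
have uv : `|v - u| < d / 4 by have := ler_distD t v u; rewrite (distrC t u); lra.
have [|d3 E3] := @box_dm R F eF c (fl c t x) rho d T chi (rc (u - t) * c + rc s * c') (v - u) c1 bx.
  by have := nmD (rc (u - t) * c) (rc s * c'); have := rb c (u - t) c1; have := rb c' s c'1; ilra.
rewrite -fu -Eu -h4 in d3 E3.
have := fl_shiftr eF c1 h3 d3; rewrite subrKC => dv3.
have [|_] := @fl_shift R F eF c (fl c' s x) u (v - u) c1 h3; rewrite subrKC // => <-.
rewrite E3 fv; congr chi; rewrite !rcB; ring.
Qed.

(** For a fixed, possibly long [s] the curve [t |-> fl c' s (fl c t x)] is shown to solve the
    equation of [c F]; its derivative comes from [comm_local] with the roles of the flows exchanged.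
    Uniqueness does the rest. Mere existence at both corners would not suffice: the flow of [c' F]
    must reach [s] all along [I]. *)
Lemma comm_strip c c' x (s : R) I : nm c <= 1 -> nm c' <= 1 -> open I -> is_interval I -> I 0 ->
  (forall t, I t -> dm c x t) -> (forall t, I t -> dm c' (fl c t x) s) ->
  forall t, I t -> dm c (fl c' s x) t /\ fl c t (fl c' s x) = fl c' s (fl c t x).
Proof.
move=> c1 c'1 oI iI I0 Ic Ic' t It.
have [Fx|Fx] := eqVneq (F x) 0.
  have E c0 (u : R) : nm c0 <= 1 -> fl c0 u x = x by move=> h; have [] := fl_eq eF u h Fx.
  by rewrite !E //; split=> //; have [] := fl_eq eF t c1 Fx.
have := @fl_max R F eF c (fl c' s x) I (fun t => fl c' s (fl c t x)) c1 oI iI I0.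
rewrite fl0 // => /(_ erefl) H; have [|h ->] := H _ t It; last by [].
move=> {}t {}It; have Fp := fl_neq eF c1 Fx (Ic _ It).
have [eta eta0 K] := comm_local c'1 c1 Fp (Ic' _ It).
have dt := Ic _ It.
apply: (@cder_near _ (fun u => fl c (u - t) (fl c' s (fl c t x)))).
  exists eta => // u ut; have [h1 h2 h3 h4] := K _ ut.
  rewrite -h4; congr (fl c' s); have [|_] := @fl_shift R F eF c x t (u - t) c1 dt.
    by apply: fl_shiftr.
  by rewrite subrKC.
apply: (@cder_shift _ (fl c ^~ (fl c' s (fl c t x))) t (- t)); rewrite subrr.
have := fl_der eF c1 (dm0 eF (fl c' s (fl c t x)) c1).
by rewrite fl0.
Qed.

(** The composed flow is, near the parameters [(s, t)], the inverse chart [chi] applied to a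
    real-linear map. This carries continuity, openness and local injectivity of the sheet. *)
Lemma box_psi c c' x (s t : R) : nm c <= 1 -> nm c' <= 1 -> F x != 0 ->
  dm c' x s -> dm c (fl c' s x) t ->
  forall rho d T chi, box F (fl c t (fl c' s x)) rho d T chi ->
  exists2 eta : R, 0 < eta & forall u v : R, `|u| < eta -> `|v| < eta ->
    [/\ dm c' x (s + u), dm c (fl c' (s + u) x) (t + v) &
      fl c (t + v) (fl c' (s + u) x) = chi (rc u * c' + rc v * c)].
Proof.
move=> c1 c'1 Fx ds dt rho d T chi bx.
have d0 : 0 < d by case: bx.
have Fy := fl_neq eF c'1 Fx ds.
have [eta eta0 K] := comm_local c1 c'1 Fy dt.
exists (Num.min eta (d / 4)); first by rewrite lt_min eta0 divr_gt0.
move=> u v; rewrite !lt_min => /andP[/K[h1 h2 h3 h4] ud] /andP[_ vd].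
have dsu := fl_shiftr eF c'1 ds h1.
have [|_ E] := @fl_shift R F eF c' x s u c'1 ds; first by [].
have rb c0 (r : R) : nm c0 <= 1 -> nm (rc r * c0) <= `|r|.
  by move=> h; rewrite nmM nm_rc ler_piMr.
have [|_ E1] := @box_dm R F eF c' _ rho d T chi 0 u c'1 bx.
  by rewrite nm0; have := normr_ge0 u; ilra.
rewrite (box_at bx) add0r in E1.
have [|d2 E2] := @box_dm R F eF c _ rho d T chi (rc u * c') v c1 bx.
  by have := rb c' u c'1; ilra.
rewrite -E1 -h4 in d2 E2.
have h5 := fl_shiftr eF c1 h3 d2.
rewrite -E; split=> //; rewrite -E2.
by have [|_ ->] := @fl_shift R F eF c (fl c' u (fl c' s x)) t v c1 h3.
Qed.

Variable d : C.
Hypothesis hd : d = ci R \/ d = - ci R.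

Lemma nm_d : nm d = 1.
Proof. by case: hd => ->; rewrite ?nmN nm_ci. Qed.

Lemma nm_d1 : nm d <= 1.
Proof. by rewrite nm_d. Qed.

Lemma nm_11 : nm (1 : C) <= 1.
Proof. by rewrite nm1. Qed.

Lemma basis_d w : exists s t : R, [/\ w = rc s * d + rc t * 1, `|s| <= nm w & `|t| <= nm w].
Proof.
case: hd => ->; [exists (complex.Im w)|exists (- complex.Im w)]; exists (complex.Re w);
  rewrite ?normrN ler_Re ler_Im; split=> //; rewrite {1}(ReIm w) ?rcN; ring.
Qed.

(** [d] and 1 form a real basis of the plane, so the coordinates of [T u] in this basis are the two
    flow times. *)
Lemma nbhd_repr q (e : R) : F q != 0 -> 0 < e ->
  exists2 r : R, 0 < r & forall u, nm (u - q) < r -> exists s t : R,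
    [/\ `|s| < e, `|t| < e, dm d q s, dm 1 (fl d s q) t & u = fl 1 t (fl d s q)].
Proof.
move=> Fq e0; have [rho [d' [T [chi bx]]]] := box_exists eF Fq.
have d'0 : 0 < d' by case: bx.
have bx' : box F (fl 1 0 (fl d 0 q)) rho d' T chi by rewrite !fl0 ?nm_11 ?nm_d1.
have [eta eta0 K] := box_psi nm_11 nm_d1 Fq (dm0 eF q nm_d1) (dm0 eF _ nm_11) bx'.
have m0 : 0 < Num.min (Num.min e eta) d' by rewrite !lt_min e0 eta0.
have [r r0 hr] := box_nbhd bx m0.
exists r => // u /hr[_ + Tc]; have [s [t [E sw tw]]] := basis_d (T u).
rewrite !lt_min => /andP[/andP[Te Teta] Td].
have [h1 h2 h3] := K s t (le_lt_trans sw Teta) (le_lt_trans tw Teta).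
rewrite !add0r in h1 h2 h3.
exists s, t; split=> //; [exact: le_lt_trans sw Te|exact: le_lt_trans tw Te|].
by rewrite h3 -E Tc.
Qed.

End Commute.

(** * Homoclinic orbits and limit sets *)

Section Homoclinic.
Variable R : realType.
Local Notation C := (Cplx R).
Implicit Types (z q w x b c : C) (I : set R) (y : R -> C).

Lemma cvgCP (u : nat -> C) (v : C) : (u n @[n --> \oo] --> v) <->
  forall e : R, 0 < e -> exists N, forall n, (N <= n)%N -> nm (u n - v) < e.
Proof.
split=> [H e e0|H A /nbhs_nmP[e e0 eA]].
  have /H : nbhs v [set y | nm (y - v) < e] by apply/nbhs_nmP; exists e.
  by move=> [N _ hN]; exists N => n Nn; exact: hN.
by have [N hN] := H _ e0; exists N => // n /= Nn; apply/eA/hN.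
Qed.

Lemma cvg_pinftyP (t : nat -> R) : (t n @[n --> \oo] --> +oo) <->
  forall M : R, exists N, forall n, (N <= n)%N -> M < t n.
Proof.
split=> [/cvgryPgt H M|H].
  by have [N _ hN] := H M; exists N => n Nn; exact: hN.
by apply/cvgryPgt => M; have [N hN] := H M; exists N => // n /= Nn; exact: hN.
Qed.

Lemma cvg_ninftyP (t : nat -> R) : (t n @[n --> \oo] --> -oo) <->
  forall M : R, exists N, forall n, (N <= n)%N -> t n < M.
Proof.
split=> [/cvgrNyPlt H M|H].
  by have [N _ hN] := H M; exists N => n Nn; exact: hN.
by apply/cvgrNyPlt => M; have [N hN] := H M; exists N => // n /= Nn; exact: hN.
Qed.

Lemma crosses_level (g : R -> C) a (e t1 t2 : R) : t1 <= t2 ->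
  (forall t, t1 <= t <= t2 -> ccont g t) -> nm (g t1 - a) < e -> e <= nm (g t2 - a) ->
  exists2 t, t1 <= t <= t2 & nm (g t - a) = e.
Proof.
move=> t12 cg g1 g2; apply: contrapT => H.
suff : nm (g t2 - a) < e by rewrite ltNge g2.
have iI : is_interval [set t : R | t1 <= t <= t2].
  by move=> u v /andP[u1 u2] /andP[v1 v2] s /andP[s1 s2] /=; apply/andP; split; lra.
apply: (@interval_ind R [set t | t1 <= t <= t2] (fun t => nm (g t - a) < e) t1) => //=.
- by rewrite lexx.
- move=> t tI; have n0 : 0 < `|nm (g t - a) - e|.
    by rewrite normr_gt0 subr_eq0; apply/eqP => E; apply: H; exists t.
  have [d d0 hd] := cg _ tI _ n0.
  exists d => // u v _ _ /hd hu /hd hv pu.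
  have := nm_tri (g u) (g t) a; have := nm_tri (g t) (g u) a.
  have := nm_tri (g v) (g t) a; have := nm_tri (g t) (g v) a.
  move: hu hv pu; rewrite (nmBC (g t) (g u)) (nmBC (g t) (g v)).
  by case: (ger0P (nm (g t - a) - e)) => k hu hv pu h1 h2 h3 h4; lra.
- by rewrite lexx t12.
Qed.

(** A limit set equal to [{a}] does not by itself exclude excursions to infinity. A curve that keeps
    returning to [a] without converging crosses some circle around [a] at arbitrarily late times,
    and the crossings accumulate on that circle. *)
Lemma conv_of_accu (g : R -> C) a : (forall t, 0 <= t -> ccont g t) ->
  (forall M e : R, 0 < e -> exists2 t, M <= t & nm (g t - a) < e) ->
  (forall z (s : nat -> R), (forall n, n%:R <= s n) ->
     (forall e : R, 0 < e -> exists N, forall n, (N <= n)%N -> nm (g (s n) - z) < e) -> z = a) ->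
  forall e : R, 0 < e -> exists M, forall t, M <= t -> nm (g t - a) < e.
Proof.
move=> cg near uniq e e0; apply: contrapT => H.
have {}H (n : nat) : exists t, n%:R <= t /\ nm (g t - a) = e.
  have [t1 nt1 g1] := near n%:R e e0.
  have [t2 [t12 g2]] : exists t2, t1 <= t2 /\ e <= nm (g t2 - a).
    apply: contrapT => K; apply: H; exists t1 => t t1t; rewrite ltNge; apply/negP => h.
    by apply: K; exists t.
  have t10 : 0 <= t1 by apply: le_trans nt1.
  have [|t /andP[h1 h2] gt] := crosses_level t12 _ g1 g2.
    by move=> t /andP[h1 h2]; apply: cg; exact: le_trans h1.
  by exists t; split=> //; exact: le_trans h1.
have [s hs] := choice H.
have [|z hz] := @accu R (fun n => g (s n)) (e + nm a).
  move=> n; have := nmD (g (s n) - a) a; rewrite subrK (hs n).2; ilra.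
have {}hz (k : nat) : exists n, (k <= n)%N /\ nm (g (s n) - z) < k.+1%:R^-1.
  by have [|n] := hz k.+1%:R^-1 _ k; [rewrite invr_gt0|exists n].
have [r hr] := choice hz.
have za : z = a.
  apply: (uniq z (fun k => s (r k))).
    by move=> k; apply: (le_trans _ (hs (r k)).1); rewrite ler_nat; exact: (hr k).1.
  move=> e' e'0; have [N hN] := invn_lt e'0; exists N => n /hN; apply: lt_trans.
  exact: (hr n).2.
have [N hN] := invn_lt e0.
have := lt_trans (hr N).2 (hN N (leqnn N)).
by rewrite za (hs _).2 ltxx.
Qed.

Variable F : C -> C.
Hypothesis eF : entire F.
Variable a : C.
Hypothesis Fa : F a = 0.
Local Notation fl := (fl F).
Local Notation dm := (dm F).
Let n1 := @nm_11 R.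

Lemma mul1F : (fun z => 1 * F z) = F.
Proof. by apply/funext => z; rewrite mul1r. Qed.

Lemma flow_fl (t : R) x : flow F t x = fl 1 t x.
Proof. by rewrite /fl mul1F. Qed.

Lemma Imax_dm x : Imax F x = dm 1 x.
Proof. by rewrite /dm mul1F. Qed.

Lemma orbitP x z : flow_orbit F x z <-> exists2 t, dm 1 x t & fl 1 t x = z.
Proof.
rewrite /flow_orbit Imax_dm; split=> [[t dt <-]|[t dt <-]].
  by exists t => //; rewrite flow_fl.
by exists t => //; rewrite flow_fl.
Qed.

Lemma orbit_refl x : flow_orbit F x x.
Proof. by apply/orbitP; exists 0; [exact: dm0|exact: fl0]. Qed.

Lemma orbit_eq x z : flow_orbit F x z -> flow_orbit F z = flow_orbit F x.
Proof.
move=> /orbitP[t dt <-]; apply/seteqP; split=> w /orbitP[s ds <-]; apply/orbitP.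
  have h := fl_shiftr eF n1 dt ds; exists (t + s) => //.
  by have [|_ ->] := @fl_shift R F eF 1 x t s n1 dt.
have [|h E] := @fl_shift R F eF 1 x t (s - t) n1 dt; first by rewrite subrKC.
by exists (s - t) => //; rewrite E subrKC.
Qed.

Lemma omega_posP x v : omega_pos F (flow_orbit F x) v <-> exists t : nat -> R,
  [/\ forall k, dm 1 x (t k), forall M : R, exists N, forall k, (N <= k)%N -> M < t k &
   forall e : R, 0 < e -> exists N, forall k, (N <= k)%N -> nm (fl 1 (t k) x - v) < e].
Proof.
split=> [[x' /orbitP[t0 dt0 <-] [t [dt /cvg_pinftyP tc /cvgCP fc]]]|[t [dt tc fc]]].
  rewrite Imax_dm in dt.
  have E k : dm 1 x (t0 + t k) /\ flow F (t k) (fl 1 t0 x) = fl 1 (t0 + t k) x.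
    have h := fl_shiftr eF n1 dt0 (dt k); split=> //.
    by rewrite flow_fl; have [|_ ->] := @fl_shift R F eF 1 x t0 (t k) n1 dt0.
  exists (fun k => t0 + t k); split=> [k|M|e e0]; first by have [] := E k.
    by have [N hN] := tc (M - t0); exists N => k /hN; rewrite ltrBlDl.
  by have [N hN] := fc e e0; exists N => k /hN; rewrite (E k).2.
exists x; first exact: orbit_refl.
exists t; split; first by rewrite Imax_dm.
  by apply/cvg_pinftyP.
by apply/cvgCP => e e0; have [N hN] := fc e e0; exists N => k; rewrite flow_fl; exact: hN.
Qed.

Lemma omega_negP x v : omega_neg F (flow_orbit F x) v <-> exists t : nat -> R,
  [/\ forall k, dm 1 x (t k), forall M : R, exists N, forall k, (N <= k)%N -> t k < M &
   forall e : R, 0 < e -> exists N, forall k, (N <= k)%N -> nm (fl 1 (t k) x - v) < e].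
Proof.
split=> [[x' /orbitP[t0 dt0 <-] [t [dt /cvg_ninftyP tc /cvgCP fc]]]|[t [dt tc fc]]].
  rewrite Imax_dm in dt.
  have E k : dm 1 x (t0 + t k) /\ flow F (t k) (fl 1 t0 x) = fl 1 (t0 + t k) x.
    have h := fl_shiftr eF n1 dt0 (dt k); split=> //.
    by rewrite flow_fl; have [|_ ->] := @fl_shift R F eF 1 x t0 (t k) n1 dt0.
  exists (fun k => t0 + t k); split=> [k|M|e e0]; first by have [] := E k.
    by have [N hN] := tc (M - t0); exists N => k /hN; rewrite ltrBrDl.
  by have [N hN] := fc e e0; exists N => k /hN; rewrite (E k).2.
exists x; first exact: orbit_refl.
exists t; split; first by rewrite Imax_dm.
  by apply/cvg_ninftyP.
by apply/cvgCP => e e0; have [N hN] := fc e e0; exists N => k; rewrite flow_fl; exact: hN.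
Qed.

Lemma dm_unbounded_pos x : (forall M : R, exists2 t, M < t & dm 1 x t) -> forall t, 0 <= t -> dm 1 x t.
Proof.
move=> H t t0; have [s ts ds] := H t; apply: (dm_itv eF n1 (dm0 eF x n1) ds).
by rewrite t0 ltW.
Qed.

Lemma dm_unbounded_neg x : (forall M : R, exists2 t, t < M & dm 1 x t) -> forall t, t <= 0 -> dm 1 x t.
Proof.
move=> H t t0; have [s ts ds] := H t; apply: (dm_itv eF n1 ds (dm0 eF x n1)).
by rewrite t0 ltW.
Qed.

Definition tail_pos x := (exists M : R, forall t, M <= t -> dm 1 x t) /\
  forall e : R, 0 < e -> exists M, forall t, M <= t -> nm (fl 1 t x - a) < e.

Definition tail_neg x := (exists M : R, forall t, t <= M -> dm 1 x t) /\
  forall e : R, 0 < e -> exists M, forall t, t <= M -> nm (fl 1 t x - a) < e.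

Lemma omega_pos_tail x : tail_pos x -> omega_pos F (flow_orbit F x) = [set a].
Proof.
move=> [[M0 hM0] H]; apply/seteqP; split=> [v /omega_posP[t [dt tc fc]] /=|_ ->].
  apply/eqP; rewrite -subr_eq0; apply/eqP; apply: eq0_of_small => e e0.
  have e2 : 0 < e / 2 by rewrite divr_gt0.
  have [M hM] := H _ e2; have [N1 h1] := tc M; have [N2 h2] := fc _ e2.
  have k1 := h1 _ (leq_maxl N1 N2); have k2 := h2 _ (leq_maxr N1 N2).
  have := hM _ (ltW k1); have := nm_tri v (fl 1 (t (maxn N1 N2)) x) a.
  by rewrite (nmBC v (fl 1 _ x)); ilra.
have [N hN] : exists N : nat, M0 <= N%:R.
  by exists (Num.truncn `|M0|).+1; apply: (le_trans (ler_norm _)); rewrite ltW // truncnS_gt.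
apply/omega_posP; exists (fun k => (N + k)%:R); split=> [k|M|e e0].
- by apply: hM0; apply: (le_trans hN); rewrite ler_nat leq_addr.
- exists (Num.truncn `|M|).+1 => k hk; apply: (le_lt_trans (ler_norm _)).
  by apply: (lt_le_trans (truncnS_gt _)); rewrite ler_nat (leq_trans hk) // leq_addl.
have [M hM] := H _ e0; exists (Num.truncn `|M|).+1 => k hk; apply: hM.
apply: (le_trans (ler_norm _)); apply: (le_trans (ltW (truncnS_gt _))).
by rewrite ler_nat (leq_trans hk) // leq_addl.
Qed.

Lemma omega_neg_tail x : tail_neg x -> omega_neg F (flow_orbit F x) = [set a].
Proof.
move=> [[M0 hM0] H]; apply/seteqP; split=> [v /omega_negP[t [dt tc fc]] /=|_ ->].
  apply/eqP; rewrite -subr_eq0; apply/eqP; apply: eq0_of_small => e e0.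
  have e2 : 0 < e / 2 by rewrite divr_gt0.
  have [M hM] := H _ e2; have [N1 h1] := tc M; have [N2 h2] := fc _ e2.
  have k1 := h1 _ (leq_maxl N1 N2); have k2 := h2 _ (leq_maxr N1 N2).
  have := hM _ (ltW k1); have := nm_tri v (fl 1 (t (maxn N1 N2)) x) a.
  by rewrite (nmBC v (fl 1 _ x)); ilra.
have nle (M : R) k : ((Num.truncn `|M|).+1 <= k)%N -> - k%:R < M.
  move=> hk; rewrite ltrNl; apply: (le_lt_trans (ler_norm _)); rewrite normrN.
  by apply: (lt_le_trans (truncnS_gt _)); rewrite ler_nat.
apply/omega_negP; exists (fun k => - ((Num.truncn `|M0|).+1 + k)%:R); split=> [k|M|e e0].
- by apply: hM0; apply/ltW/nle; rewrite leq_addr.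
- by exists (Num.truncn `|M|).+1 => k hk; apply: nle; rewrite (leq_trans hk) // leq_addl.
have [M hM] := H _ e0; exists (Num.truncn `|M|).+1 => k hk; apply: hM; apply/ltW/nle.
by rewrite (leq_trans hk) // leq_addl.
Qed.

(** The working form of homoclinicity: convergence to [a] at both ends of time, expressed at once by
    [|t|]. The condition [F x != 0] stands for the orbit avoiding [a]. *)
Definition hom x := [/\ F x != 0, forall t, dm 1 x t &
  forall e : R, 0 < e -> exists M, forall t, M <= `|t| -> nm (fl 1 t x - a) < e].

Lemma hom_tail x : F x != 0 -> (forall t, dm 1 x t) -> tail_pos x -> tail_neg x -> hom x.
Proof.
move=> Fx dx [_ hp] [_ hn]; split=> // e e0.
have [M1 h1] := hp _ e0; have [M2 h2] := hn _ e0.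
exists (Num.max M1 (- M2)) => t; rewrite ge_max => /andP[m1 m2].
have [t0|t0] := lerP 0 t; first by apply: h1; rewrite -(ger0_norm t0).
by apply: h2; move: m2; rewrite ltr0_norm // lerN2.
Qed.

Lemma hom_tail_pos x : hom x -> tail_pos x.
Proof.
move=> [Fx dx H]; split; first by exists 0 => t _; exact: dx.
by move=> e /H[M hM]; exists M => t Mt; apply: hM; exact: (le_trans Mt (ler_norm _)).
Qed.

Lemma hom_tail_neg x : hom x -> tail_neg x.
Proof.
move=> [Fx dx H]; split; first by exists 0 => t _; exact: dx.
move=> e /H[M hM]; exists (- M) => t tM; apply: hM; rewrite -normrN.
by apply: le_trans (ler_norm _); rewrite lerNr.
Qed.

Lemma homP x : homoclinic F a (flow_orbit F x) <-> hom x.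
Proof.
split=> [[_ na op on]|[Fx dx H]]; last first.
  split; first by exists x.
  - move=> /orbitP[t dt E]; have := fl_neq eF n1 Fx dt; by rewrite E Fa eqxx.
  - by apply: omega_pos_tail; exact: hom_tail_pos.
  - by apply: omega_neg_tail; exact: hom_tail_neg.
have [tp [dp hp ap]] : exists t : nat -> R,
  [/\ forall k, dm 1 x (t k), forall M : R, exists N, forall k, (N <= k)%N -> M < t k &
   forall e : R, 0 < e -> exists N, forall k, (N <= k)%N -> nm (fl 1 (t k) x - a) < e].
  by apply/omega_posP; rewrite op.
have [tn [dn hn an]] : exists t : nat -> R,
  [/\ forall k, dm 1 x (t k), forall M : R, exists N, forall k, (N <= k)%N -> t k < M &
   forall e : R, 0 < e -> exists N, forall k, (N <= k)%N -> nm (fl 1 (t k) x - a) < e].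
  by apply/omega_negP; rewrite on.
have dpos : forall t, 0 <= t -> dm 1 x t.
  by apply: dm_unbounded_pos => M; have [N hN] := hp M; exists (tp N) => //; exact: hN.
have dneg : forall t, t <= 0 -> dm 1 x t.
  by apply: dm_unbounded_neg => M; have [N hN] := hn M; exists (tn N) => //; exact: hN.
have Fx : F x != 0.
  (* The orbit of an equilibrium is one point, which then is its own limit [a]. *)
  apply/eqP => F0; apply: na; suff -> : a = x by exact: orbit_refl.
  apply/eqP; rewrite -subr_eq0; apply/eqP; apply: eq0_of_small => e e0.
  have [N hN] := ap _ e0; have := hN N (leqnn N).
  by have [_ ->] := fl_eq eF (tp N) n1 F0; rewrite nmBC.
apply: hom_tail => //.
- by move=> t; case: (lerP 0 t) => [/dpos//|/ltW/dneg].
- split; first by exists 0.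
  apply: (@conv_of_accu (fl 1 ^~ x)).
  + by move=> t t0; apply: fl_cont => //; exact: dpos.
  + move=> M e e0; have [N1 h1] := hp M; have [N2 h2] := ap _ e0.
    exists (tp (maxn N1 N2)); first by rewrite ltW // h1 // leq_maxl.
    by apply: h2; rewrite leq_maxr.
  move=> z s hs hz; have : omega_pos F (flow_orbit F x) z; last by rewrite op.
  apply/omega_posP; exists s; split=> // [k|M].
    by apply: dpos; exact: le_trans (hs k).
  exists (Num.truncn `|M|).+1 => k hk; apply: (le_lt_trans (ler_norm _)).
  by apply: (lt_le_trans (truncnS_gt _)); apply: le_trans (hs k); rewrite ler_nat.
split; first by exists 0.
have K : forall e : R, 0 < e -> exists M, forall t, M <= t -> nm (fl 1 (- t) x - a) < e.
  apply: (@conv_of_accu (fun t => fl 1 (- t) x)).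
  + move=> t t0; apply: (@cder_cont _ _ _ (- (1 * F (fl 1 (- t) x)))).
    apply: (@cder_rev R (fl 1 ^~ x)); apply: fl_der => //; apply: dneg; by rewrite oppr_le0.
  + move=> M e e0; have [N1 h1] := hn (- M); have [N2 h2] := an _ e0.
    exists (- tn (maxn N1 N2)); first by rewrite ltW // ltrNr h1 // leq_maxl.
    by rewrite opprK; apply: h2; rewrite leq_maxr.
  move=> z s hs hz; have : omega_neg F (flow_orbit F x) z; last by rewrite on.
  apply/omega_negP; exists (fun k => - s k); split=> // [k|M].
    by apply: dneg; rewrite oppr_le0; exact: le_trans (hs k).
  exists (Num.truncn `|M|).+1 => k hk; rewrite ltrNl; apply: (le_lt_trans (ler_norm _)); rewrite normrN.
  by apply: (lt_le_trans (truncnS_gt _)); apply: le_trans (hs k); rewrite ler_nat.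
move=> e /K[M hM]; exists (- M) => t tM; rewrite -(opprK t); apply: hM; by rewrite lerNr.
Qed.

Lemma homoclinic_orbit Xi : homoclinic F a Xi -> exists2 x, Xi = flow_orbit F x & hom x.
Proof. by move=> /[dup] -[[x ->] _ _ _] /homP h; exists x. Qed.

Lemma hom_flow x t : hom x -> hom (fl 1 t x).
Proof.
move=> hx; apply/homP; rewrite (@orbit_eq x); first by apply/homP.
by apply/orbitP; exists t => //; case: hx.
Qed.

End Homoclinic.

(** * The sheet of homoclinic orbits *)

Section Sheet.
Variable R : realType.
Local Notation C := (Cplx R).
Implicit Types (z q w x b c : C) (I : set R).

(* The real part attains its extrema on the compact set, but not in the open set V, hence
   at a, so it is constant. *)
Lemma no_clopen_bounded (V : set C) a : V !=set0 -> open V -> ~ V a ->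
  closed (V `|` [set a]) -> bdd (V `|` [set a]) -> False.
Proof.
move=> [v0 Vv0] /open_nmP oV Va cV bV.
have cRe (s : R) (x : C) : ccontR (fun z => s * complex.Re z) x.
  move=> e e0; exists (e / (`|s| + 1)); first by rewrite divr_gt0 // ltr_wpDl.
  move=> y; rewrite ltr_pdivlMr ?ltr_wpDl // => yx.
  rewrite -mulrBr normrM -ReN -ReD.
  have h1 : `|s| * `|complex.Re (y - x)| <= `|s| * nm (y - x) by rewrite ler_wpM2l // ler_Re.
  have h2 : `|s| * nm (y - x) + nm (y - x) < e.
    by move: yx; rewrite mulrDr mulr1 [nm _ * `|s|]mulrC.
  by have := nm_ge0 (y - x); ilra.
have ext (s : R) : s = 1 \/ s = -1 -> forall y, V y -> s * complex.Re a <= s * complex.Re y.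
  move=> hs.
  have [||z Kz zmin] := @min_attained R (V `|` [set a]) (fun z => s * complex.Re z) cV bV.
  - by exists a; right.
  - by move=> x _; exact: cRe.
  suff za : z = a by move=> y Vy; rewrite -za; apply: zmin; left.
  case: Kz => // Vz; have [e e0 he] := oV _ Vz.
  have e2 : 0 < e / 2 by rewrite divr_gt0.
  have : V (z - rc (s * (e / 2))).
    apply: he; rewrite addrC addKr nmN nm_rc normrM.
    case: hs => ->; rewrite ?normrN1 ?normr1 mul1r gtr0_norm //; lra.
  move=> Vz'; have := zmin _ (or_introl Vz'); rewrite ReD ReN /=.
  by case: hs => -> ?; exfalso; lra.
have [e e0 he] := oV _ Vv0.
have e2 : 0 < e / 2 by rewrite divr_gt0.
have V1 : V (v0 + rc (e / 2)).
  by apply: he; rewrite addrC addKr nm_rc gtr0_norm //; lra.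
have := ext 1 (or_introl erefl) _ Vv0; have := ext (-1) (or_intror erefl) _ V1.
rewrite ReD /=; ilra.
Qed.

Definition jcont (g : R -> R -> C) (t s : R) := forall e : R, 0 < e ->
  exists2 d : R, 0 < d & forall t' s' : R, `|t' - t| < d -> `|s' - s| < d ->
    nm (g t' s' - g t s) < e.

(** The rectangle is coded as a subset of [C] in order to reuse [uniform_on]. With a degenerate
    second side it serves for intervals. *)
Lemma uniform_rect (P : R -> R -> R -> Prop) (a1 b1 a2 b2 : R) :
  (forall d d' t s, d' <= d -> P d t s -> P d' t s) ->
  (forall t s, a1 <= t <= b1 -> a2 <= s <= b2 -> exists2 r, 0 < r & exists2 d, 0 < d &
     forall t' s', `|t' - t| < r -> `|s' - s| < r -> a1 <= t' <= b1 -> a2 <= s' <= b2 -> P d t' s') ->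
  exists2 d, 0 < d & forall t s, a1 <= t <= b1 -> a2 <= s <= b2 -> P d t s.
Proof.
move=> mono loc.
pose K := [set z : C | a1 <= complex.Re z <= b1 /\ a2 <= complex.Im z <= b2].
have [||||d d0 H] := @uniform_on R K (fun d z => P d (complex.Re z) (complex.Im z)).
- apply/closed_nmP => z H.
  have A (e : R) : 0 < e -> [/\ a1 <= complex.Re z + e, complex.Re z <= b1 + e,
      a2 <= complex.Im z + e & complex.Im z <= b2 + e].
    move=> e0; have [y [/andP[h1 h2] /andP[h3 h4]] yz] := H _ e0.
    have := ler_Re (y - z); have := ler_Im (y - z); rewrite !ler_norml ReD ImD ReN ImN.
    by move=> /andP[k1 k2] /andP[k3 k4]; split; lra.
  by split; apply/andP; split; apply/ler_addgt0Pr => e /A[].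
- exists (`|a1| + `|b1| + (`|a2| + `|b2|)) => z [/andP[h1 h2] /andP[h3 h4]].
  rewrite (le_trans (nm_le_ReIm _)) // lerD // ler_norml; apply/andP; split.
  + by have := lerNnormlW (lexx `|a1|); have := normr_ge0 b1; ilra.
  + by have := ler_norm b1; have := normr_ge0 a1; ilra.
  + by have := lerNnormlW (lexx `|a2|); have := normr_ge0 b2; ilra.
  + by have := ler_norm b2; have := normr_ge0 a2; ilra.
- by move=> d d' y; exact: mono.
- move=> z [h1 h2]; have [r r0 [d d0 hd]] := loc _ _ h1 h2.
  exists r => //; exists d => // y [h3 h4] yz.
  apply: hd => //; rewrite -?ReN -?ImN -?ReD -?ImD.
    exact: le_lt_trans (ler_Re _) yz.
  exact: le_lt_trans (ler_Im _) yz.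
by exists d => // t s ht hs; exact: (H (Complex t s)).
Qed.

Lemma image_rect_closed (g : R -> R -> C) (a1 b1 a2 b2 : R) q :
  (forall t s, a1 <= t <= b1 -> a2 <= s <= b2 -> jcont g t s) ->
  (forall e : R, 0 < e -> exists t s, [/\ a1 <= t <= b1, a2 <= s <= b2 & nm (g t s - q) < e]) ->
  exists t s, [/\ a1 <= t <= b1, a2 <= s <= b2 & g t s = q].
Proof.
move=> cg H; apply: contrapT => nH.
have [||d d0 K] := @uniform_rect (fun d t s => d <= nm (g t s - q)) a1 b1 a2 b2.
- by move=> d d' t s; exact: le_trans.
- move=> t s ht hs; have n0 : 0 < nm (g t s - q).
    by rewrite nm_gt0 subr_eq0; apply/eqP => E; apply: nH; exists t, s.
  have [r r0 hr] := cg _ _ ht hs _ (divr_gt0 n0 (ltr0Sn R 1)).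
  exists r => //; exists (nm (g t s - q) / 2); first by rewrite divr_gt0.
  move=> t' s' ht' hs' _ _; have := hr _ _ ht' hs'.
  by have := nm_tri (g t s) (g t' s') q; rewrite (nmBC (g t s) (g t' s')); ilra.
have [t [s [ht hs]]] := H _ d0.
by rewrite ltNge K.
Qed.

Lemma image_rect_bdd (g : R -> R -> C) (a1 b1 a2 b2 : R) :
  (forall t s, a1 <= t <= b1 -> a2 <= s <= b2 -> jcont g t s) ->
  exists M : R, forall t s, a1 <= t <= b1 -> a2 <= s <= b2 -> nm (g t s) <= M.
Proof.
move=> cg.
have [||d d0 K] := @uniform_rect (fun d t s => 0 < d -> nm (g t s) <= d^-1) a1 b1 a2 b2.
- move=> d d' t s dd H d'0; have d0 := lt_le_trans d'0 dd.
  by apply: (le_trans (H d0)); rewrite lef_pV2 ?posrE.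
- move=> t s ht hs; have [r r0 hr] := cg _ _ ht hs _ ltr01.
  have n0 : 0 < nm (g t s) + 1 by rewrite ltr_wpDl ?nm_ge0.
  exists r => //; exists (nm (g t s) + 1)^-1; first by rewrite invr_gt0.
  move=> t' s' ht' hs' _ _ _; have := hr _ _ ht' hs'; rewrite invrK.
  by have := nmD (g t' s' - g t s) (g t s); rewrite subrK; ilra.
by exists d^-1 => t s ht hs; exact: K.
Qed.

Variable F : C -> C.
Hypothesis eF : entire F.
Variable a : C.
Hypothesis Fa : F a = 0.
Variable d : C.
Hypothesis hd : d = ci R \/ d = - ci R.
Local Notation fl := (fl F).
Local Notation dm := (dm F).
Local Notation hom := (hom F a).
Let n1 := @nm_11 R.
Let nd := nm_d1 hd.

(** The time span [tau] is the same for all scales [e]. Hence moving a curve by a fixed time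
    preserves its convergence to an equilibrium. *)
Lemma near_eq_flow b : F b = 0 -> exists2 tau : R, 0 < tau & exists2 r : R, 0 < r &
  forall c x (s e : R), nm c <= 1 -> `|s| <= tau -> e <= r -> nm (x - b) < e / 2 ->
    dm c x s /\ nm (fl c s x - b) < e.
Proof.
move=> Fb; have [tau tau0 [r r0 H]] := near_equilibrium eF Fb.
have [r' r'0 [tau' tau'0 H']] := local_time eF b.
exists (Num.min tau tau'); first by rewrite lt_min tau0.
exists (Num.min r r'); first by rewrite lt_min r0.
move=> c x s e c1; rewrite !le_min => /andP[st st'] /andP[er er'] xb.
have e0 : 0 < e by have := nm_ge0 (x - b); ilra.
have ds : dm c x s by apply: H' => //; lra.
split=> //; have [_ iI I0 f0 hf] := fl_sol eF x c1.
apply: (H c (dm c x) (fl c ^~ x) 0 s) => //; first by rewrite subr0.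
by rewrite f0.
Qed.

Lemma hom_comm x (s : R) : hom x -> (forall t, dm d (fl 1 t x) s) ->
  forall t, dm 1 (fl d s x) t /\ fl 1 t (fl d s x) = fl d s (fl 1 t x).
Proof.
move=> [Fx dx _] h t.
by apply: (@comm_strip R F eF 1 d x s setT) => //; exact: openT.
Qed.

Lemma fl_jcont x (s t : R) : F x != 0 -> dm d x s -> dm 1 (fl d s x) t ->
  jcont (fun t s => fl 1 t (fl d s x)) t s.
Proof.
move=> Fx ds dt e e0.
have Fy : F (fl 1 t (fl d s x)) != 0 by apply: (fl_neq eF n1 _ dt); exact: (fl_neq eF nd).
have [rho [d' [T [chi bx]]]] := box_exists eF Fy.
have [eta eta0 K] := box_psi eF n1 nd Fx ds dt bx.
have [rho0 d'0 _ _ [_ _ hchi]] := bx.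
have [|r r0 hr] := hol_cont (hchi 0 _) e0; first by rewrite nm0.
exists (Num.min eta (r / 2)); first by rewrite lt_min eta0 divr_gt0.
move=> t' s'; rewrite !lt_min => /andP[t1 t2] /andP[s1 s2].
have [_ _] := K _ _ s1 t1; rewrite !subrKC => ->.
rewrite -[X in _ - X](box_at bx); apply: hr; rewrite subr0.
by rewrite mulr1 (le_lt_trans (nmD _ _)) // nmM !nm_rc (nm_d hd) mulr1; lra.
Qed.

(** By commutation the moved curve is again an orbit, and its ends stay near [a]. The bound [tau]
    comes from [a] alone and is thus common to all homoclinic orbits. *)
Lemma hom_step : exists2 tau : R, 0 < tau & forall x s, hom x -> `|s| <= tau ->
  (forall t, dm d (fl 1 t x) s) -> hom (fl d s x).
Proof.
have [tau tau0 [r r0 H]] := near_eq_flow Fa.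
exists tau => // x s hx st ds; have [Fx dx tx] := hx; have hc := hom_comm hx ds.
have d0 : dm d x s by rewrite -(fl0 eF x n1).
split; first exact: fl_neq.
  by move=> t; have [] := hc t.
move=> e e0; have m0 : 0 < Num.min e r by rewrite lt_min e0.
have [M hM] := tx _ (divr_gt0 m0 (ltr0Sn R 1)).
exists M => t /hM ht; rewrite (hc t).2.
have [|_] := H d (fl 1 t x) s (Num.min e r) nd st _ ht; first by rewrite ge_min lexx orbT.
by rewrite lt_min => /andP[].
Qed.

(** The two ends of the orbit lie near [a], where a common existence time is available; the
    remaining compact piece is covered by local existence times. *)
Lemma hom_strip x : hom x -> exists2 s0 : R, 0 < s0 & forall s, `|s| <= s0 ->
  (forall t, dm d (fl 1 t x) s) /\ hom (fl d s x).
Proof.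
move=> hx; have [Fx dx tx] := hx.
have [tau tau0 [r r0 H]] := near_eq_flow Fa; have [sg sg0 step] := hom_step.
have [N hN] := tx _ (divr_gt0 r0 (ltr0Sn R 1)).
have [||s0 s00 K] := @uniform_rect (fun s t _ => forall u, `|u| <= s -> dm d (fl 1 t x) u) (- N) N 0 0.
- by move=> s s' t _ ss h u us; apply: h; exact: le_trans ss.
- move=> t s1 _ _; have [r1 r10 [tau1 tau10 H1]] := local_time eF (fl 1 t x).
  have [d1 d10 h1] := fl_cont eF n1 (dx t) r10.
  exists d1 => //; exists tau1 => // t' _ t't _ _ _ u ut.
  by apply: H1 => //; exact: h1.
exists (Num.min s0 (Num.min tau sg)); first by rewrite !lt_min s00 tau0.
move=> s; rewrite !le_min => /and3P[ss0 st ssg].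
have ds t : dm d (fl 1 t x) s.
  have [tN|Nt] := lerP `|t| N.
    by apply: (K t 0); rewrite ?lexx // -ler_norml.
  by have [] := H d (fl 1 t x) s r nd st (lexx _) (hN _ (ltW Nt)).
by split=> //; exact: step.
Qed.

Definition betw (u s : R) := (0 <= u <= s) \/ (s <= u <= 0).

(* For y = z0 this is the interval L of the header. *)
Definition Ld y : set R := [set s | forall u, betw u s -> dm d y u /\ hom (fl d u y)].

Lemma betw_sub (r t w : R) : t <= r -> betw w (t - r) -> t <= r + w <= r.
Proof. by move=> tr [/andP[? ?]|/andP[? ?]]; apply/andP; split; lra. Qed.

Lemma betw_refl s : betw s s.
Proof. by rewrite /betw; case: (lerP 0 s) => [h|/ltW h]; [left|right]; rewrite lexx ?h. Qed.

Lemma Ld_dm y s : Ld y s -> dm d y s /\ hom (fl d s y).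
Proof. by apply; exact: betw_refl. Qed.

Lemma Ld0 y : hom y -> Ld y 0.
Proof.
move=> hy u; rewrite /betw; have -> : ((0 <= u <= 0) \/ (0 <= u <= 0)) <-> u = 0.
  split=> [[]|->]; rewrite -?eq_le; [by move=> /eqP ->|by move=> /eqP ->|by left].
by move=> ->; rewrite fl0 //; split=> //; exact: dm0.
Qed.

Lemma Ld_itv y : is_interval (Ld y).
Proof.
move=> s t hs ht u /andP[su ut] v [/andP[v0 vu]|/andP[uv v0]].
  by apply: ht; left; rewrite v0 (le_trans vu).
by apply: hs; right; rewrite v0 (le_trans su).
Qed.

Lemma Ld_shift y s v : Ld y s -> Ld (fl d s y) v -> Ld y (s + v) /\ fl d v (fl d s y) = fl d (s + v) y.
Proof.
move=> hs hv; have [ds h1] := Ld_dm hs.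
have K (w : R) : betw w v -> dm d y (s + w) /\ hom (fl d (s + w) y).
  move=> /hv[dw hw]; have dsw := fl_shiftr eF nd ds dw; split=> //.
  by have [|_ <-] := @fl_shift R F eF d y s w nd ds.
have [dv hv'] := Ld_dm hv.
split; last by have [_ ->] := @fl_shift R F eF d y s v nd ds (fl_shiftr eF nd ds dv).
move=> u hu.
have [bs|bs] := pselect (betw u s); first exact: hs.
have -> : u = s + (u - s) by rewrite subrKC.
apply: K; move: bs hu; rewrite /betw => bs hu.
have [us|us] := lerP s u; [left|right]; apply/andP; split; first lra.
- case: hu => /andP[h1' h2']; first lra.
  by exfalso; apply: bs; right; rewrite us h2'.
- case: hu => /andP[h1' h2']; last lra.
  by exfalso; apply: bs; left; rewrite h1' ltW.
lra.
Qed.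

Lemma Ld_unshift y s v : Ld y s -> Ld y (s + v) -> Ld (fl d s y) v.
Proof.
move=> hs hsv u hu; have [ds _] := Ld_dm hs.
have hh : Ld y (s + u).
  case: hu => /andP[h1 h2].
    by apply: (@Ld_itv y s (s + v)) => //; rewrite lerDl h1 lerD2l.
  by apply: (@Ld_itv y (s + v) s) => //; rewrite gerDl h2 lerD2l h1.
have [dsu hsu] := Ld_dm hh.
by have [|h ->] := @fl_shift R F eF d y s u nd ds.
Qed.

Lemma Ld_open y : open (Ld y).
Proof.
apply/open_R => s hs; have [ds h] := Ld_dm hs.
have [s0 s00 H] := hom_strip h.
exists s0 => // u us; rewrite -(subrKC s u); apply: (Ld_shift hs _).1 => v hv.
have [|dt hv'] := H v.
  case: hv => /andP[k1 k2]; rewrite ler_norml; move: us; rewrite ltr_norml => /andP[? ?];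
  apply/andP; split; lra.
by split=> //; have := dt 0; rewrite fl0.
Qed.

(** The strip argument with the flows exchanged: here [t] is fixed and the interval of levels is
    traversed. So the attainable levels do not depend on the point chosen on the orbit. *)
Lemma Ld_flow y (t v : R) : hom y -> Ld y v -> Ld (fl 1 t y) v /\ fl d v (fl 1 t y) = fl 1 t (fl d v y).
Proof.
move=> hy.
have K u : Ld y u -> dm d (fl 1 t y) u /\ fl d u (fl 1 t y) = fl 1 t (fl d u y).
  apply: (@comm_strip R F eF d 1 y t (Ld y)) => //.
  - exact: Ld_open.
  - exact: Ld_itv.
  - exact: Ld0.
  - by move=> s /Ld_dm[].
  - by move=> s /Ld_dm[_ [_ h _]].
move=> hv; split; last by have [] := K _ hv.
move=> u hu; have hu' : Ld y u.
  case: hu => hu.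
    by apply: (Ld_itv (Ld0 hy) hv).
  by apply: (Ld_itv hv (Ld0 hy)).
have [h1 ->] := K _ hu'; split=> //; apply: hom_flow => //.
by have [] := Ld_dm hu'.
Qed.

End Sheet.

(** * Openness, compactness and injectivity of the sheet *)

Section SheetGeometry.
Variable R : realType.
Local Notation C := (Cplx R).
Implicit Types (z q w x b c : C) (I : set R).
Variable F : C -> C.
Hypothesis eF : entire F.
Variable a : C.
Hypothesis Fa : F a = 0.
Variable d : C.
Hypothesis hd : d = ci R \/ d = - ci R.
Local Notation fl := (fl F).
Local Notation dm := (dm F).
Local Notation hom := (hom F a).
Local Notation Ld := (Ld F a d).
Let n1 := @nm_11 R.
Let nd := nm_d1 hd.

Definition sheet (z0 : C) (t s : R) : C := fl 1 t (fl d s z0).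

Lemma hom_neq_a x : hom x -> x <> a.
Proof. by move=> [Fx _ _] xa; move: Fx; rewrite xa Fa eqxx. Qed.

Lemma hom_add x (s t : R) : hom x -> fl 1 s (fl 1 t x) = fl 1 (t + s) x.
Proof.
by move=> [_ dx _]; have [|_ ->] := @fl_shift R F eF 1 x t s n1 (dx t); first exact: dx.
Qed.

Variable z0 : C.
Hypothesis hz0 : hom z0.
Local Notation psi := (sheet z0).
Local Notation L := (Ld z0).

Lemma L_hom (t s : R) : L s -> hom (psi t s).
Proof. by move=> /Ld_dm[_ h]; exact: hom_flow. Qed.

Lemma psi_flow (t s v : R) : L s -> fl 1 v (psi t s) = psi (t + v) s.
Proof. by move=> /Ld_dm[_ h]; exact: hom_add. Qed.

Lemma psi_up (t s u : R) : L s -> L (s + u) ->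
  [/\ Ld (psi t s) u, dm d (psi t s) u & fl d u (psi t s) = psi t (s + u)].
Proof.
move=> hs hsu; have [_ hh] := Ld_dm hs.
have hu : Ld (fl d s z0) u := Ld_unshift eF hd hs hsu.
have [h1 h2] := Ld_flow eF Fa hd t hh hu.
split=> //; first by have [] := Ld_dm h1.
by rewrite h2 /sheet (Ld_shift eF hd hs hu).2.
Qed.

(** The extension is first carried back along the orbit to time 0, where levels are counted. *)
Lemma psi_ext (t s u : R) : L s -> Ld (psi t s) u -> L (s + u) /\ fl d u (psi t s) = psi t (s + u).
Proof.
move=> hs hu; have [_ hh] := Ld_dm hs.
have [h1 _] := Ld_flow eF Fa hd (- t) (L_hom t hs) hu.
rewrite (psi_flow _ _ hs) subrr /sheet fl0 // in h1.
have [hsu _] := Ld_shift eF hd hs h1.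
by split=> //; have [] := psi_up t hs hsu.
Qed.

Lemma psi_jcont (t s : R) : L s -> jcont psi t s.
Proof.
move=> hs; have [ds [_ dh _]] := Ld_dm hs.
by apply: (fl_jcont eF hd) => //; case: hz0.
Qed.

Lemma psi_nbhd (t s e : R) : L s -> 0 < e -> exists2 r, 0 < r &
  forall u, nm (u - psi t s) < r -> exists t' s' : R,
    [/\ `|t' - t| < e, `|s' - s| < e, L s' & u = psi t' s'].
Proof.
move=> hs e0; have hq := L_hom t hs; have [Fq _ _] := hq.
have /open_R/(_ _ hs)[d1 d10 h1] := Ld_open eF Fa hd (y := z0).
have m0 : 0 < Num.min e d1 by rewrite lt_min e0.
have [r r0 hr] := nbhd_repr eF hd Fq m0.
exists r => // u /hr[v [w]]; rewrite !lt_min => -[/andP[ve vd] /andP[we wd] dv dw ->].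
have hsv : L (s + v) by apply: h1; rewrite addrC addKr.
have [_ _ ->] := psi_up t hs hsv.
by exists (t + w), (s + v); rewrite psi_flow // ![_ + _ - _]addrC !addKr.
Qed.

Lemma open_sheet (P : R -> Prop) : (forall s, P s -> L s) ->
  (forall s, P s -> exists2 e, 0 < e & forall s', `|s' - s| < e -> P s') ->
  open [set z | exists t s, P s /\ z = psi t s].
Proof.
move=> PL oP; apply/open_nmP => _ [t [s [Ps ->]]].
have [e e0 he] := oP _ Ps; have [r r0 hr] := psi_nbhd t (PL _ Ps) e0.
by exists r => // u /hr[t' [s' [_ /he Ps' _ ->]]]; exists t', s'.
Qed.

(** The ends of one level lie near [a]; neighbouring levels arise from it by a short flow of [d F],
    which leaves points near [a] near [a]. Compactness of [[c1, c2]] makes the time uniform; it is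
    coded as [k^-1] so that a smaller [k] claims less. *)
Lemma psi_tail (c1 c2 e : R) : L c1 -> L c2 -> 0 < e ->
  exists M, forall t s, c1 <= s <= c2 -> M <= `|t| -> nm (psi t s - a) < e.
Proof.
move=> h1 h2 e0.
have [tau tau0 [r r0 H]] := near_eq_flow eF Fa.
have [||s0 s00 K] := @uniform_rect R (fun k s _ => 0 < k -> forall t, k^-1 <= `|t| -> nm (psi t s - a) < e) c1 c2 0 0.
- move=> k k' s _ kk h k'0 t tk; have k0 := lt_le_trans k'0 kk.
  by apply: h => //; apply: le_trans tk; rewrite lef_pV2 ?posrE.
- move=> s u sc _; have hs : L s := Ld_itv h1 h2 sc.
  have [ds hh] := Ld_dm hs; have [_ _ th] := hh.
  have m0 : 0 < Num.min e r by rewrite lt_min e0.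
  have [M hM] := th _ (divr_gt0 m0 (ltr0Sn R 1)).
  exists tau => //; exists (`|M| + 1)^-1; first by rewrite invr_gt0 ltr_wpDl.
  move=> s' _ s's _ s'c _ _ t; rewrite invrK => tM.
  have hs' : L s' := Ld_itv h1 h2 s'c.
  have hss : L (s + (s' - s)) by rewrite subrKC.
  have [_ _ E] := psi_up t hs hss.
  have := H d (psi t s) (s' - s) (Num.min e r) nd (ltW s's).
  rewrite E subrKC ge_min lexx orbT => /(_ isT) [|_].
    by apply: hM; have := ler_norm M; ilra.
  by rewrite lt_min => /andP[].
exists s0^-1 => t s sc tM; apply: (K s 0) => //; by rewrite lexx.
Qed.

Definition slab (c1 c2 : R) : set C := [set z | exists t s, c1 <= s <= c2 /\ z = psi t s].

Lemma slab_closed (c1 c2 : R) : L c1 -> L c2 -> closed (slab c1 c2 `|` [set a]).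
Proof.
move=> h1 h2; apply/closed_nmP => q H.
have [->|qa] := eqVneq q a; first by right.
have n0 : 0 < nm (q - a) by rewrite nm_gt0 subr_eq0.
have e0 := divr_gt0 n0 (ltr0Sn R 1).
have [M hM] := psi_tail h1 h2 e0.
left; have [||t [s [_ sc E]]] := @image_rect_closed R psi (- M) M c1 c2 q.
- by move=> t s _ sc; apply: psi_jcont; exact: Ld_itv h1 h2 _ sc.
- move=> e e00; have m0 : 0 < Num.min e (nm (q - a) / 2) by rewrite lt_min e00.
  have [y [|->]] := H _ m0; last first.
    by rewrite lt_min nmBC => /andP[_ k]; exfalso; lra.
  move=> [t [s [sc ->]]]; rewrite lt_min => /andP[k1 k2]; exists t, s; split=> //.
  have [Mt|tM] := lerP M `|t|; last by rewrite -ler_norml ltW.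
  have := hM _ _ sc Mt; have := nm_tri q (psi t s) a; rewrite (nmBC q (psi t s)).
  by move=> k3 k4; exfalso; lra.
by exists t, s.
Qed.

Lemma slab_bdd (c1 c2 : R) : L c1 -> L c2 -> bdd (slab c1 c2 `|` [set a]).
Proof.
move=> h1 h2; have [M hM] := psi_tail h1 h2 ltr01.
have [|B hB] := @image_rect_bdd R psi (- M) M c1 c2.
  by move=> t s _ sc; apply: psi_jcont; exact: Ld_itv h1 h2 _ sc.
exists (`|B| + (1 + nm a)) => z [[t [s [sc ->]]]|->]; last first.
  by have := normr_ge0 B; ilra.
have [Mt|tM] := lerP M `|t|.
  by have := hM _ _ sc Mt; have := nmD (psi t s - a) a; rewrite subrK; have := normr_ge0 B; ilra.
have := hB t s; rewrite -ler_norml => /(_ (ltW tM) sc); have := ler_norm B; have := nm_ge0 a.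
ilra.
Qed.

Lemma slab_a (c1 c2 : R) : L c1 -> L c2 -> ~ slab c1 c2 a.
Proof.
move=> h1 h2 [t [s [sc E]]]; have hs : L s := Ld_itv h1 h2 sc.
exact: (hom_neq_a (L_hom t hs)).
Qed.

(** Along the multiples of a nonzero [p] the orbit would return to [x] and also tend to [a]. *)
Lemma not_periodic x (p : R) : hom x -> fl 1 p x = x -> p = 0.
Proof.
move=> hx E; apply/eqP; apply: contrapT => /negP p0.
have En (n : nat) : fl 1 (p *+ n) x = x.
  elim: n => [|n IH]; first by rewrite mulr0n fl0.
  by rewrite mulrSr -hom_add // IH E.
apply: (hom_neq_a hx); apply/eqP; rewrite -subr_eq0; apply/eqP; apply: eq0_of_small => e e0.
have [_ _ tx] := hx; have [M hM] := tx _ e0.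
have np : 0 < `|p| by rewrite normr_gt0.
have := hM (p *+ (Num.truncn (`|M| / `|p|)).+1); rewrite En; apply.
rewrite normrMn -mulr_natl -ler_pdivrMr // (le_trans _ (ltW (truncnS_gt _))) //.
by rewrite ler_wpM2r ?invr_ge0 // ler_norm.
Qed.

(** If levels [s < s'] lie on one orbit, then raising the level by [s' - s] amounts to a time shift
    [tau]. The slab between them closes up: a point just beyond one edge reenters at the other. The
    slab is thus open, while with [a] it is compact. *)
Lemma psi_inj_lt (t s t' s' : R) : L s -> L s' -> s < s' -> psi t s = psi t' s' -> False.
Proof.
move=> hs hs' ss E.
have [_ hy] := Ld_dm hs; have [_ hy'] := Ld_dm hs'.
pose y := fl d s z0; pose tau := t - t'.
have Ey : fl d s' z0 = fl 1 tau y.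
  have := congr1 (fl 1 (- t')) E; rewrite !psi_flow // subrr {2}/sheet fl0 // => <-.
have step (u : R) : L u -> L (u + (s' - s)) -> fl d (u + (s' - s)) z0 = fl 1 tau (fl d u z0).
  move=> hu hu'.
  have Lu : Ld y (u - s) by apply: Ld_unshift => //; rewrite subrKC.
  have Lu' : Ld (fl d s' z0) (u - s).
    by apply: Ld_unshift => //; rewrite (_ : s' + (u - s) = u + (s' - s)) //; ring.
  have [_ E1] := Ld_shift eF hd hs' Lu'.
  have [_ E2] := Ld_shift eF hd hs Lu.
  rewrite (_ : u + (s' - s) = s' + (u - s)); last by ring.
  rewrite -E1 Ey (Ld_flow eF Fa hd tau hy Lu).2 E2.
  by rewrite subrKC.
apply: (@no_clopen_bounded R (slab s s') a).
- by exists (psi 0 s), 0, s; rewrite lexx ltW.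
- apply/open_nmP => _ [t1 [u [/andP[su us'] ->]]].
  have hu : L u by apply: (Ld_itv hs hs'); rewrite su.
  have ds : 0 < s' - s by rewrite subr_gt0.
  have [r r0 hr] := psi_nbhd t1 hu ds.
  exists r => // v /hr[t2 [w [_ wu Lw ->]]].
  have [sw|ws] := lerP s w; last first.
    exists (t2 - tau), (w + (s' - s)); split.
      by move: wu; rewrite ltr_norml => /andP[? ?]; apply/andP; split; lra.
    have Lw' : L (w + (s' - s)).
      apply: (Ld_itv hs hs').
      by move: wu; rewrite ltr_norml => /andP[? ?]; apply/andP; split; lra.
    rewrite /sheet (step w) // hom_add; last by have [] := Ld_dm Lw.
    by rewrite addrC subrK.
  have [ws'|s'w] := lerP w s'; first by exists t2, w; rewrite sw.
  exists (t2 + tau), (w - (s' - s)); split.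
    by move: wu; rewrite ltr_norml => /andP[? ?]; apply/andP; split; lra.
  have Lw' : L (w - (s' - s)).
    apply: (Ld_itv hs hs').
    by move: wu; rewrite ltr_norml => /andP[? ?]; apply/andP; split; lra.
  have := step _ Lw'; rewrite subrK => /(_ Lw) E1.
  rewrite /sheet E1 hom_add; first by rewrite [tau + _]addrC.
  by have [] := Ld_dm Lw'.
- exact: slab_a.
- exact: slab_closed.
- exact: slab_bdd.
Qed.

Lemma psi_inj (t s t' s' : R) : L s -> L s' -> psi t s = psi t' s' -> t = t' /\ s = s'.
Proof.
move=> hs hs' E; have [ss|ss|ss] := ltgtP s s'.
- by case: (psi_inj_lt hs hs' ss E).
- by case: (psi_inj_lt hs' hs ss (esym E)).
split=> //; rewrite -ss in E; have [_ hy] := Ld_dm hs.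
have := congr1 (fl 1 (- t')) E; rewrite !psi_flow // subrr {2}/sheet fl0 // => E'.
by apply/eqP; rewrite -subr_eq0; apply/eqP; exact: (not_periodic hy).
Qed.

Definition sheet_set : set C := [set z | exists t s, L s /\ z = psi t s].

(** The orbit of [q] has levels of its own on both sides, and these already meet the sheet at points
    near [q]; going back along them stays in the sheet. *)
Lemma sheet_closed_in_hom q : hom q -> closure sheet_set q -> sheet_set q.
Proof.
move=> hq cq; have [Fq _ _] := hq.
have /open_R/(_ 0 (Ld0 eF hd hq))[e e0 he] := Ld_open eF Fa hd (y := q).
have [r r0 hr] := nbhd_repr eF hd Fq e0.
move/closure_nmP: cq => /(_ _ r0)[_ [t [s [hs ->]]] /hr[v [w [ve we dv dw E]]]].
have Lv : Ld q v by apply: he; rewrite subr0.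
have [_ hv] := Ld_dm Lv.
have E1 : fl d v q = psi (t - w) s.
  by rewrite -psi_flow // E hom_add // subrr fl0.
have [_ Eq] := fl_inv eF nd dv.
have Lv' : Ld (psi (t - w) s) (- v).
  by rewrite -E1; apply: Ld_unshift => //; rewrite subrr; exact: Ld0.
have [h1 h2] := psi_ext hs Lv'.
by exists (t - w), (s - v); split=> //; rewrite -h2 -E1 Eq.
Qed.

End SheetGeometry.

(** * Square roots along curves and on rectangles *)

Section SquareRoots.
Variable R : realType.
Local Notation C := (Cplx R).
Implicit Types (z q w a b p l : C).

(* [B d] are the sets of a filter base; curves, rectangles and infinity use the same lemmas. *)
Definition tends (T : Type) (B : R -> T -> Prop) (f : T -> C) (l : C) :=
  forall e : R, 0 < e -> exists2 d : R, 0 < d & forall x, B d x -> nm (f x - l) < e.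

Definition shrinking (T : Type) (B : R -> T -> Prop) :=
  forall (d d' : R) (x : T), 0 < d -> d <= d' -> B d x -> B d' x.

Section Tends.
Variables (T : Type) (B : R -> T -> Prop).
Hypothesis mB : shrinking B.

Lemma tends_near2 (f g : T -> C) l l' (e1 e2 : R) : tends B f l -> tends B g l' -> 0 < e1 -> 0 < e2 ->
  exists2 d : R, 0 < d & forall x, B d x -> nm (f x - l) < e1 /\ nm (g x - l') < e2.
Proof.
move=> hf hg e10 e20; have [d1 d10 h1] := hf _ e10; have [d2 d20 h2] := hg _ e20.
have m0 : 0 < Num.min d1 d2 by rewrite lt_min d10.
exists (Num.min d1 d2) => // x Bx.
by split; [apply: h1|apply: h2]; apply: mB Bx; rewrite // ge_min lexx ?orbT.
Qed.

Lemma tends_cst l : tends B (fun _ => l) l.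
Proof. by move=> e e0; exists 1 => // x _; rewrite subrr nm0. Qed.

Lemma tendsB (f g : T -> C) l l' : tends B f l -> tends B g l' ->
  tends B (fun x => f x - g x) (l - l').
Proof.
move=> hf hg e e0; have e2 := divr_gt0 e0 (ltr0Sn R 1).
have [d d0 h] := tends_near2 hf hg e2 e2; exists d => // x /h[h1 h2].
have -> : f x - g x - (l - l') = (f x - l) - (g x - l') by ring.
by rewrite (le_lt_trans (nmB _ _)) // (splitr e) ltrD.
Qed.

Lemma tends_comp (h : C -> C) (f : T -> C) l : zcont h l -> tends B f l ->
  tends B (fun x => h (f x)) (h l).
Proof.
move=> hh hf e e0; have [r r0 hr] := hh _ e0; have [d d0 H] := hf _ r0.
by exists d => // x /H/hr.
Qed.

Lemma tendsM (f g : T -> C) l l' : tends B f l -> tends B g l' ->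
  tends B (fun x => f x * g x) (l * l').
Proof.
move=> hf hg e e0.
have n1 : 0 < nm l' + 1 by rewrite ltr_wpDl ?nm_ge0.
have n2 : 0 < nm l + 1 by rewrite ltr_wpDl ?nm_ge0.
have e2 := divr_gt0 e0 (ltr0Sn R 1).
have e1 : 0 < e / 2 / (nm l' + 1) by rewrite divr_gt0.
have e3 : 0 < Num.min 1 (e / 2 / (nm l + 1)) by rewrite lt_min ltr01 divr_gt0.
have [d d0 h] := tends_near2 hf hg e1 e3; exists d => // x /h[h1].
rewrite lt_min => /andP[h2 h3].
have -> : f x * g x - l * l' = (f x - l) * g x + l * (g x - l') by ring.
rewrite (le_lt_trans (nmD _ _)) // !nmM (splitr e) ltr_leD //.
  have gb : nm (g x) < nm l' + 1 by have := nmD (g x - l') l'; rewrite subrK; ilra.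
  rewrite (@le_lt_trans _ _ (nm (f x - l) * (nm l' + 1))) //.
    by rewrite ler_wpM2l ?nm_ge0 // ltW.
  by rewrite -ltr_pdivlMr.
apply: (@le_trans _ _ ((nm l + 1) * (e / 2 / (nm l + 1)))).
  by rewrite ler_pM ?nm_ge0 ?(ltW h3) // lerDl.
by rewrite mulrC divfK // gt_eqF.
Qed.

Lemma tendsV (f : T -> C) l : l != 0 -> tends B f l -> tends B (fun x => (f x)^-1) l^-1.
Proof.
move=> l0; apply: (@tends_comp (fun z => z^-1)).
apply: (hol_cont (l := - 1 / l ^+ 2)).
apply: (@hol_inv _ id) => // e e0; exists 1 => // h _.
rewrite mulr1 (_ : _ - h = 0) ?nm0 ?mulr_ge0 ?nm_ge0 ?(ltW e0) //; ring.
Qed.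

Lemma tends_uniq (f : T -> C) l l' : (forall d, 0 < d -> exists x, B d x) ->
  tends B f l -> tends B f l' -> l = l'.
Proof.
move=> nB h h'; apply/eqP; rewrite -subr_eq0 -nm_eq0; apply/eqP/le_anti; rewrite nm_ge0 andbT.
apply/ler_addgt0Pr => e e0; rewrite add0r.
have e2 := divr_gt0 e0 (ltr0Sn R 1).
have [d d0 H] := tends_near2 h h' e2 e2; have [x /H[h1 h2]] := nB _ d0.
have := nm_tri l (f x) l'; rewrite (nmBC l (f x)); lra.
Qed.

End Tends.

(** The principal root [(u + |u|) / sqrt (2 * (|u| + Re u))]. Its continuity follows from
    [s y - s u = (y - u) / (s y + s u)], where the real part of the denominator is at least that of
    [s u]. *)
Lemma local_sqrt : exists s : C -> C, forall u, nm (u - 1) < 1 ->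
  [/\ s u * s u = u, 0 < complex.Re (s u) & zcont s u].
Proof.
pose X (u : C) : R := 2 * (nm u + complex.Re u).
pose s (u : C) : C := (u + rc (nm u)) * rc (Num.sqrt (X u))^-1.
have Rep (u : C) : nm (u - 1) < 1 -> 0 < complex.Re u.
  move=> h; have := ler_Re (u - 1); rewrite ReD ReN /= ler_norml => /andP[]; lra.
have X0 u : nm (u - 1) < 1 -> 0 < X u.
  by move=> /Rep h; have := nm_ge0 u; rewrite /X; lra.
have sq u : nm (u - 1) < 1 -> s u * s u = u.
  move=> h; have Xu := X0 _ h.
  have -> : s u * s u = (u + rc (nm u)) ^+ 2 * rc ((Num.sqrt (X u) ^+ 2)^-1).
    by rewrite /s expr2 -exprVn expr2 rcM; ring.
  rewrite sqr_sqrtr ?(ltW Xu) //.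
  have -> : (u + rc (nm u)) ^+ 2 = u * rc (X u).
    have E : rc (nm u) * rc (nm u) = u * conjc u by rewrite conj_nm expr2 rcM.
    have E2 : rc (2 * complex.Re u) = u + conjc u.
      by apply: eq_Cplx; rewrite ?ReD ?ImD; case: (u) => x y /=; ring.
    have E3 : rc (2 * nm u) = rc (nm u) + rc (nm u) by rewrite -rcD; congr rc; ring.
    transitivity (u * u + (u * rc (nm u) + u * rc (nm u)) + rc (nm u) * rc (nm u)); first by ring.
    by rewrite E /X mulrDr rcD E2 E3; ring.
  by rewrite -mulrA -rcM divff ?gt_eqF // mulr1.
have Rs u : nm (u - 1) < 1 -> 0 < complex.Re (s u).
  move=> h; rewrite /s ReM /= mulr0 subr0 ReD /= mulr_gt0 ?invr_gt0 ?sqrtr_gt0 ?X0 //.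
  by have := Rep _ h; have := nm_ge0 u; lra.
exists s => u hu; split; [exact: sq|exact: Rs|] => e e0.
exists (Num.min (1 - nm (u - 1)) (e * complex.Re (s u))).
  by rewrite lt_min subr_gt0 hu mulr_gt0 // Rs.
move=> y; rewrite lt_min => /andP[y1 y2].
have hy : nm (y - 1) < 1 by have := nm_tri y u 1; lra.
have E : (s y - s u) * (s y + s u) = y - u by transitivity (s y * s y - s u * s u); [ring|rewrite !sq].
have low : complex.Re (s u) <= nm (s y + s u).
  have := ler_Re (s y + s u); rewrite ReD; have := Rs _ hy; have := Rs _ hu.
  by move=> h1 h2; rewrite gtr0_norm ?addr_gt0 //; lra.
rewrite -(ltr_pM2r (Rs _ hu)); apply: le_lt_trans y2; rewrite -E nmM.
by rewrite ler_wpM2l ?nm_ge0.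
Qed.

(** * Roots along closed curves *)

Definition nearR (t d s : R) := `|s - t| < d.
(** Both ends of the line form one neighbourhood of infinity, so a limit along [atinf] closes a
    curve to a loop. *)
Definition atinf (d t : R) := d^-1 <= `|t|.

Lemma nearR_shrinking (t : R) : shrinking (nearR t).
Proof. by move=> d d' x _ dd h; exact: lt_le_trans h dd. Qed.

Lemma atinf_shrinking : shrinking atinf.
Proof.
move=> d d' x d0 dd h; apply: le_trans h.
by rewrite lef_pV2 ?posrE // (lt_le_trans d0).
Qed.

(** The common limit at the two ends is the essential demand: along the open line alone a root would
    be no obstruction. *)
Definition root_ratio (g : R -> C) a p q := exists2 r : R -> C,
  (forall t, r t * r t = (g t - p) / (g t - q)) &
  (forall t, tends (nearR t) r (r t)) /\ exists l, tends atinf r l.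

Section Curve.
Variables (g : R -> C) (a : C).
Hypothesis cg : forall t, tends (nearR t) g (g t).
Hypothesis ig : tends atinf g a.

(** Since [p] is closer to [q] than the curve is, the ratio stays at distance less than 1 from 1,
    where the principal root is continuous. *)
Lemma root_ratio_close p q (rho : R) : (forall t, rho <= nm (g t - q)) -> nm (p - q) < rho ->
  root_ratio g a p q.
Proof.
move=> gq pq; have [s hs] := local_sqrt.
have rho0 : 0 < rho by have := nm_ge0 (p - q); lra.
have aq : rho <= nm (a - q).
  apply/ler_addgt0Pr => e e0; have [d d0 hd] := ig e0.
  have := hd d^-1; rewrite /atinf ler_norm => /(_ isT).
  by have := gq d^-1; have := nm_tri (g d^-1) a q; ilra.
have near (x : C) : rho <= nm (x - q) -> nm ((x - p) / (x - q) - 1) < 1.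
  move=> xq; have x0 : x - q != 0 by rewrite -nm_gt0 (lt_le_trans rho0).
  have -> : (x - p) / (x - q) - 1 = (q - p) / (x - q) by field.
  by rewrite nmM nmV ltr_pdivrMr ?nm_gt0 // mul1r nmBC (lt_le_trans pq).
have tt (B : R -> R -> Prop) b : shrinking B -> rho <= nm (b - q) -> tends B g b ->
   tends B (fun t => s ((g t - p) / (g t - q))) (s ((b - p) / (b - q))).
  move=> mB bq tb; apply: (tends_comp (h := s)); first by have [] := hs _ (near _ bq).
  have b0 : b - q != 0 by rewrite -nm_gt0 (lt_le_trans rho0).
  apply: tendsM => //; first by apply: tendsB => //; exact: tends_cst.
  by apply: tendsV => //; apply: tendsB => //; exact: tends_cst.
exists (fun t => s ((g t - p) / (g t - q))).
  by move=> t; have [] := hs _ (near _ (gq t)).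
split; first by move=> t; apply: tt => //; exact: nearR_shrinking.
by exists (s ((a - p) / (a - q))); apply: tt => //; exact: atinf_shrinking.
Qed.

Lemma root_ratio_mul p q q' : (forall t, g t != q) ->
  root_ratio g a p q -> root_ratio g a q q' -> root_ratio g a p q'.
Proof.
move=> gq [r rE [rc' [l rl]]] [r' r'E [rc'' [l' rl']]]; exists (fun t => r t * r' t).
  move=> t; have -> : r t * r' t * (r t * r' t) = (r t * r t) * (r' t * r' t) by ring.
  by rewrite rE r'E mulrA divfK // subr_eq0.
split; first by move=> t; apply: tendsM => //; exact: nearR_shrinking.
by exists (l * l'); apply: tendsM => //; exact: atinf_shrinking.
Qed.

(** Roots for neighbouring pairs exist by closeness and multiply along [D], as the ratios telescope.
    The loop is closed, so it keeps a distance from each point of [D]. *)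
Lemma root_ratio_connected (D : set C) p q : closed (range g `|` [set a]) ->
  connected D -> (forall z, D z -> ~ (range g `|` [set a]) z) -> D p -> D q -> root_ratio g a p q.
Proof.
move=> cJ cD DJ Dp Dq.
have gD t z : D z -> g t != z.
  by move=> Dz; apply/eqP => E; apply: (DJ _ Dz); left; exists t.
apply: (connected_ind cD Dp _ _ Dq).
  exists (fun _ => 1).
    by move=> t; rewrite mulr1 divff // subr_eq0 gD.
  by split; [move=> t; exact: tends_cst|exists 1; exact: tends_cst].
move=> z Dz; have oJ := closed_openC cJ.
have /open_nmP/(_ z)[|rho rho0 hrho] := oJ; first exact: DJ.
have far t : rho <= nm (g t - z).
  by rewrite leNgt; apply/negP => /hrho; apply; left; exists t.
exists [set y | nm (y - z) < rho / 4]; first by apply/nbhs_nmP; exists (rho / 4); rewrite ?divr_gt0.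
move=> u v Du Dv /= uz vz pu.
apply: (@root_ratio_mul p u v) => //; first by move=> t; exact: gD.
apply: (@root_ratio_close u v (rho / 2)) => [t|].
  by have := far t; have := nm_tri (g t) v z; lra.
by have := nm_tri u z v; rewrite (nmBC z v); lra.
Qed.

End Curve.

(** * Roots on rectangles and the obstruction to a common root *)

Definition inrect (N e : R) (x : R * R) := `|x.1| <= N /\ `|x.2| <= e.

Definition nearRect (N e : R) (x : R * R) (d : R) (y : R * R) :=
  [/\ inrect N e y, `|y.1 - x.1| < d & `|y.2 - x.2| < d].

Lemma nearRect_shrinking (N e : R) (x : R * R) : shrinking (nearRect N e x).
Proof. by move=> d d' y _ dd [h1 h2 h3]; split=> //; exact: lt_le_trans dd. Qed.

Lemma tends_map (T T' : Type) (B : R -> T -> Prop) (B' : R -> T' -> Prop) (phi : T' -> T)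
    (f : T -> C) l : (forall d y, B' d y -> B d (phi y)) -> tends B f l ->
  tends B' (fun y => f (phi y)) l.
Proof. by move=> h H e /H[d d0 hd]; exists d => // y /h/hd. Qed.

Lemma tends_eq (T : Type) (B : R -> T -> Prop) (f g : T -> C) l : shrinking B ->
  (exists2 d, 0 < d & forall x, B d x -> f x = g x) -> tends B f l -> tends B g l.
Proof.
move=> mB [d d0 fg] H e /H[d' d'0 hd']; have m0 : 0 < Num.min d d' by rewrite lt_min d0.
exists (Num.min d d') => // x Bx; rewrite -fg.
  by apply: hd'; apply: mB Bx => //; rewrite ge_min lexx orbT.
by apply: mB Bx => //; rewrite ge_min lexx.
Qed.

Definition scal (m : R) (x : R * R) := (m * x.1, m * x.2).

Lemma inrect_scal (N e m : R) x : 0 <= m <= 1 -> inrect N e x -> inrect N e (scal m x).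
Proof.
move=> /andP[m0 m1] [h1 h2]; split; rewrite /= normrM (ger0_norm m0).
  by apply: le_trans h1; rewrite ler_piMl.
by apply: le_trans h2; rewrite ler_piMl.
Qed.

(** The rectangle is contracted to its centre: a root of [x |-> k (m x)] is constant for [m = 0] and
    is continued up to [m = 1]. For nearby factors the ratio of the two functions is close to 1,
    uniformly by compactness, and has a principal root. *)
Lemma root_rect (N e : R) (k : R * R -> C) : 0 <= N -> 0 <= e ->
  (forall x, inrect N e x -> tends (nearRect N e x) k (k x)) ->
  (forall x, inrect N e x -> k x != 0) ->
  exists K : R * R -> C, forall x, inrect N e x -> K x * K x = k x /\ tends (nearRect N e x) K (K x).
Proof.
move=> N0 e0 ck kn0; have [s hs] := local_sqrt.
pose P (m : R) := exists K : R * R -> C, forall x, inrect N e x ->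
  K x * K x = k (scal m x) /\ tends (nearRect N e x) K (K x).
have cm (m : R) x : 0 <= m <= 1 -> inrect N e x ->
    tends (nearRect N e x) (fun y => k (scal m y)) (k (scal m x)).
  move=> m01 hx; have /andP[m0 m1] := m01.
  apply: (tends_map _ (ck _ (inrect_scal m01 hx))) => d y [h1 h2 h3].
  split; first exact: inrect_scal.
    by rewrite -mulrBr normrM (ger0_norm m0) (le_lt_trans _ h2) // ler_piMl.
  by rewrite -mulrBr normrM (ger0_norm m0) (le_lt_trans _ h3) // ler_piMl.
have P1 : P 1.
  apply: (@interval_ind R [set m : R | 0 <= m <= 1] P 0).
  - by move=> u v /andP[u1 u2] /andP[v1 v2] w /andP[w1 w2] /=; apply/andP; split; lra.
  - by rewrite /= lexx ler01.
  - exists (fun _ => sqrtC (k (scal 0 (0, 0)))) => x hx; split; last exact: tends_cst.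
    by rewrite -expr2 sqrtCK /scal !mul0r.
  - move=> m /= m01.
    have [||eta eta0 H] := @uniform_rect R (fun eta t u => forall m', 0 <= m' <= 1 -> `|m' - m| < eta ->
        nm (k (scal m' (t, u)) - k (scal m (t, u))) < nm (k (scal m (t, u))) / 4) (- N) N (- e) e.
    + by move=> d d' t u dd h m' hm' mm; apply: h => //; exact: lt_le_trans dd.
    + move=> t u; rewrite -!ler_norml => ht hu.
      have hx : inrect N e (t, u) by [].
      have hmx := inrect_scal m01 hx.
      have n0 : 0 < nm (k (scal m (t, u))) by rewrite nm_gt0 kn0.
      have [d d0 hd] := ck _ hmx _ (divr_gt0 n0 (ltr0Sn R 15)).
      have Ne : 0 < N + e + 1 by rewrite ltr_wpDl // addr_ge0.
      have [NV eV] : N <= N + e + 1 /\ e <= N + e + 1 by split; lra.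
      exists (d / 2); first by rewrite divr_gt0.
      exists (d / 2 / (N + e + 1)); first by rewrite !divr_gt0.
      move=> t' u' tt uu; rewrite -!ler_norml => ht' hu' m' hm'.
      rewrite ltr_pdivlMr // => mm.
      have hx' : inrect N e (t', u') by [].
      have hc (c c0 v v' V : R) : 0 <= c <= 1 -> `|c - c0| * (N + e + 1) < d / 2 -> `|v' - v| < d / 2 ->
          `|v| <= V -> V <= N + e + 1 -> `|c * v' - c0 * v| < d.
        move=> /andP[c0' c1] cc vv vV VN.
        have -> : c * v' - c0 * v = c * (v' - v) + (c - c0) * v by ring.
        rewrite (le_lt_trans (ler_normD _ _)) // !normrM (ger0_norm c0').
        have : `|c - c0| * `|v| <= `|c - c0| * (N + e + 1) by rewrite ler_wpM2l // (le_trans vV).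
        have : c * `|v' - v| <= 1 * `|v' - v| by rewrite ler_wpM2r.
        ilra.
      have near0 : nm (k (scal m (t', u')) - k (scal m (t, u))) < nm (k (scal m (t, u))) / 16.
        have z0 : `|m - m| * (N + e + 1) < d / 2 by rewrite subrr normr0 mul0r divr_gt0.
        by apply: hd; split; [exact: inrect_scal|exact: (hc _ _ _ _ N)|exact: (hc _ _ _ _ e)].
      have near1 : nm (k (scal m' (t', u')) - k (scal m (t, u))) < nm (k (scal m (t, u))) / 16.
        by apply: hd; split; [exact: inrect_scal|exact: (hc _ _ _ _ N)|exact: (hc _ _ _ _ e)].
      have := nm_tri (k (scal m' (t', u'))) (k (scal m (t, u))) (k (scal m (t', u'))).
      have := nm_tri (k (scal m (t, u))) (k (scal m (t', u'))) 0.
      by rewrite !subr0 (nmBC (k (scal m (t, u)))); move: near0 near1 n0; clear; ilra.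
    exists eta => // m1 m2 m101 m201 m1m m2m [K hK].
    have rat x : inrect N e x -> nm (k (scal m2 x) / k (scal m1 x) - 1) < 1.
      case: x => t u hx; have [ht hu] := hx; move: ht hu; rewrite /= !ler_norml => ht hu.
      have h1 := H t u ht hu _ m101 m1m; have h2 := H t u ht hu _ m201 m2m.
      have k1 : k (scal m1 (t, u)) != 0 by apply/kn0/inrect_scal.
      have -> : k (scal m2 (t, u)) / k (scal m1 (t, u)) - 1 =
        (k (scal m2 (t, u)) - k (scal m1 (t, u))) / k (scal m1 (t, u)) by field.
      rewrite nmM nmV ltr_pdivrMr ?nm_gt0 // mul1r.
      have := nm_tri (k (scal m2 (t, u))) (k (scal m (t, u))) (k (scal m1 (t, u))).
      have := nm_tri (k (scal m (t, u))) (k (scal m1 (t, u))) 0.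
      rewrite !subr0 (nmBC (k (scal m (t, u))) (k (scal m1 (t, u)))).
      have : 0 < nm (k (scal m (t, u))) by rewrite nm_gt0; apply/kn0/inrect_scal.
      by move: h1 h2; clear; ilra.
    exists (fun x => K x * s (k (scal m2 x) / k (scal m1 x))) => x hx.
    have [Kx cK] := hK x hx; have k1 : k (scal m1 x) != 0 by apply/kn0/inrect_scal.
    have [sE _ sc] := hs _ (rat x hx); split.
      rewrite (_ : _ * _ = (K x * K x) * (s (k (scal m2 x) / k (scal m1 x)) * s (k (scal m2 x) / k (scal m1 x)))).
        by rewrite Kx sE mulrC divfK.
      by ring.
    apply: tendsM => //; first exact: nearRect_shrinking.
    apply: (tends_comp (h := s)) => //.
    apply: tendsM; [exact: nearRect_shrinking|exact: cm|].
    by apply: tendsV => //; exact: cm.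
  - by rewrite /= lexx ler01.
have [K hK] := P1; exists K => x hx; have [E cK] := hK x hx; split=> //.
by rewrite E /scal !mul1r; case: (x).
Qed.

Definition nearI (b t : R) (d s : R) := `|s| <= b /\ `|s - t| < d.

Lemma nearI_shrinking (b t : R) : shrinking (nearI b t).
Proof. by move=> d d' x _ dd [h1 h2]; split=> //; exact: lt_le_trans dd. Qed.

(** The quotient of [f] and [g] is a continuous root of [-1], and a jump to the other root would
    contradict the continuity of [f] and [g]. *)
Lemma const_ratio (f g : R -> C) (b : R) : 0 <= b ->
  (forall t, `|t| <= b -> [/\ f t * f t = - (g t * g t), g t != 0,
     tends (nearI b t) f (f t) & tends (nearI b t) g (g t)]) ->
  exists2 j, j * j = -1 & forall t, `|t| <= b -> f t = j * g t.
Proof.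
move=> b0 H; have bb : `|b| <= b by rewrite ger0_norm.
have [E0 g0 _ _] := H _ bb.
exists (f b / g b).
  have -> : f b / g b * (f b / g b) = (f b * f b) / (g b * g b) by field.
  by rewrite E0 mulNr divff // mulf_neq0.
set j := f b / g b.
have jj : j * j = -1.
  have -> : j * j = (f b * f b) / (g b * g b) by rewrite /j; field.
  by rewrite E0 mulNr divff // mulf_neq0.
have nj : nm j = 1.
  have := congr1 (@nm R) jj; rewrite nmM nmN nm1 => h.
  by apply/eqP; rewrite -(@eqrXn2 _ 2) ?nm_ge0 // expr1n expr2 h.
apply: (@interval_ind R [set t | `|t| <= b] (fun t => f t = j * g t) b) => //.
- move=> u v /=; rewrite !ler_norml => /andP[u1 u2] /andP[v1 v2] w /andP[w1 w2].
  by rewrite /= ler_norml; apply/andP; split; lra.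
- by rewrite /j divfK.
move=> t /= tb; have [Et gt ct cgt] := H _ tb.
have n2 : 0 < nm (g t) / 2 by rewrite divr_gt0 // nm_gt0.
have [d d0 hd] := tends_near2 (@nearI_shrinking b t) ct cgt n2 n2.
exists d => // u v ub vb ut vt Eu.
have [fu gu] := hd u (conj ub ut); have [fv gv] := hd v (conj vb vt).
have [Ev _ _ _] := H _ vb.
have : (f v - j * g v) * (f v + j * g v) = 0.
  rewrite (_ : _ * _ = f v * f v - (j * j) * (g v * g v)); last by ring.
  by rewrite Ev jj; ring.
move/eqP; rewrite mulf_eq0 subr_eq0 addr_eq0 => /orP[/eqP //|/eqP Ev'].
exfalso.
have E : f v - f u = - (j * (g v + g u)) by rewrite Ev' Eu; ring.
have h1 : nm (f v - f u) = nm (g v + g u) by rewrite E nmN nmM nj mul1r.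
have h2 : nm (f v - f u) < nm (g t).
  have := nm_tri (f v) (f t) (f u); rewrite (nmBC (f t)); lra.
have h3 : nm (g t + g t) <= nm (g v + g u) + nm (g v - g t) + nm (g u - g t).
  have -> : g t + g t = (g v + g u) - (g v - g t) - (g u - g t) by ring.
  by rewrite (le_trans (nmB _ _)) // lerD2r nmB.
have h4 : nm (g t + g t) = nm (g t) + nm (g t).
  rewrite -mulr2n -mulr_natl nmM (_ : 2%:R = rc 2) ?nm_rc ?ger0_norm //; first by ring.
  by rewrite -[2 in LHS]/(1 + 1) rcD.
lra.
Qed.

Lemma root_unique (x y : C) : x * x = y * y -> 0 < complex.Re x -> 0 < complex.Re y -> x = y.
Proof.
move=> E x0 y0; apply/eqP; rewrite -subr_eq0.
have : (x - y) * (x + y) == 0.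
  by apply/eqP; transitivity (x * x - y * y); [ring|rewrite E subrr].
rewrite mulf_eq0 => /orP[//|/eqP h].
by have := congr1 (@complex.Re R) h; rewrite ReD /=; lra.
Qed.

Definition atinfS (e : R) (d : R) (x : R * R) := d^-1 <= `|x.1| /\ `|x.2| <= e.

Lemma atinfS_shrinking (e : R) : shrinking (atinfS e).
Proof.
move=> d d' x d0 dd [h1 h2]; split=> //; apply: le_trans h1.
by rewrite lef_pV2 ?posrE // (lt_le_trans d0).
Qed.

(* G fills the strip between the curves u = - ep and u = ep, with p = G 0 0 inside and q
   outside.  On a large rectangle (G - p) / (G - q) is (t + d u) times a square K ^ 2, so
   roots on the two curves, joined near infinity, would give a continuous root of t + d u
   on the boundary of the rectangle.  Comparing x with - x, such a root would change by
   one and the same factor j with j ^ 2 = - 1 along both halves of the boundary, whereas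
   going round once gives j ^ 2 = 1. *)
Lemma no_common_root (G : R -> R -> C) (ep : R) (a p q l d : C) (chi : C -> C) (del : R) :
  0 < ep -> nm d = 1 -> (forall t u : R, rc t + d * rc u = 0 -> t = 0 /\ u = 0) ->
  (forall t u, `|u| <= ep -> jcont G t u) ->
  tends (atinfS ep) (fun x => G x.1 x.2) a ->
  G 0 0 = p -> (forall t u, `|u| <= ep -> G t u = p -> t = 0 /\ u = 0) ->
  (forall t u, `|u| <= ep -> G t u != q) -> a != q -> a != p ->
  0 < del -> (forall t u, `|t| < del -> `|u| < del -> G t u = chi (rc t + d * rc u)) ->
  hol chi 0 l -> l != 0 ->
  root_ratio (G ^~ (- ep)) a p q -> root_ratio (G ^~ ep) a p q -> False.
Proof.
move=> ep0 nd1 hd cG iG G0 Gp Gq aq ap del0 Gchi hchi l0 [r0 r0E [cr0 [l0' lr0]]] [r2 r2E [cr2 [l2' lr2]]].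
have [s hs] := local_sqrt.
pose kap := (a - p) / (a - q).
pose g (x : R * R) := (G x.1 x.2 - p) / (G x.1 x.2 - q).
pose E (x : R * R) : C := rc x.1 + d * rc x.2.
have kap0 : kap != 0 by rewrite mulf_neq0 ?invr_eq0 ?subr_eq0.
have hq x : `|x.2| <= ep -> G x.1 x.2 - q != 0 by move=> h; rewrite subr_eq0 Gq.
have ig : tends (atinfS ep) g kap.
  apply: tendsM; [exact: atinfS_shrinking| |apply: tendsV; first by rewrite subr_eq0];
  by apply: tendsB => //; [exact: atinfS_shrinking|exact: tends_cst].
have epn : `|ep| <= ep by rewrite gtr0_norm.
have epn' : `|- ep| <= ep by rewrite normrN.
have atinf_ne : forall d : R, 0 < d -> exists x, atinf d x.
  by move=> k k0; exists k^-1; rewrite /atinf ler_norm.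
have lim (r : R -> C) l1 u : `|u| <= ep -> (forall t, r t * r t = (G t u - p) / (G t u - q)) ->
    tends (atinf) r l1 -> l1 * l1 = kap.
  move=> hu rE lr; apply: (tends_uniq atinf_shrinking atinf_ne (tendsM atinf_shrinking lr lr)).
  have -> : (fun x => r x * r x) = (fun x => g (x, u)) by apply/funext => x; rewrite rE.
  by apply: (tends_map _ ig) => k y h; split.
have L0 : l0' * l0' = kap := lim _ _ _ epn' r0E lr0.
have L2 : l2' * l2' = kap := lim _ _ _ epn r2E lr2.
have l0n : l0' != 0 by apply/eqP => h; move: kap0; rewrite -L0 h mul0r eqxx.
(* The limits of the two roots have the same square [kap]; a sign makes the limits equal. *)
have [sg [sg1 sgl]] : exists sg, sg * sg = 1 /\ sg * l2' = l0'.
  have : (l0' - l2') * (l0' + l2') == 0.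
    by apply/eqP; transitivity (l0' * l0' - l2' * l2'); [ring|rewrite L0 L2 subrr].
  rewrite mulf_eq0 subr_eq0 addr_eq0 => /orP[/eqP ->|/eqP ->]; first by exists 1; rewrite !mul1r.
  by exists (-1); rewrite mulrNN mulN1r mulr1.
pose R2 t := sg * r2 t.
have R2E t : R2 t * R2 t = (G t ep - p) / (G t ep - q).
  by rewrite /R2 -r2E; transitivity ((sg * sg) * (r2 t * r2 t)); [ring|rewrite sg1 mul1r].
have lR2 : tends (atinf) R2 l0'.
  by rewrite -sgl; apply: tendsM => //; [exact: atinf_shrinking|exact: tends_cst].
have cR2 t : tends (nearR t) R2 (R2 t).
  by apply: tendsM => //; [exact: nearR_shrinking|exact: tends_cst].
(* A root of [g] near infinity, for the two vertical sides. It has the same limit [l0'] and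
   therefore joins the roots on the two curves at the corners. *)
pose RB (x : R * R) := l0' * s (g x / kap).
have [N [N0 NB]] : exists N : R, 0 < N /\ forall t, N <= `|t| ->
    [/\ forall u, `|u| <= ep -> nm (g (t, u) / kap - 1) < 1,
        nm (r0 t / l0' - 1) < 1 & nm (R2 t / l0' - 1) < 1].
  have lg : tends (atinfS ep) (fun x => g x / kap) (kap / kap).
    by apply: tendsM => //; [exact: atinfS_shrinking|exact: tends_cst].
  have lr0' : tends (atinf) (fun t => r0 t / l0') (l0' / l0').
    by apply: tendsM => //; [exact: atinf_shrinking|exact: tends_cst].
  have lR2' : tends (atinf) (fun t => R2 t / l0') (l0' / l0').
    by apply: tendsM => //; [exact: atinf_shrinking|exact: tends_cst].
  rewrite !divff // in lg lr0' lR2'.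
  have [d1 d10 h1] := lg _ ltr01.
  have [d2 d20 h2] := tends_near2 atinf_shrinking lr0' lR2' ltr01 ltr01.
  exists (Num.max d1^-1 d2^-1); split; first by rewrite lt_max invr_gt0 d10.
  move=> t; rewrite ge_max => /andP[t1 t2]; have [h3 h4] := h2 t t2.
  by split=> // u hu; apply: h1.
have RBE x : N <= `|x.1| -> `|x.2| <= ep -> RB x * RB x = g x.
  case: x => t u /= ht hu; have [h _ _] := NB _ ht; have [h1 _ _] := hs _ (h _ hu).
  rewrite /RB (_ : _ * _ = (l0' * l0') * (s (g (t, u) / kap) * s (g (t, u) / kap))); last by ring.
  by rewrite h1 L0 mulrC divfK.
have corner (r : R -> C) t u : N <= `|t| -> `|u| <= ep -> r t * r t = g (t, u) ->
    nm (r t / l0' - 1) < 1 -> r t = RB (t, u).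
  move=> ht hu rE rn; have [h _ _] := NB _ ht; have [h1 h2 _] := hs _ (h _ hu).
  rewrite /RB -(root_unique (x := r t / l0') (y := s (g (t, u) / kap))) //.
  - by rewrite mulrC divfK.
  - rewrite h1 -rE -L0; field; exact: l0n.
  have := ler_Re (r t / l0' - 1); rewrite ReD ReN /= ler_norml => /andP[]; lra.
have E0 x : E x = 0 -> x = (0, 0) by case: x => t u /hd[/= -> ->].
(* The quotient of [g] by [E], with the gap at the centre filled by the derivative of [chi]. It
   vanishes nowhere and so has a root on the whole rectangle. *)
pose k (x : R * R) : C := if x == (0, 0) then l / (p - q) else
  (G x.1 x.2 - p) / ((G x.1 x.2 - q) * E x).
have pq : p - q != 0.
  by rewrite -G0; apply: (hq (0, 0)); rewrite normr0 ltW.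
have gE x : `|x.2| <= ep -> g x = E x * k x.
  move=> hx; rewrite /k; case: eqP => [->|/eqP x0].
    by rewrite /g /E /= G0 subrr mul0r rc0 mulr0 addr0 mul0r.
  have h1 := hq x hx; have h2 : E x != 0 by apply/eqP => /E0/eqP; rewrite (negbTE x0).
  by rewrite /g; field; rewrite h1 h2.
have kn0 x : inrect N ep x -> k x != 0.
  move=> [_ hx]; rewrite /k; case: (x =P (0, 0)) => [_|/eqP x0]; first by rewrite mulf_neq0 ?invr_eq0.
  have h2 : E x != 0 by apply/eqP => /E0/eqP; rewrite (negbTE x0).
  rewrite mulf_neq0 ?invr_eq0 ?mulf_neq0 ?hq // subr_eq0.
  by apply/eqP => /(Gp _ _ hx)[h3 h4]; move/eqP: h2; apply; rewrite /E h3 h4 rc0 mulr0 addr0.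
have cGx x : inrect N ep x -> tends (nearRect N ep x) (fun y => G y.1 y.2) (G x.1 x.2).
  move=> [_ hx] e e0; have [dd dd0 hdd] := cG x.1 x.2 hx _ e0.
  by exists dd => // y [_ h1 h2]; exact: hdd.
have cE x : tends (nearRect N ep x) E (E x).
  move=> e e0; exists (e / 2); first by rewrite divr_gt0.
  move=> y [_ h1 h2]; have -> : E y - E x = rc (y.1 - x.1) + d * rc (y.2 - x.2).
    by rewrite /E !rcB; ring.
  by rewrite (le_lt_trans (nmD _ _)) // nmM nd1 !nm_rc mul1r; lra.
have ck x : inrect N ep x -> tends (nearRect N ep x) k (k x).
  move=> hx; have mB := @nearRect_shrinking N ep x; have [hx1 hx2] := hx.
  have [x0|x0] := eqVneq x (0, 0); last first.
    have h2 : E x != 0 by apply/eqP => /E0/eqP; rewrite (negbTE x0).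
    rewrite [k x]/k (negbTE x0).
    apply: (@tends_eq _ _ (fun y => (G y.1 y.2 - p) / ((G y.1 y.2 - q) * E y))) => //.
      have n0 : 0 < nm (E x) by rewrite nm_gt0.
      have [dd dd0 hdd] := cE x _ n0; exists dd => // y By; rewrite /k.
      case: eqP => // y0; exfalso; have := hdd _ By.
      by rewrite y0 {1}/E /= rc0 mulr0 addr0 sub0r nmN ltxx.
    apply: tendsM => //; first by apply: tendsB => //; [exact: cGx|exact: tends_cst].
    apply: tendsV; first by rewrite mulf_neq0 ?hq.
    by apply: tendsM => //; apply: tendsB => //; [exact: cGx|exact: tends_cst].
  have -> : k x = l / (p - q) by rewrite /k x0 eqxx.
  have chi0 : chi 0 = p.
    rewrite -G0 (Gchi 0 0) ?normr0 //; by rewrite rc0 mulr0 addr0.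
  have slope : tends (nearRect N ep x) (fun y => if y == (0, 0) then l else (G y.1 y.2 - p) / E y) l.
    move=> e e0; have e2 := divr_gt0 e0 (ltr0Sn R 1).
    have [dd dd0 hdd] := hchi _ e2.
    exists (Num.min del (dd / 2)); first by rewrite lt_min del0 divr_gt0.
    move=> y [_]; rewrite x0 !subr0 !lt_min => /andP[y1 y2] /andP[y3 y4].
    case: eqP => [_|/eqP y0]; first by rewrite subrr nm0.
    have h2 : E y != 0 by apply/eqP => /E0/eqP; rewrite (negbTE y0).
    have nE : 0 < nm (E y) by rewrite nm_gt0.
    have Ed : nm (E y) < dd.
      by rewrite (le_lt_trans (nmD _ _)) // nmM nd1 !nm_rc mul1r; lra.
    have := hdd _ Ed; rewrite add0r chi0 -Gchi // => H.
    have -> : (G y.1 y.2 - p) / E y - l = (G y.1 y.2 - p - E y * l) / E y by field.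
    by rewrite nmM nmV ltr_pdivrMr // (le_lt_trans H) // ltr_pM2r // ltr_pdivrMr // ltr_pMr // ltr1n.
  apply: (@tends_eq _ _ (fun y => (if y == (0, 0) then l else (G y.1 y.2 - p) / E y) / (G y.1 y.2 - q))) => //.
    exists 1 => // y [[_ hy] _ _]; rewrite /k; case: eqP => [->|/eqP y0] /=; first by rewrite G0.
    have h2 : E y != 0 by apply/eqP => /E0/eqP; rewrite (negbTE y0).
    by field; rewrite h2 hq.
  apply: tendsM => //; apply: tendsV => //; apply: tendsB => //; last exact: tends_cst.
  by have := cGx x hx; rewrite x0 /= G0.
have [K hK] := root_rect (ltW N0) (ltW ep0) ck kn0.
have Nn : `|N| <= N by rewrite gtr0_norm.
have Nn' : `|- N| <= N by rewrite normrN.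
have NN : N <= `|N| by rewrite gtr0_norm.
have NN' : N <= `|- N| by rewrite normrN.
have EN x : E (- x.1, - x.2) = - E x by rewrite /E /= !rcN; ring.
have tK1 u t : `|u| <= ep -> `|t| <= N -> tends (nearI N t) (fun y => K (y, u)) (K (t, u)).
  move=> hu ht; have [_ hc] := hK (t, u) (conj ht hu).
  apply: (tends_map _ hc) => dd y [h1 h2]; split=> //=.
  by rewrite subrr normr0 (le_lt_trans _ h2).
have tK2 u t : `|u| <= ep -> `|t| <= N -> tends (nearI ep u) (fun y => K (t, y)) (K (t, u)).
  move=> hu ht; have [_ hc] := hK (t, u) (conj ht hu).
  apply: (tends_map _ hc) => dd y [h1 h2]; split=> //=.
  by rewrite subrr normr0 (le_lt_trans _ h2).
have tneg (B : R) (f : R -> C) t : tends (nearI B (- t)) f (f (- t)) ->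
    tends (nearI B t) (fun y => f (- y)) (f (- t)).
  move=> hf; apply: (tends_map _ hf) => dd y [h1 h2]; split; first by rewrite normrN.
  by rewrite -opprD normrN.
have Kn0 x : inrect N ep x -> K x != 0.
  by move=> hx; have [h _] := hK x hx; apply/eqP => h0; move: (kn0 x hx); rewrite -h h0 mul0r eqxx.
have gn0 x : inrect N ep x -> x != (0, 0) -> g x != 0.
  move=> hx x0; have [_ h] := hx; rewrite gE // mulf_neq0 ?kn0 //.
  by apply/eqP => /E0/eqP; rewrite (negbTE x0).
have opx : forall x : R, 0 < x -> (- x == 0) = false /\ (x == 0) = false.
  by move=> x x0; rewrite oppr_eq0 gt_eqF.
have [epN epP] := opx _ ep0; have [NN0 NP] := opx _ N0.
have sqn0 (x y : C) : x * x = y -> y != 0 -> x != 0.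
  by move=> <-; apply: contra => /eqP ->; rewrite mul0r.
have [j jj Hj] : exists2 j, j * j = -1 & forall t : R, `|t| <= N ->
    R2 (- t) * K (t, - ep) = j * (r0 t * K (- t, ep)).
  apply: (@const_ratio (fun t => R2 (- t) * K (t, - ep)) (fun t => r0 t * K (- t, ep)) N (ltW N0)) => t ht.
  have ht' : `|- t| <= N by rewrite normrN.
  have [K1 _] := hK (t, - ep) (conj ht epn'); have [K2 _] := hK (- t, ep) (conj ht' epn).
  have mB := @nearI_shrinking N t; split.
  - have e1 : R2 (- t) * R2 (- t) = E (- t, ep) * k (- t, ep) by rewrite R2E -gE.
    have e2 : r0 t * r0 t = E (t, - ep) * k (t, - ep) by rewrite r0E -gE.
    have e3 : E (- t, ep) = - E (t, - ep) by rewrite -EN /= opprK.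
    rewrite mulrACA K1 e1 e3 mulrACA K2 e2; ring.
  - rewrite mulf_neq0 ?Kn0 //; apply: (sqn0 _ _ (r0E t)); apply: (gn0 (t, - ep)) => //.
    by apply/eqP => -[_ /eqP]; rewrite epN.
  - apply: tendsM => //; last exact: tK1.
    by apply: tneg; apply: (tends_map _ (cR2 (- t))) => dd y [_ h].
  - apply: tendsM => //; first by apply: (tends_map _ (cr0 t)) => dd y [_ h].
    by apply: (tneg N (fun y => K (y, ep))); exact: tK1.
have cRB t u : N <= `|t| -> `|t| <= N -> `|u| <= ep -> tends (nearI ep u) (fun y => RB (t, y)) (RB (t, u)).
  move=> ht ht' hu; have [h _ _] := NB _ ht; have [_ _ h1] := hs _ (h _ hu).
  have mB := @nearI_shrinking ep u.
  apply: tendsM => //; first exact: tends_cst.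
  apply: (tends_comp (h := s)) => //; apply: tendsM => //; last exact: tends_cst.
  have cg : tends (nearI ep u) (fun y => G t y) (G t u).
    apply: (@tends_map _ _ (nearRect N ep (t, u)) (nearI ep u) (fun y => (t, y)) (fun x => G x.1 x.2) (G t u) _ (cGx (t, u) (conj ht' hu))) => dd y [h3 h2]; split=> //=.
    by rewrite subrr normr0 (le_lt_trans _ h2).
  apply: tendsM => //; last apply: tendsV; rewrite ?(hq (t, u)) //;
  by apply: tendsB => //; exact: tends_cst.
have [i ii Hi] : exists2 i, i * i = -1 & forall u : R, `|u| <= ep ->
    RB (- N, - u) * K (N, u) = i * (RB (N, u) * K (- N, - u)).
  apply: (@const_ratio (fun u => RB (- N, - u) * K (N, u)) (fun u => RB (N, u) * K (- N, - u)) ep (ltW ep0)) => u hu.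
  have hu' : `|- u| <= ep by rewrite normrN.
  have [K1 _] := hK (N, u) (conj Nn hu); have [K2 _] := hK (- N, - u) (conj Nn' hu').
  have mB := @nearI_shrinking ep u; split.
  - have e1 : RB (- N, - u) * RB (- N, - u) = E (- N, - u) * k (- N, - u) by rewrite RBE // gE.
    have e2 : RB (N, u) * RB (N, u) = E (N, u) * k (N, u) by rewrite RBE // gE.
    have e3 : E (- N, - u) = - E (N, u) by rewrite -EN.
    rewrite mulrACA K1 e1 e3 mulrACA K2 e2; ring.
  - rewrite mulf_neq0 ?Kn0 //; apply: (sqn0 _ (g (N, u))); first by rewrite RBE.
    apply: gn0 => //; by apply/eqP => -[/eqP]; rewrite NP.
  - apply: tendsM => //; last exact: tK2.
    by apply: (tneg ep (fun y => RB (- N, y))); exact: cRB.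
  - apply: tendsM => //; first exact: cRB.
    by apply: (tneg ep (fun y => K (- N, y))); exact: tK2.
have [_ hr0N hR2N] := NB _ NN; have [_ hr0N' hR2N'] := NB _ NN'.
have A1 : R2 (- N) = RB (- N, ep) by apply: corner => //; rewrite R2E.
have A2 : r0 N = RB (N, - ep) by apply: corner => //; rewrite r0E.
have A3 : R2 N = RB (N, ep) by apply: corner => //; rewrite R2E.
have A4 : r0 (- N) = RB (- N, - ep) by apply: corner => //; rewrite r0E.
have H1 := Hj _ Nn; have H2 := Hj _ Nn'; have H3 := Hi _ epn'; have H4 := Hi _ epn.
rewrite !opprK -?A1 -?A2 -?A3 -?A4 in H1 H2 H3 H4.
(* The corners [(- N, ep)] and [(N, - ep)] identify the two factors. The other two corners then make
   [R2 N * K (- N, - ep)] equal to its own negative. *)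
have ij : i = j.
  have n0 : r0 N * K (- N, ep) != 0.
    rewrite mulf_neq0 ?Kn0 //; apply: (sqn0 _ _ (r0E N)); apply: (gn0 (N, - ep)) => //.
    by apply/eqP => -[_ /eqP]; rewrite epN.
  by apply: (mulIf n0); rewrite -H3 -H1.
have n0 : R2 N * K (- N, - ep) != 0.
  rewrite mulf_neq0 ?Kn0 //; apply: (sqn0 _ _ (R2E N)); apply: (gn0 (N, ep)) => //.
  by apply/eqP => -[_ /eqP]; rewrite epP.
have : R2 N * K (- N, - ep) = - (R2 N * K (- N, - ep)).
  by rewrite {1}H2 H4 ij mulrA jj mulN1r.
move/eqP; rewrite -subr_eq0 opprK -mulr2n mulrn_eq0 /= => /eqP h.
by move: n0; rewrite h eqxx.
Qed.

End SquareRoots.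

(** * Components of complements *)

Section PlaneTopology.
Variable R : realType.
Local Notation C := (Cplx R).
Implicit Types (z q w a b p : C) (A J D : set C).

Lemma ccont_continuous (f : R -> C) (t : R) : ccont f t -> {for t, continuous f}.
Proof.
move=> h A /nbhs_nmP[e e0 eA]; have [d d0 hd] := h _ e0.
apply/nbhs_ballP; exists d => // s; rewrite /ball /= distrC => /hd; exact: eA.
Qed.

Lemma connected_curve (f : R -> C) (I : set R) : is_interval I ->
  (forall t, I t -> ccont f t) -> connected (f @` I).
Proof.
move=> /connected_intervalP cI cf; apply: connected_continuous_connected => //.
by apply: continuous_in_subspaceT => t; rewrite inE => /cf/ccont_continuous.
Qed.

Definition cvx A := forall x y (m : R), A x -> A y -> 0 <= m <= 1 -> A (x + rc m * (y - x)).

Lemma connected_convex A : cvx A ->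
  connected A.
Proof.
move=> cA; have [[x0 Ax0]|nA] := pselect (A !=set0); last first.
  have A0 : A = set0 by rewrite -subset0 => x Ax; apply: nA; exists x.
  by rewrite A0; exact: connected0.
pose seg (y : C) : set C := (fun m : R => x0 + rc m * (y - x0)) @` [set m : R | 0 <= m <= 1].
have -> : A = \bigcup_(y in A) seg y.
  apply/seteqP; split=> [y Ay|_ [y Ay [m m01 <-]]]; last exact: cA.
  by exists y => //; exists 1; rewrite /= ?ler01 ?lexx // rc1 mul1r subrKC.
apply: bigcup_connected.
  by exists x0 => y Ay; exists 0; rewrite /= ?lexx ?ler01 // rc0 mul0r addr0.
move=> y Ay; apply: connected_curve.
  by move=> u v /andP[u1 u2] /andP[v1 v2] w /andP[w1 w2] /=; apply/andP; split; lra.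
move=> t _; apply: (@cder_cont _ _ _ (y - x0)).
by have := cder_lin (y - x0) x0 t; congr (cder _ _ _); apply/funext => s; rewrite addrC.
Qed.

Lemma mix_lt (K u v m : R) : 0 <= m <= 1 -> K < u -> K < v -> K < u + m * (v - u).
Proof.
move=> /andP[m0 m1] ku kv; have -> : u + m * (v - u) = (1 - m) * u + m * v by ring.
have [->|mn0] := eqVneq m 0; first by rewrite mul0r addr0 subr0 mul1r.
have {}m0 : 0 < m by rewrite lt_neqAle eq_sym mn0.
have : m * K < m * v by rewrite ltr_pM2l.
have : (1 - m) * K <= (1 - m) * u by rewrite ler_wpM2l ?subr_ge0 // ltW.
ilra.
Qed.

Lemma cvx_ball q (r : R) : cvx [set z | nm (z - q) < r].
Proof.
move=> x y m /= xr yr m01; have /andP[m0 m1] := m01.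
have -> : x + rc m * (y - x) - q = rc (1 - m) * (x - q) + rc m * (y - q) by rewrite rcB rc1; ring.
rewrite (le_lt_trans (nmD _ _)) // !nmM !nm_rc !ger0_norm ?subr_ge0 //.
have := @mix_lt (- r) (- nm (x - q)) (- nm (y - q)) m m01; rewrite !ltrN2 => /(_ xr yr); lra.
Qed.

Lemma ball_connected q (r : R) : connected [set z | nm (z - q) < r].
Proof. exact/connected_convex/cvx_ball. Qed.

(** The set is the union of four convex pieces, one for each side of the square, and consecutive
    pieces meet at the corners [q + (+-M, +-M)]. It serves for the outside of a large square and,
    with [K = 0], for a punctured disc. *)
Lemma square_complement_connected A q (K M : R) : cvx A -> 0 <= K < M ->
  (forall s t : R, `|s| = M -> `|t| = M -> A (q + Complex s t)) ->
  connected [set z | A z /\ (K < `|complex.Re (z - q)| \/ K < `|complex.Im (z - q)|)].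
Proof.
move=> cA /andP[K0 KM] hM.
have M0 : 0 <= M by lra.
pose H (f : C -> R) := [set z | A z /\ K < f (z - q)].
have cH (f : C -> R) : (forall x y m, f (x + rc m * y) = f x + m * f y) -> connected (H f).
  move=> hf; apply: connected_convex => x y m [Ax fx] [Ay fy] m01; split; first exact: cA.
  have -> : x + rc m * (y - x) - q = (x - q) + rc m * (y - q + rc (- 1) * (x - q)).
    by rewrite rcN rc1; ring.
  by rewrite !hf mulN1r; exact: mix_lt.
have lRe x y m : complex.Re (x + rc m * y) = complex.Re x + m * complex.Re y.
  by rewrite !(ReD, ReM) /=; ring.
have lIm x y m : complex.Im (x + rc m * y) = complex.Im x + m * complex.Im y.
  by rewrite !(ImD, ImM) /=; ring.
have -> : [set z | A z /\ (K < `|complex.Re (z - q)| \/ K < `|complex.Im (z - q)|)] =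
   H (fun z => complex.Re z) `|` H (fun z => complex.Im z) `|`
   H (fun z => - complex.Re z) `|` H (fun z => - complex.Im z).
  apply/seteqP; split=> z.
    rewrite /H /= !ltr_normr => -[Az [/orP[h|h]|/orP[h|h]]].
    + by left; left; left.
    + by left; right.
    + by left; left; right.
    + by right.
  rewrite /H /= !ltr_normr => -[[[|]|]|] [Az h]; split=> //.
  + by left; rewrite h.
  + by right; rewrite h.
  + by left; rewrite h orbT.
  + by right; rewrite h orbT.
have Mn : `|M| = M by rewrite ger0_norm.
have Mn' : `|- M| = M by rewrite normrN.
apply: connectedU => //.
  exists (q + Complex (- M) (- M)); split; last first.
    by split; [exact: hM|rewrite addrC addKr /= opprK].
  by right; split; [exact: hM|rewrite addrC addKr /= opprK].
- apply: connectedU => //.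
    exists (q + Complex (- M) M); split; last first.
      by split; [exact: hM|rewrite addrC addKr /= opprK].
    by right; split; [exact: hM|rewrite addrC addKr /=].
  + apply: connectedU.
    * by exists (q + Complex M M); split; split; try exact: hM; rewrite addrC addKr.
    * by apply: cH => x y m; exact: lRe.
    * by apply: cH => x y m; exact: lIm.
  + by apply: cH => x y m; rewrite lRe; ring.
- by apply: cH => x y m; rewrite lIm; ring.
Qed.

Definition component_of J z : set C := connected_component (~` J) z.

Lemma comp_sub J z : component_of J z `<=` ~` J.
Proof. exact: connected_component_sub. Qed.

Lemma comp_refl J z : ~ J z -> component_of J z z.
Proof. exact: connected_component_refl. Qed.

Lemma comp_connected J z : connected (component_of J z).
Proof. exact: component_connected. Qed.

Lemma comp_max J z D y : connected D -> D `<=` ~` J -> D y -> component_of J z y -> D `<=` component_of J z.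
Proof.
move=> cD DJ Dy zy w Dw; rewrite /component_of.
apply: (connected_component_trans zy).
exact: (connected_component_max Dy DJ cD).
Qed.

Lemma comp_ball J z q (r : R) y : (forall u, nm (u - q) < r -> ~ J u) -> nm (y - q) < r ->
  component_of J z y -> forall u, nm (u - q) < r -> component_of J z u.
Proof.
move=> hJ yr zy u ur.
by apply: (@comp_max J z _ y (@ball_connected q r)).
Qed.

Lemma comp_open J z : closed J -> open (component_of J z).
Proof.
move=> cJ; apply/open_nmP => q zq.
have /open_nmP/(_ q)[|e e0 he] := closed_openC cJ; first exact: comp_sub zq.
by exists e => // y; apply: (@comp_ball J z q e q) => //; rewrite subrr nm0.
Qed.

Lemma comp_closed J z : closed J -> closed (component_of J z `|` J).
Proof.
move=> cJ; apply/closed_nmP => q H.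
have [Jq|Jq] := pselect (J q); [by right|left].
have /open_nmP/(_ q)[//|e e0 he] := closed_openC cJ.
have [y [zy|Jy] yq] := H _ e0; last by case: (he _ yq).
by apply: (@comp_ball J z q e y) => //; rewrite subrr nm0.
Qed.

Lemma comp_eq J z y : component_of J z y -> component_of J y = component_of J z.
Proof.
move=> zy; apply/seteqP; split=> w h; first exact: connected_component_trans zy h.
by apply: connected_component_trans h; exact: connected_component_sym.
Qed.

Definition outside (K : R) : set C := [set z | K < `|complex.Re z| \/ K < `|complex.Im z|].

Lemma outside_connected (K : R) : connected (outside K).
Proof.
have [K0'|K0'] := lerP 0 K.
  have := @square_complement_connected setT 0 K (K + 1) _ _ _.
  rewrite (_ : [set z | _] = outside K); first by apply=> //; rewrite K0' ltrDl ltr01.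
  by apply/seteqP; split=> z; rewrite /= subr0 => //=[[]].
rewrite (_ : outside K = setT); first by apply: connected_convex.
by apply/seteqP; split=> z // _; left; exact: lt_le_trans K0' _.
Qed.

Lemma punctured_ball_connected q (r : R) : 0 < r ->
  connected [set z | nm (z - q) < r /\ z <> q].
Proof.
move=> r0; have : connected [set z | [set z | nm (z - q) < r] z /\
    (0 < `|complex.Re (z - q)| \/ 0 < `|complex.Im (z - q)|)].
  apply: (@square_complement_connected _ q 0 (r / 3) (@cvx_ball q r)).
    by rewrite lexx divr_gt0.
  move=> s t hs ht /=; rewrite addrC addKr (le_lt_trans (nm_le_ReIm _)) //= hs ht; lra.
congr (connected _).
apply/seteqP; split=> z [h1 h2]; split=> //=.
  by move=> E; move: h2; rewrite E subrr /= normr0 ltxx => -[].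
rewrite !normr_gt0; apply: contrapT => /not_orP[/negP/negPn/eqP k1 /negP/negPn/eqP k2].
by apply: h2; apply/eqP; rewrite -subr_eq0; apply/eqP; apply: eq_Cplx.
Qed.

Lemma outside_far (K r : R) : exists z, outside K z /\ r < nm z.
Proof.
exists (rc (`|K| + `|r| + 1)); have h1 := ler_norm K; have h2 := ler_norm r.
have p : 0 <= `|K| + `|r| + 1 by rewrite !addr_ge0.
by split; [left; rewrite /= ger0_norm //; have := normr_ge0 r; ilra|
  rewrite nm_rc ger0_norm //; have := normr_ge0 K; ilra].
Qed.

(** Any unbounded component meets the outside of a large square, which is connected and misses
    [J]. *)
Lemma unbounded_comp_eq J z y : bdd J -> ~ bdd (component_of J z) -> ~ bdd (component_of J y) ->
  component_of J z = component_of J y.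
Proof.
move=> [K hK] nz ny.
have oJ : outside K `<=` ~` J.
  move=> w ow /hK; case: ow => h; have := ler_Re w; have := ler_Im w; ilra.
have H v : ~ bdd (component_of J v) -> outside K `<=` component_of J v.
  move=> nv; have [w vw ow] : exists2 w, component_of J v w & outside K w.
    apply: contrapT => h; apply: nv; exists (K + K) => w vw.
    rewrite leNgt; apply/negP => kw; apply: h; exists w => //.
    have := nm_le_ReIm w; rewrite /outside /=.
    case: (ltrP K `|complex.Re w|) => [|h1]; first by left.
    case: (ltrP K `|complex.Im w|) => [|h2]; [by right|by move=> h; exfalso; lra].
  exact: (comp_max (@outside_connected K) oJ ow vw).
have [w [ow _]] := outside_far K 0.
by rewrite -(comp_eq (H _ nz _ ow)) (comp_eq (H _ ny _ ow)).
Qed.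

End PlaneTopology.

(** * Separation by the loops of the sheet *)

Section Separation.
Variable R : realType.
Local Notation C := (Cplx R).
Implicit Types (z q w a b p : C) (A J D : set C).
Variable F : C -> C.
Hypothesis eF : entire F.
Variable a : C.
Hypothesis Fa : F a = 0.
Variable d : C.
Hypothesis hd : d = ci R \/ d = - ci R.
Local Notation fl := (fl F).
Local Notation dm := (dm F).
Local Notation hom := (hom F a).
Variable z0 : C.
Hypothesis hz0 : hom z0.
Local Notation psi := (sheet F d z0).
Local Notation L := (Ld F a d z0).
Let n1 := @nm_11 R.
Let nd := nm_d1 hd.

Definition loop (s : R) : set C := range (psi ^~ s) `|` [set a].

Lemma loop_slab s : loop s = slab F d z0 s s `|` [set a].
Proof.
congr (_ `|` _); apply/seteqP; split=> z.
  by move=> [t _ <-]; exists t, s; rewrite lexx.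
by move=> [t [u [/andP[h1 h2] ->]]]; exists t => //; have -> : u = s by apply: le_anti; rewrite h2.
Qed.

Lemma loop_closed s : L s -> closed (loop s).
Proof. by move=> hs; rewrite loop_slab; exact: (slab_closed eF Fa hd hz0). Qed.

Lemma loop_bdd s : L s -> bdd (loop s).
Proof. by move=> hs; rewrite loop_slab; exact: (slab_bdd eF Fa hd hz0). Qed.

Lemma loop_psi s t v : L s -> L v -> loop s (psi t v) -> v = s.
Proof.
move=> hs hv [[t' _ E]|E].
  by have [_ ->] := psi_inj eF Fa hd hz0 hs hv E.
by case: (hom_neq_a Fa (L_hom eF Fa t hv) E).
Qed.

Lemma psi_vcont v t : L v -> ccont (psi t) v.
Proof.
move=> hv e e0; have [r r0 hr] := psi_jcont eF hd hz0 t hv e0.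
by exists r => // s sv; apply: hr => //; rewrite subrr normr0.
Qed.

Lemma psi_hcont v t : L v -> ccont (psi ^~ v) t.
Proof.
move=> hv e e0; have [r r0 hr] := psi_jcont eF hd hz0 t hv e0.
by exists r => // s sv; apply: hr => //; rewrite subrr normr0.
Qed.

Lemma sheet_connected (I : set R) : is_interval I -> (forall v, I v -> L v) ->
  connected [set z | exists t v, I v /\ z = psi t v].
Proof.
move=> iI IL.
have [[v0 Iv0]|nI] := pselect (I !=set0); last first.
  rewrite (_ : [set z | _] = set0); first exact: connected0.
  by rewrite -subset0 => x [t [v [Iv _]]]; apply: nI; exists v.
have -> : [set z | exists t v, I v /\ z = psi t v] =
   \bigcup_(v in I) ((psi 0 @` I) `|` range (psi ^~ v)).
  apply/seteqP; split=> [z [t [v [Iv ->]]]|z [v Iv [[u Iu <-]|[t _ <-]]]].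
  - by exists v => //; right; exists t.
  - by exists 0, u.
  - by exists t, v.
apply: bigcup_connected.
  by exists (psi 0 v0) => v Iv; left; exists v0.
move=> v Iv; apply: connectedU.
- by exists (psi 0 v); split; [exists v|exists 0].
- by apply: connected_curve => // u Iu; apply: psi_vcont; exact: IL.
- by apply: connected_curve => // u _; apply: psi_hcont; exact: IL.
Qed.

(** The strip around level [s + ep], of half-width [ep], has the loops at [s] and [s + 2 ep] as its
    edges, with [p] inside and [q] at level [s - ep] outside. A connection [D] off the lower loop
    gives a root there; off the upper loop [p] and [q] are joined by the segment of levels from
    [s - ep] to [s + ep]. Two such roots cannot coexist. *)
Lemma jordan_sep s (ep : R) D : 0 < ep -> L (s - ep) -> L (s + ep + ep) ->
  connected D -> D `<=` ~` loop s -> D (psi 0 (s + ep)) -> D (psi 0 (s - ep)) -> False.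
Proof.
move=> ep0 L1 L2 cD DJ Dp Dq.
have Lm v : s - ep <= v <= s + ep + ep -> L v by exact: Ld_itv.
have Ls : L s by apply: Lm; lra.
have Lp : L (s + ep) by apply: Lm; lra.
have [dp [Fx hx _]] := Ld_dm Lp.
have Fy : F (psi 0 (s + ep)) != 0 by apply: (fl_neq eF n1 _ (hx 0)).
have [rho [d' [T [chi bx]]]] := box_exists eF Fy.
have [eta eta0 K] : exists2 eta : R, 0 < eta & forall u v : R, `|u| < eta -> `|v| < eta ->
    psi (0 + v) (s + ep + u) = chi (rc u * d + rc v * 1).
  have [Fz0 _ _] := hz0.
  have [eta eta0 K] := box_psi eF n1 nd Fz0 dp (hx 0) bx.
  by exists eta => // u v hu hv; have [] := K u v hu hv.
have b0 := box_at bx.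
have [rho0 d'0 _ _ [_ _ hchi]] := bx.
have tailS : forall c1 c2, L c1 -> L c2 -> tends (fun dd (x : R * R) => dd^-1 <= `|x.1| /\ c1 <= x.2 <= c2)
    (fun x => psi x.1 x.2) a.
  move=> c1 c2 h1 h2 e e0; have [M hM] := psi_tail eF Fa hd h1 h2 e0.
  exists (`|M| + 1)^-1; first by rewrite invr_gt0 ltr_wpDl.
  move=> [t u] /=; rewrite invrK => -[ht hu]; apply: hM => //.
  by have := ler_norm M; ilra.
have cur v : L v -> [/\ forall t, tends (nearR t) (psi ^~ v) (psi t v), tends (@atinf R) (psi ^~ v) a &
     closed (range (psi ^~ v) `|` [set a])].
  move=> hv; split; last exact: loop_closed.
    by move=> t; exact: psi_hcont.
  apply: (tends_map (phi := fun t : R => (t, v)) _ (tailS _ _ hv hv)) => dd t h.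
  by split; rewrite //= lexx.
apply: (@no_common_root R (fun t u => psi t (s + ep + u)) ep a (psi 0 (s + ep)) (psi 0 (s - ep))
   (F (psi 0 (s + ep))) d chi eta) => //.
- exact: nm_d.
- move=> t u E; have := congr1 (@complex.Re R) E; have := congr1 (@complex.Im R) E.
  rewrite !(ReD, ReM, ImD, ImM); case: hd => -> /=; rewrite ?oppr0; split; lra.
- move=> t u; rewrite ler_norml => hu e e0.
  have hv : L (s + ep + u) by apply: Lm; lra.
  have [r r0 hr] := psi_jcont eF hd hz0 t hv e0.
  exists r => // t' u' h1 h2; apply: hr => //.
  by rewrite opprD addrACA subrr add0r.
- apply: (tends_map (phi := fun x : R * R => (x.1, s + ep + x.2)) _ (tailS _ _ L1 L2)) => dd x [h1 h2].
  by split=> //=; move: h2; rewrite ler_norml => /andP[? ?]; apply/andP; split; lra.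
- by rewrite addr0.
- move=> t u; rewrite ler_norml => hu E.
  have hv : L (s + ep + u) by apply: Lm; lra.
  have [-> E2] := psi_inj eF Fa hd hz0 hv Lp E; split=> //; lra.
- move=> t u; rewrite ler_norml => hu; apply/eqP => E.
  have hv : L (s + ep + u) by apply: Lm; lra.
  have [_ E2] := psi_inj eF Fa hd hz0 hv L1 E; lra.
- by apply/eqP => E; apply: (hom_neq_a Fa (L_hom eF Fa 0 L1)).
- by apply/eqP => E; apply: (hom_neq_a Fa (L_hom eF Fa 0 Lp)).
- by move=> t u ht hu; rewrite -[t in LHS]add0r K // mulr1 addrC mulrC.
- by have := hchi 0; rewrite nm0 b0; apply.
- rewrite (_ : (fun _ => _) = psi ^~ s); last by apply/funext => t; rewrite addrK.
  have [c1 c2 c3] := cur _ Ls.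
  by apply: (@root_ratio_connected R _ a c1 c2 D) => // z /DJ.
have [c1 c2 c3] := cur _ L2.
apply: (@root_ratio_connected R _ a c1 c2 (psi 0 @` [set v : R | s - ep <= v <= s + ep])) => //.
- apply: connected_curve => [u v /andP[u1 u2] /andP[v1 v2] w /andP[w1 w2] /=|v /= hv].
    by apply/andP; split; lra.
  by apply: psi_vcont; apply: Lm; lra.
- move=> z [v /= hv <-] h.
  have hv' : L v by apply: Lm; lra.
  have := loop_psi L2 hv' h; lra.
- by exists (s + ep) => //=; lra.
- by exists (s - ep) => //=; lra.
Qed.

Lemma same_side s u v t t' : L s -> L u -> L v -> (s < u /\ s < v) \/ (u < s /\ v < s) ->
  component_of (loop s) (psi t u) (psi t' v).
Proof.
move=> hs hu hv side.
pose I := [set w : R | L w /\ ((s < w /\ s < u) \/ (w < s /\ u < s))].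
have iI : is_interval I.
  move=> x y [Lx hx] [Ly hy] w /andP[xw wy]; split; first by apply: (Ld_itv Lx Ly); rewrite xw.
  by case: hx => -[h1 h2]; case: hy => -[h3 h4]; [left|left|right|right]; split => //; lra.
apply: (comp_max (sheet_connected iI _) _ (y := psi t u)).
- by move=> w [].
- move=> _ [t1 [w [[Lw hw] ->]]] /(loop_psi hs Lw) ws.
  by move: hw; rewrite ws ltxx => -[[]|[]].
- by exists t, u; split=> //; split=> //; case: side => -[h1 h2]; [left|right].
- by apply: comp_refl => /(loop_psi hs hu) us; case: side; rewrite us ltxx => -[].
- by exists t', v; split=> //; split=> //; case: side => -[h1 h2]; [left|right].
Qed.

Lemma sides_distinct s u v t t' : L s -> L u -> L v -> u < s -> s < v ->
  ~ component_of (loop s) (psi t v) (psi t' u).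
Proof.
move=> hs hu hv us sv h.
pose ep := Num.min (s - u) ((v - s) / 2).
have ep0 : 0 < ep by rewrite lt_min subr_gt0 us divr_gt0 // subr_gt0.
have e1 : ep <= s - u by rewrite ge_min lexx.
have e2 : ep <= (v - s) / 2 by rewrite ge_min lexx orbT.
have Lm (w : R) : u <= w <= v -> L w by exact: Ld_itv.
have L1 : L (s - ep) by apply: Lm; lra.
have L2 : L (s + ep) by apply: Lm; lra.
apply: (@jordan_sep s ep (component_of (loop s) (psi t v))) => //.
- by apply: Lm; lra.
- exact: comp_connected.
- exact: comp_sub.
- by apply: same_side => //; left; split; lra.
rewrite -(comp_eq h); apply: same_side => //; right; split; lra.
Qed.

Lemma one_side_bounded s u v t t' : L s -> L u -> L v -> u < s -> s < v ->
  bdd (component_of (loop s) (psi t v)) \/ bdd (component_of (loop s) (psi t' u)).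
Proof.
move=> hs hu hv us sv; apply: contrapT => /not_orP[n2 n3].
apply: (@sides_distinct s u v t t') => //.
rewrite (unbounded_comp_eq (loop_bdd hs) n2 n3); apply: comp_refl.
by move=> /(loop_psi hs hu) E; move: us; rewrite E ltxx.
Qed.

(** The two components and the loop without [a] together form an open set, because the sheet fills a
    neighbourhood of each point of that orbit; adding [a] makes it compact. *)
Lemma not_both_bounded s u v t t' : L s -> L u -> L v -> u < s -> s < v ->
  bdd (component_of (loop s) (psi t v)) -> bdd (component_of (loop s) (psi t' u)) -> False.
Proof.
move=> hs hu hv us sv [M1 b1] [M2 b2].
have cl := loop_closed hs; have [M3 b3] := loop_bdd hs.
apply: (@no_clopen_bounded R (component_of (loop s) (psi t v) `|` component_of (loop s) (psi t' u) `|` range (psi ^~ s)) a).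
- by exists (psi 0 s); right; exists 0.
- apply/open_nmP => z [[h|h]|[t1 _ <-]].
  + have /open_nmP/(_ _ h)[e e0 he] := comp_open (z := psi t v) cl.
    by exists e => // y /he; left; left.
  + have /open_nmP/(_ _ h)[e e0 he] := comp_open (z := psi t' u) cl.
    by exists e => // y /he; left; right.
  have [r r0 hr] := psi_nbhd eF Fa hd t1 hs ltr01.
  exists r => // y /hr[t2 [w [_ _ Lw ->]]].
  have [ws|sw|->] := ltgtP w s.
  + by left; right; apply: same_side => //; right.
  + by left; left; apply: same_side => //; left.
  by right; exists t2.
- move=> [[h|h]|[t1 _ E]]; try by apply: (comp_sub h); right.
  exact: (hom_neq_a Fa (L_hom eF Fa t1 hs)).
- have c1 := comp_closed (z := psi t v) cl; have c2 := comp_closed (z := psi t' u) cl.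
  rewrite (_ : _ `|` _ = (component_of (loop s) (psi t v) `|` loop s) `|` (component_of (loop s) (psi t' u) `|` loop s)).
    exact: closedU.
  apply/seteqP; split=> z; rewrite /loop /=; tauto.
exists (`|M1| + `|M2| + `|M3|) => z hz.
have := ler_norm M1; have := ler_norm M2; have := ler_norm M3.
have := normr_ge0 M1; have := normr_ge0 M2; have := normr_ge0 M3.
case: hz => [[[/b1|/b2]|h]|h]; try ilra.
- have := b3 _ (or_introl h); ilra.
- have := b3 _ (or_intror h); ilra.
Qed.

End Separation.

(** * Bounded sets and closures *)

Section Bounded.
Variable R : realType.
Local Notation C := (Cplx R).
Implicit Types (A B : set C).

Lemma bdd_sub A B : A `<=` B -> bdd B -> bdd A.
Proof. by move=> AB [M hM]; exists M => z /AB/hM. Qed.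

Lemma bddU A B : bdd A -> bdd B -> bdd (A `|` B).
Proof.
move=> [M hM] [N hN]; exists (Num.max M N) => z [/hM|/hN] h; rewrite le_max h ?orbT //.
Qed.

Lemma bdd_closure A : bdd A -> bdd (closure A).
Proof.
move=> [M hM]; exists (M + 1) => z /closure_nmP/(_ _ ltr01)[y /hM yM yz].
by have := nmD (z - y) y; rewrite subrK nmBC; lra.
Qed.

Lemma not_closure A z : ~ closure A z -> exists2 e : R, 0 < e & forall y, nm (y - z) < e -> ~ A y.
Proof.
move=> nc; apply: contrapT => h; apply: nc; apply/closure_nmP => e e0.
by apply: contrapT => k; apply: h; exists e => // y ye Ay; apply: k; exists y.
Qed.

Lemma zcont_continuous (f : C -> C) z :
  (forall e : R, 0 < e -> exists2 d : R, 0 < d & forall y, nm (y - z) < d -> nm (f y - f z) < e) ->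
  {for z, continuous f}.
Proof.
move=> h A /nbhs_nmP[e e0 eA]; have [d d0 hd] := h _ e0.
by apply/nbhs_nmP; exists d => // y /hd/eA.
Qed.

End Bounded.

(** * The sector is the sheet *)

Section Sector.
Variable R : realType.
Local Notation C := (Cplx R).
Implicit Types (z q w b p x : C) (A J D : set C).
Variable F : C -> C.
Hypothesis eF : entire F.
Variable a : C.
Hypothesis Fa : F a = 0.
Local Notation fl := (fl F).
Local Notation dm := (dm F).
Local Notation hom := (hom F a).
Let n1 := @nm_11 R.

Lemma Ld_opp d z0 (s : R) : nm d <= 1 -> Ld F a d z0 s ->
  Ld F a (- d) z0 (- s) /\ fl (- d) (- s) z0 = fl d s z0.
Proof.
move=> nd hs; split; last by have [ds _] := Ld_dm hs; have [_ ->] := fl_rev eF nd ds.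
move=> u hu; have [|du hom_u] := hs (- u).
  by case: hu => /andP[h1 h2]; [right|left]; apply/andP; split; lra.
by have [] := fl_rev eF nd du; rewrite opprK => h1 ->.
Qed.

Lemma loop0 d z0 : nm d <= 1 -> hom z0 -> loop F a d z0 0 = flow_orbit F z0 `|` [set a].
Proof.
move=> nd [_ dz _]; congr (_ `|` _); apply/seteqP; split=> z.
  by move=> [t _ <-]; apply/orbitP; exists t => //; rewrite /sheet fl0.
by move=> /orbitP[t dt <-]; exists t => //; rewrite /sheet fl0.
Qed.

Lemma orient z0 : hom z0 -> exists2 d, d = ci R \/ d = - ci R & exists2 v : R, 0 < v &
  Ld F a d z0 v /\ bdd (component_of (flow_orbit F z0 `|` [set a]) (sheet F d z0 0 v)).
Proof.
move=> hz0; have hd : ci R = ci R \/ ci R = - ci R := or_introl erefl.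
have nd := nm_d1 hd.
have L0 := Ld0 eF hd hz0.
have /open_R/(_ _ L0)[e e0 he] := Ld_open eF Fa hd (y := z0).
have e2 : 0 < e / 2 by rewrite divr_gt0.
have L1 : Ld F a (ci R) z0 (e / 2) by apply: he; rewrite subr0 gtr0_norm //; lra.
have L2 : Ld F a (ci R) z0 (- (e / 2)) by apply: he; rewrite subr0 normrN gtr0_norm //; lra.
have ne : - (e / 2) < 0 by rewrite oppr_lt0.
have := one_side_bounded eF Fa hd hz0 0 0 L0 L2 L1 ne e2; rewrite loop0 //.
case=> h; first by exists (ci R) => //; exists (e / 2).
have [L3 E] := Ld_opp nd L2; rewrite opprK in L3 E.
exists (- ci R); first by right.
by exists (e / 2) => //; split=> //; rewrite /sheet E.
Qed.

Variable d : C.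
Hypothesis hd : d = ci R \/ d = - ci R.
Let nd := nm_d1 hd.

(** Existence times are uniform on the compact set [K], and the bound that keeps the ends near [a]
    is the same for all homoclinic orbits. So [tau] depends only on [K]. *)
Lemma bounded_step (K : set C) : closed K -> bdd K -> exists2 tau : R, 0 < tau &
  forall x, hom x -> (forall t, K (fl 1 t x)) -> Ld F a d x tau /\ Ld F a d x (- tau).
Proof.
move=> cK bK; have [tau tau0 H] := hom_step eF Fa hd.
have [||s0 s00 HK] := @uniform_on R K (fun s y => forall u : R, `|u| <= s -> dm d y u) cK bK.
- by move=> s s' y ss h u us; apply: h; exact: le_trans ss.
- move=> y _; have [r1 r10 [tau1 tau10 H1]] := local_time eF y.
  by exists r1 => //; exists tau1 => // y' _ yy u ut; exact: H1.
exists (Num.min s0 tau); first by rewrite lt_min s00.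
move=> x hx Kx.
have key (u : R) : `|u| <= Num.min s0 tau -> dm d x u /\ hom (fl d u x).
  rewrite le_min => /andP[us ut].
  have du t : dm d (fl 1 t x) u by exact: HK (Kx t) _ us.
  by split; [have := du 0; rewrite fl0|exact: H].
have m0 : 0 < Num.min s0 tau by rewrite lt_min s00.
by split=> u hu; apply: key; rewrite ler_norml; case: hu => /andP[h1 h2]; apply/andP; split; lra.
Qed.

Variable z0 : C.
Hypothesis hz0 : hom z0.
Local Notation psi := (sheet F d z0).
Local Notation L := (Ld F a d z0).
Local Notation U := (sheet_set F a d z0).
Let L0 := Ld0 eF hd hz0.

Lemma sheet_set_open : open U.
Proof.
apply: (open_sheet eF Fa hd) => // s hs.
by have /open_R/(_ _ hs) := Ld_open eF Fa hd (y := z0).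
Qed.

Lemma L_step (K : set C) (I : set R) : closed K -> bdd K ->
  (forall t s, I s -> L s -> K (psi t s)) ->
  exists2 tau : R, 0 < tau & forall s, I s -> L s -> L (s + tau) /\ L (s - tau).
Proof.
move=> cK bK hK; have [tau tau0 H] := bounded_step cK bK; exists tau => // s Is Ls.
have [_ hs] := Ld_dm Ls.
have [|h1 h2] := H _ hs; first by move=> t; exact: hK.
by have [h3 _] := Ld_shift eF hd Ls h1; have [h4 _] := Ld_shift eF hd Ls h2.
Qed.

Lemma L_all_bdd : bdd U -> forall s, L s.
Proof.
move=> bU; have [||tau tau0 H] := @L_step (closure U) setT _ (bdd_closure bU).
- exact: closed_closure.
- by move=> t s _ Ls; apply: subset_closure; exists t, s.
have Ln (n : nat) : L (n%:R * tau) /\ L (- (n%:R * tau)).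
  elim: n => [|n [IH1 IH2]]; first by rewrite mul0r oppr0.
  rewrite -natr1 mulrDl mul1r opprD; split.
    by have [] := H _ I IH1.
  by have [] := H _ I IH2.
move=> s; have [h1 h2] := Ln (Num.truncn (`|s| / tau)).+1.
apply: (Ld_itv h2 h1); rewrite -ler_norml -ler_pdivrMr //; exact/ltW/truncnS_gt.
Qed.

(** If all levels existed, the sheet would contain every limit point of it where [F] does not
    vanish, hence a punctured disc around [a]. The circle of radius [r / 2] then corresponds to a
    bounded set of parameters. Outside a large parameter square, which is a connected region, the
    sheet cannot cross this circle and stays in the disc. So the rest of the sheet is the image of a
    compact square, and the sheet with [a] is compact. *)
Lemma L_not_all : (exists2 r : R, 0 < r & forall z, nm (z - a) < r -> z <> a -> F z != 0) ->
  ~ (forall s, L s).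
Proof.
move=> [r r0 Fr] LL.
have cU x : closure U x -> F x != 0 -> U x.
  move=> /closure_nmP cx Fx; have [rr rr0 hr] := nbhd_repr eF hd Fx ltr01.
  have [_ [t [s [_ ->]]] /hr[v [w [_ _ dv dw E]]]] := cx _ rr0.
  have E1 : fl d v x = psi (t - w) s.
    by have [_ <-] := fl_inv eF n1 dw; rewrite -E (psi_flow eF t (- w) (LL s)).
  have [_ Ex] := fl_inv eF nd dv.
  have [_ _ E2] := psi_up eF Fa hd (t - w) (LL s) (LL (s - v)).
  by exists (t - w), (s - v); rewrite -Ex E1 E2.
have nUa : ~ U a by move=> [t [s [_ E]]]; apply: (hom_neq_a Fa (L_hom eF Fa t (LL s))).
have r2 : 0 < r / 2 by rewrite divr_gt0.
have r2r : r / 2 < r by lra.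
have oU := sheet_set_open.
have [M hM] := psi_tail eF Fa hd L0 L0 r2.
(* The sheet is open and closed in the punctured disc, which is connected, and it enters the disc
   along level 0. *)
have pU x : nm (x - a) < r -> x <> a -> U x.
  move=> xr xa; have yM : nm (psi `|M| 0 - a) < r / 2.
    by apply: hM; rewrite ?lexx // normr_id ler_norm.
  apply: (@connected_ind _ _ U (psi `|M| 0) (@punctured_ball_connected R a r r0) _ _ _ x _) => //.
  - split; first exact: lt_trans r2r.
    exact: (hom_neq_a Fa (L_hom eF Fa _ L0)).
  - by exists `|M|, 0.
  move=> y [yr ya]; have [Uy|nUy] := pselect (U y).
    by exists U => //; apply/nbhs_nmP; move/open_nmP: oU; exact.
  have [|e e0 he] := @not_closure R U y; first by move=> /cU h; apply: nUy; apply: h; exact: Fr.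
  by exists [set y' | nm (y' - y) < e]; [apply/nbhs_nmP; exists e|move=> u w _ _ /he].
have [K hK] : exists K, forall t s, nm (psi t s - a) = r / 2 -> `|t| <= K /\ `|s| <= K.
  have [||||dd dd0 H] := @uniform_on R [set z | nm (z - a) = r / 2]
    (fun dd y => forall t s, y = psi t s -> 0 < dd -> `|t| <= dd^-1 /\ `|s| <= dd^-1).
  - apply/closed_nmP => z H /=; apply/eqP; rewrite eq_le; apply/andP; split; apply/ler_addgt0Pr => e e0.
      have [y /= ya yz] := H _ e0; have := nm_tri z y a; rewrite ya (nmBC z y); lra.
    have [y /= ya yz] := H _ e0; have := nm_tri y z a; rewrite ya; lra.
  - by exists (r / 2 + nm a) => z /= za; have := nmD (z - a) a; rewrite subrK za.
  - move=> k k' y kk h t s yE k'0; have [h1 h2] := h t s yE (lt_le_trans k'0 kk).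
    have kk' : k^-1 <= k'^-1 by rewrite lef_pV2 ?posrE // (lt_le_trans k'0).
    by split; [exact: le_trans kk'|exact: le_trans kk'].
  - move=> x /= xa.
    have [t0 [s0 [_ xE]]] : U x.
      apply: pU; first by rewrite xa.
      by move=> E; move: xa; rewrite E subrr nm0; lra.
    have [r' r'0 hr'] := psi_nbhd eF Fa hd t0 (LL s0) ltr01.
    exists r' => //; exists (`|t0| + `|s0| + 1)^-1; first by rewrite invr_gt0 ltr_wpDl // addr_ge0.
    move=> y _; rewrite xE => /hr'[t' [s' [tt ss _ yE]]] t s yE' _; rewrite invrK.
    rewrite yE in yE'; have [<- <-] := psi_inj eF Fa hd hz0 (LL s') (LL s) yE'.
    have := ler_normD (t' - t0) t0; have := ler_normD (s' - s0) s0; rewrite !subrK.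
    by have := normr_ge0 t0; have := normr_ge0 s0 => *; split; lra.
  by exists dd^-1 => t s h; exact: (H _ h t s).
(* The outer parameters contain late times on level 0, whose points lie in the disc; their connected
   image does not meet the circle. *)
have hE t s : K < `|t| \/ K < `|s| -> nm (psi t s - a) < r / 2.
  move=> ts; pose g (z : C) := psi (complex.Re z) (complex.Im z).
  have cg : connected (g @` outside K).
    apply: connected_continuous_connected; first exact: outside_connected.
    apply: continuous_in_subspaceT => z _; apply: zcont_continuous => e e0.
    have [dd dd0 hdd] := psi_jcont eF hd hz0 (complex.Re z) (LL (complex.Im z)) e0.
    exists dd => // y yz; apply: hdd; rewrite -?ReN -?ImN -?ReD -?ImD.
      exact: le_lt_trans (ler_Re _) yz.
    exact: le_lt_trans (ler_Im _) yz.
  apply: (connected_ind (P := fun z => nm (z - a) < r / 2) cg (x0 := psi (`|M| + `|K| + 1) 0)).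
  - exists (Complex (`|M| + `|K| + 1) 0) => //; left => /=; rewrite ger0_norm ?addr_ge0 //.
    by have := ler_norm K; have := normr_ge0 M; lra.
  - apply: hM; rewrite ?lexx // ger0_norm ?addr_ge0 //.
    by have := ler_norm M; have := normr_ge0 K; lra.
  - move=> _ [z oz <-]; have gz : nm (g z - a) != r / 2.
      apply/eqP => /hK[h1 h2]; case: oz; rewrite /= ltNge ?h1 ?h2 //.
    exists [set y | nm (y - g z) < `|nm (g z - a) - r / 2|].
      by apply/nbhs_nmP; exists `|nm (g z - a) - r / 2| => //; rewrite normr_gt0 subr_eq0.
    move=> u v _ _ /= hu hv Pu.
    have := nm_tri (g z) u a; have := nm_tri v (g z) a; rewrite (nmBC (g z) u).
    move: hu hv; case: (ger0P (nm (g z - a) - r / 2)) => ?; lra.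
  - by exists (Complex t s).
have hin t s : r / 2 <= nm (psi t s - a) -> - K <= t <= K /\ - K <= s <= K.
  rewrite leNgt -!ler_norml => /negP h; split; rewrite leNgt; apply/negP => k; apply: h; apply: hE.
    by left.
  by right.
apply: (@no_clopen_bounded R U a) => //.
- by exists (psi 0 0), 0, 0.
- apply/closed_nmP => q H.
  have [->|qa] := pselect (q = a); first by right.
  left; have [qr|rq] := ltrP (nm (q - a)) r; first exact: pU.
  have [||t [s [_ _ <-]]] := @image_rect_closed R psi (- K) K (- K) K q.
  - by move=> t s _ _; apply: (psi_jcont eF hd hz0).
  - move=> e e0; have m0 : 0 < Num.min e (r / 2) by rewrite lt_min e0.
    have [y [|->]] := H _ m0; last by rewrite nmBC lt_min => /andP[_]; lra.
    move=> [t [s [_ ->]]]; rewrite lt_min => /andP[k1 k2]; exists t, s.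
    have [|h1 h2] := hin t s; last by split.
    by have := nm_tri q (psi t s) a; rewrite (nmBC q (psi t s)); lra.
  by exists t, s.
apply: bddU; last by exists (nm a) => z ->.
have [|N hN] := @image_rect_bdd R psi (- K) K (- K) K.
  by move=> t s _ _; apply: (psi_jcont eF hd hz0).
exists (`|N| + (r + nm a)) => z [t [s [_ ->]]].
have [h|/hin[h1 h2]] := ltrP (nm (psi t s - a)) (r / 2).
  by have := nmD (psi t s - a) a; rewrite subrK; have := normr_ge0 N; lra.
by have := hN _ _ h1 h2; have := ler_norm N; have := nm_ge0 a; lra.
Qed.

Hypothesis F_isol : exists2 r : R, 0 < r & forall z, nm (z - a) < r -> z <> a -> F z != 0.

Lemma sheet_unbounded : ~ bdd U.
Proof. by move=> /L_all_bdd/(L_not_all F_isol). Qed.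

Variable v1 : R.
Hypotheses (v10 : 0 < v1) (Lv1 : L v1).
Local Notation J0 := (flow_orbit F z0 `|` [set a]).
Local Notation D := (component_of (loop F a d z0 0) (psi 0 v1)).
Hypothesis bD : bdd (component_of J0 (psi 0 v1)).
Hypothesis hInt : forall z, Int J0 z -> hom z.

Let bD' : bdd D. Proof. by rewrite loop0. Qed.

Lemma D_hom z : D z -> hom z.
Proof.
move=> Dz; apply: hInt; split; first by have := comp_sub Dz; rewrite loop0.
apply/bdd_boundedP; have := comp_eq Dz; rewrite loop0 // -/(component_of _ _) => ->; exact: bD.
Qed.

(** All points of [D] are homoclinic, so limits in [D] of the upper half of the sheet lie on the
    sheet again. Their level is positive, as level 0 is the loop and negative levels lie on its
    other side. Connectedness of [D] concludes. *)
Lemma D_upper z : D z <-> exists t s, (0 < s /\ L s) /\ z = psi t s.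
Proof.
split=> [Dz|[t [s [[s0 Ls] ->]]]]; last first.
  by apply: (same_side eF Fa hd hz0) => //; left.
pose V := [set z | exists t s, (0 < s /\ L s) /\ z = psi t s].
have oV : open V.
  apply: (open_sheet (P := fun s => 0 < s /\ L s) eF Fa hd); first by move=> s [].
  move=> s [s0 Ls]; have /open_R/(_ _ Ls)[e e0 he] := Ld_open eF Fa hd (y := z0).
  exists (Num.min e s); first by rewrite lt_min e0.
  move=> u; rewrite lt_min => /andP[ue us]; split; last exact: he.
  by move: us; rewrite ltr_norml => /andP[? ?]; lra.
apply: (connected_ind (P := V) (comp_connected (z := psi 0 v1) (J := loop F a d z0 0)) (x0 := psi 0 v1)) => //.
- apply: comp_refl => /(loop_psi eF Fa hd hz0 L0 Lv1) E; by move: v10; rewrite E ltxx.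
- by exists 0, v1.
move=> x Dx; have [Vx|nVx] := pselect (V x).
  by exists V => //; apply/nbhs_nmP; move/open_nmP: oV; exact.
have [|e e0 he] := @not_closure R V x; last first.
  by exists [set y | nm (y - x) < e]; [apply/nbhs_nmP; exists e|move=> u w _ _ /he].
move=> cx; have [|t [s [Ls xE]]] := sheet_closed_in_hom eF Fa hd (z0 := z0) (D_hom Dx).
  by apply: closureS cx => _ [t [s [[_ Ls] ->]]]; exists t, s.
have [s0|s0|s0] := ltgtP s 0.
- by apply: (sides_distinct eF Fa hd hz0 L0 Ls Lv1 s0 v10 (t := 0) (t' := t)); rewrite -xE.
- by apply: nVx; exists t, s.
by apply: (comp_sub Dx); left; exists t => //; rewrite xE s0.
Qed.

(** [Int] collects all bounded components, so a second one has to be excluded. If it had a boundary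
    point on the loop other than [a], it would meet one half of the sheet: the upper half belongs to
    [D], and the lower half lies in an unbounded component. Without such a point it is open, and
    compact together with [a]. *)
Lemma Int_D z : Int J0 z -> D z.
Proof.
move=> [Jz /bdd_boundedP]; rewrite -/(component_of _ _) -(@loop0 d) // in Jz * => bz.
apply: contrapT => nDz; set J := loop F a d z0 0 in Jz bz nDz *.
have cJ : closed J by exact: (loop_closed eF Fa hd hz0).
apply: (@no_clopen_bounded R (component_of J z) a).
- by exists z; exact: comp_refl.
- exact: comp_open.
- by move=> h; apply: (comp_sub h); right.
- apply/closed_nmP => q H.
  have [->|qa] := pselect (q = a); first by right.
  left; have [//|Jq] : (component_of J z `|` J) q.
    apply/(closed_nmP (component_of J z `|` J)).1; first exact: comp_closed.
    move=> e /H[y [h|->] ye]; first by exists y => //; left.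
    by exists a => //; right; right.
  case: Jq => // -[t _ qE].
  have [r r0 hr] := psi_nbhd eF Fa hd t L0 ltr01.
  have r1 : 0 < Num.min r (nm (q - a)) by rewrite lt_min r0 nm_gt0 subr_eq0; apply/eqP.
  have [y [zy|->]] := H _ r1; rewrite lt_min => /andP[yr ya]; last by move: ya; rewrite nmBC ltxx.
  rewrite -qE in yr; have [t' [s' [_ _ Ls' yE]]] := hr _ yr.
  exfalso; have [s0|s0|s0] := ltgtP s' 0.
  + apply: (not_both_bounded eF Fa hd hz0 L0 Ls' Lv1 s0 v10 (t := 0) (t' := t')) => //.
    by rewrite -yE (comp_eq zy).
  + apply: nDz; rewrite -/J; have Dy : D y by apply/D_upper; exists t', s'.
    rewrite -(comp_eq Dy) (comp_eq zy); exact: comp_refl.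
  + by apply: (comp_sub zy); left; exists t' => //; rewrite yE s0.
apply: bddU => //; by exists (nm a) => w ->.
Qed.

(** Orbits at levels [s >= 0] stay in [D] and its loop, a compact set, so one step length serves all
    of them. *)
Lemma half_line s : 0 <= s -> L s.
Proof.
have [|||tau tau0 H] := @L_step (D `|` loop F a d z0 0) [set s | 0 <= s].
- exact/comp_closed/(loop_closed eF Fa hd hz0).
- by apply: bddU => //; exact: (loop_bdd eF Fa hd hz0).
- move=> t u /=; rewrite le_eqVlt => /orP[/eqP<- _|u0 Lu]; first by right; left; exists t.
  by left; apply/D_upper; exists t, u.
have Ln (n : nat) : L (n%:R * tau).
  elim: n => [|n IH]; first by rewrite mul0r.
  rewrite -natr1 mulrDl mul1r; have [] // := H _ _ IH.
  by rewrite /= mulr_ge0 // ltW.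
move=> s0; apply: (Ld_itv L0 (Ln (Num.truncn (s / tau)).+1)).
by rewrite s0 -ler_pdivrMr //; exact/ltW/truncnS_gt.
Qed.

(** Otherwise the lower side would be bounded, and the whole sheet would be covered by it, the slab
    from [s] to 0 and the bounded set [D]. *)
Lemma upper_bdd s (t : R) : L s -> s < 0 -> bdd (component_of (loop F a d z0 s) (psi t 0)).
Proof.
move=> Ls s0; have /open_R/(_ _ Ls)[e e0 he] := Ld_open eF Fa hd (y := z0).
have Lu : L (s - e / 2) by apply: he; rewrite addrC addKr normrN gtr0_norm ?divr_gt0 //; lra.
have us : s - e / 2 < s by rewrite gtrBl divr_gt0.
have [//|bu] := one_side_bounded eF Fa hd hz0 t 0 Ls Lu L0 us s0.
case: sheet_unbounded; apply: bdd_sub (bddU (bddU bu bD') (slab_bdd eF Fa hd hz0 Ls L0)).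
move=> _ [t' [w [Lw ->]]]; have [ws|sw] := ltrP w s.
  by left; left; apply: (same_side eF Fa hd hz0) => //; right.
have [w0|w0] := ltrP 0 w; first by left; right; apply/D_upper; exists t', w.
by right; left; exists t', w; rewrite sw.
Qed.

(** For the outer part: if the loop of a point off the sheet enclosed [Xi], it would enclose the
    whole connected sheet, which is unbounded. Conversely a loop at a negative level encloses [Xi],
    since its upper side is bounded. *)
Lemma sector_eq : global_elliptic_sector F a (flow_orbit F z0) = U.
Proof.
apply/seteqP; split=> [z [[/orbitP[t dt <-]|/Int_D/D_upper[t [s [[_ Ls] ->]]]]|[/(homP eF Fa) hz hX]]|].
- by exists t, 0; rewrite /sheet fl0.
- by exists t, s.
- apply: contrapT => nUz; pose J := flow_orbit F z `|` [set a].
  have UJ : U `<=` ~` J.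
    move=> _ [t [s [Ls ->]]] [/orbitP[t' dt' E]|E].
      apply: nUz; exists (t - t'), s; split=> //.
      by rewrite -(psi_flow eF t (- t') Ls) -E; have [_ ->] := fl_inv eF n1 dt'.
    exact: (hom_neq_a Fa (L_hom eF Fa t Ls)).
  have [Jz0 /bdd_boundedP bz0] := hX _ (orbit_refl eF z0).
  apply: sheet_unbounded; apply: bdd_sub bz0; rewrite -/(component_of _ _).
  apply: (comp_max _ UJ (y := z0)).
  + by apply: (sheet_connected eF hd hz0) => //; exact: Ld_itv.
  + by exists 0, 0; rewrite /sheet !fl0.
  + exact: comp_refl.
move=> _ [t [s [Ls ->]]]; have [s0|s0|s0] := ltgtP s 0; last first.
- by left; left; apply/orbitP; exists t; [case: hz0|rewrite /sheet s0 fl0].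
- left; right; have Dp : D (psi t s) by apply/D_upper; exists t, s.
  split; first by have := comp_sub Dp; rewrite loop0.
  by apply/bdd_boundedP; have := comp_eq Dp; rewrite loop0 // -/(component_of _ _) => ->; exact: bD.
right; have hs := L_hom eF Fa t Ls; split; first exact/(homP eF Fa).
have -> : flow_orbit F (psi t s) `|` [set a] = loop F a d z0 s.
  congr (_ `|` _); apply/seteqP; split=> z.
    by move=> /orbitP[t' _ <-]; exists (t + t') => //; rewrite (psi_flow eF t t' Ls).
  move=> [t' _ <-]; apply/orbitP; exists (t' - t); first by case: hs.
  by rewrite (psi_flow eF t _ Ls) addrC subrK.
move=> y /orbitP[t' _ <-]; have -> : fl 1 t' z0 = psi t' 0 by rewrite /sheet fl0.
split; last by apply/bdd_boundedP; exact: upper_bdd.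
by move=> /(loop_psi eF Fa hd hz0 Ls L0) E; move: s0; rewrite E ltxx.
Qed.

(** The slab from [s] to 0 is compact with [a], and the levels above 0 form [D], which is closed
    together with its loop. *)
Lemma upper_closed s : L s -> s <= 0 ->
  closed ([set z | exists t u, (s <= u /\ L u) /\ z = psi t u] `|` [set a]).
Proof.
move=> Ls s0.
rewrite (_ : _ `|` _ = (slab F d z0 s 0 `|` [set a]) `|` (D `|` loop F a d z0 0)).
  apply: closedU; first exact: (slab_closed eF Fa hd hz0).
  exact/comp_closed/(loop_closed eF Fa hd hz0).
apply/seteqP; split=> z.
  move=> [[t [u [[su Lu] ->]]]|->]; last by left; right.
  have [u0|u0] := lerP u 0; first by left; left; exists t, u; rewrite su.
  by right; left; apply/D_upper; exists t, u.
move=> [[[t [u [/andP[su u0] ->]]]|->]|[/D_upper[t [u [[u0 Lu] ->]]]|[[t _ <-]|->]]].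
- by left; exists t, u; split=> //; split=> //; apply: (Ld_itv Ls L0); rewrite su.
- by right.
- by left; exists t, u; split=> //; split=> //; rewrite (le_trans s0) // ltW.
- by left; exists t, 0.
by right.
Qed.

Lemma lower_end : exists h : R, forall s, L s <-> h < s.
Proof.
have [s1 ns1] : exists s, ~ L s.
  by apply: contrapT => h; apply: (L_not_all F_isol) => s; apply: contrapT => k; apply: h; exists s.
pose E := [set s : R | ~ L s].
have ubE : ubound E 0 by move=> s ns; rewrite leNgt; apply/negP => s0; apply: ns; exact/half_line/ltW.
have hE : has_sup E by split; [exists s1|exists 0].
have nLh : ~ L (sup E).
  move=> Lh; have /open_R/(_ _ Lh)[e e0 he] := Ld_open eF Fa hd (y := z0).
  have [s ns se] := sup_adherent e0 hE; have := ub_le_sup hE.2 ns => sE; apply: ns; apply: he; rewrite ltr_norml; apply/andP; split; lra.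
exists (sup E) => s; split=> [Ls|hs]; last first.
  by apply: contrapT => ns; have := ub_le_sup hE.2 ns; rewrite leNgt hs.
rewrite ltNge; apply/negP => sh; apply: nLh; apply: (Ld_itv Ls L0); rewrite sh /=.
exact: ge_sup hE.1 ubE.
Qed.

End Sector.

(** * The boundary of the sheet *)

Section SheetBoundary.
Variable R : realType.
Local Notation C := (Cplx R).
Implicit Types (z q w b p x : C).
Variable F : C -> C.
Hypothesis eF : entire F.
Variable a : C.
Hypothesis Fa : F a = 0.
Variable d : C.
Hypothesis hd : d = ci R \/ d = - ci R.
Local Notation fl := (fl F).
Local Notation dm := (dm F).
Local Notation hom := (hom F a).
Variable z0 : C.
Hypothesis hz0 : hom z0.
Local Notation psi := (sheet F d z0).
Local Notation L := (Ld F a d z0).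
Local Notation U := (sheet_set F a d z0).
Let n1 := @nm_11 R.
Let nd := nm_d1 hd.
Let L0 := Ld0 eF hd hz0.
Variable h : R.
Hypothesis hL : forall s, L s <-> h < s.
Hypothesis upC : forall s, L s -> s <= 0 ->
  closed ([set z | exists t u, (s <= u /\ L u) /\ z = psi t u] `|` [set a]).

Lemma psi_F t s : L s -> F (psi t s) != 0.
Proof. by move=> /(L_hom eF Fa t)[]. Qed.

(** The flow of [d F] for time [sg] leaves points near [b] near [b] and raises sheet points to
    levels above [h + sg]. Hence [b] is a limit of these levels, which are closed together with [a].
    The bound [sg <= - h] keeps [h + sg] in the range of [upC]. *)
Lemma closure_eq0 b : closure U b -> F b = 0 -> b = a.
Proof.
move=> /closure_nmP cb Fb; have h0 : h < 0 by apply/hL.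
have [tau tau0 [r r0 H]] := near_eq_flow eF Fb.
pose sg := Num.min tau (- h).
have sg0 : 0 < sg by rewrite lt_min tau0 oppr_gt0.
have sgt : sg <= tau by rewrite ge_min lexx.
have sgh : sg <= - h by rewrite ge_min lexx orbT.
have Lh : L (h + sg) by apply/hL; rewrite ltrDl.
have hs0 : h + sg <= 0 by lra.
have /closed_nmP/(_ b) [|[t [u [[_ Lu] E]]]|//] := upC Lh hs0; last first.
  by have := psi_F t Lu; rewrite -E Fb eqxx.
move=> e e0; have m0 : 0 < Num.min e r / 2 by rewrite divr_gt0 // lt_min e0.
have [_ [t [s [Ls ->]]] sb] := cb _ m0.
have Lss : L (s + sg) by apply/hL; move/hL: Ls; lra.
have [_ _ E] := psi_up eF Fa hd t Ls Lss.
have [||_] := H d (psi t s) sg (Num.min e r) nd _ _ sb.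
- by rewrite ger0_norm // ltW.
- by rewrite ge_min lexx orbT.
rewrite lt_min E => /andP[k _]; exists (psi t (s + sg)) => //.
by left; exists t, (s + sg); split=> //; split=> //; move/hL: Ls; lra.
Qed.

Lemma sheet_set_a : ~ U a.
Proof. by move=> [t [s [Ls E]]]; apply: (hom_neq_a Fa (L_hom eF Fa t Ls)). Qed.

Variable kap : R.
Hypothesis kap0 : 0 < kap.
Let hk : L (h + kap). Proof. by apply/hL; rewrite ltrDl. Qed.

(** The set A of the overview. *)
Definition bdom : set R := [set t | dm d (psi t (h + kap)) (- kap)].
Definition beta (t : R) : C := fl d (- kap) (psi t (h + kap)).

(** A sheet point near [q] differs from it by a small [v] in level, and its level [s] is at most
    [h + v], as otherwise [q] would be on the sheet at level [s - v]. So [q] raised by [kap] is a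
    limit of points at levels tending to [h + kap]; the slabs are closed with [a] and levels are
    unique, so it lies exactly at level [h + kap]. *)
Lemma beta_surj q : closure U q -> ~ U q -> q <> a -> exists2 t, bdom t & beta t = q.
Proof.
move=> cq nq qa; have Fq : F q != 0 by apply/eqP => /(closure_eq0 cq).
have k0 := kap0.
have key (e : R) : 0 < e -> exists v t s, [/\ `|v| < e, h < s <= h + v, dm d q (v + kap) &
    fl d (v + kap) q = psi t (s + kap)].
  move=> e0; have [r r0 hr] := nbhd_repr eF hd Fq e0.
  have [_ [t [s [Ls ->]]] /hr[v [w [ve we dv dw E]]]] := (closure_nmP _ _).1 cq _ r0.
  have E1 : fl d v q = psi (t - w) s.
    by have [_ <-] := fl_inv eF n1 dw; rewrite -E (psi_flow eF t (- w) Ls).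
  have [_ Eq] := fl_inv eF nd dv.
  have Lk : L (s + kap) by apply/hL; move/hL: Ls; lra.
  have [_ dk Ek] := psi_up eF Fa hd (t - w) Ls Lk.
  rewrite -E1 in dk Ek; have dvk := fl_shiftr eF nd dv dk.
  exists v, (t - w), s; split=> //.
    apply/andP; split; first exact/hL.
    rewrite leNgt; apply/negP => hsv; apply: nq.
    have Lsv : L (s - v) by apply/hL; lra.
    have [_ _ E2] := psi_up eF Fa hd (t - w) Ls Lsv.
    by exists (t - w), (s - v); rewrite -Eq E1 E2.
  by rewrite -Ek; have [_ ->] := fl_shift eF nd dv dvk.
have dk : dm d q kap.
  have [v [t [s [_ /andP[h1 h2] h3 _]]]] := key _ ltr01.
  by apply: (dm_itv eF nd (dm0 eF q nd) h3); apply/andP; split; lra.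
have near e1 : 0 < e1 -> exists t s, h + kap <= s <= h + kap + e1 /\ fl d kap q = psi t s.
  move=> e10; have L1 : L (h + kap + e1) by apply/hL; lra.
  have [|[t [s [hs E]]]|E] := (closed_nmP _).1 (slab_closed eF Fa hd hz0 hk L1) (fl d kap q).
  - move=> e e0; have [dd dd0 hdd] := fl_cont eF nd dk e0.
    have m0 : 0 < Num.min dd e1 by rewrite lt_min dd0.
    have [v [t [s [h1 /andP[h2 h3] _ h4]]]] := key _ m0; move: h1; rewrite lt_min => /andP[h1 h1'].
    exists (psi t (s + kap)); last by rewrite -h4; apply: hdd; rewrite addrK.
    by left; exists t, (s + kap); split=> //; have := ler_norm v => ?; apply/andP; split; lra.
  - by exists t, s.
  by have := fl_neq eF nd Fq dk; rewrite E Fa eqxx.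
have [t [s [/andP[s1 s2] E]]] := near _ ltr01.
have Ls : L s by apply/hL; lra.
have sE : s = h + kap.
  apply/eqP; rewrite eq_le s1 andbT; apply/ler_addgt0Pr => e e0.
  have [t' [s' [/andP[s1' s2'] E']]] := near _ e0.
  have Ls' : L s' by apply/hL; lra.
  by have [_ ->] := psi_inj eF Fa hd hz0 Ls Ls' (etrans (esym E) E').
have [h1 h2] := fl_inv eF nd dk; rewrite E sE in h1 h2.
by exists t.
Qed.

(** All levels from [h + kap] down to [h] would then carry homoclinic orbits, which puts [h] into
    [L]. *)
Lemma hom_beta t : bdom t -> hom (beta t) -> False.
Proof.
move=> At hb; have k0 := kap0.
have Lk : Ld F a d (psi t (h + kap)) (- kap).
  move=> u [/andP[h1 h2]|/andP[h1 h2]]; first by exfalso; lra.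
  have [->//|uk] := eqVneq u (- kap).
  have uk' : - kap < u by rewrite lt_neqAle eq_sym uk.
  have Lu : L (h + kap + u) by apply/hL; lra.
  have [_ h3 h4] := psi_up eF Fa hd t hk Lu.
  by rewrite h4; split=> //; exact: L_hom.
by have [/hL] := psi_ext eF Fa hd hk Lk; rewrite addrK ltxx.
Qed.

Lemma beta_approx t (r : R) : bdom t -> 0 < r -> exists2 s, `|s + kap| < r &
  L (h + kap + s) /\ fl d s (psi t (h + kap)) = psi t (h + kap + s).
Proof.
move=> At r0; have k0 := kap0; pose m := Num.min r kap.
have m0 : 0 < m by rewrite lt_min r0.
have mr : m <= r by rewrite ge_min lexx.
have mk : m <= kap by rewrite ge_min lexx orbT.
exists (m / 2 - kap); first by rewrite subrK gtr0_norm ?divr_gt0 //; lra.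
have Ls : L (h + kap + (m / 2 - kap)) by apply/hL; lra.
by split=> //; have [] := psi_up eF Fa hd t hk Ls.
Qed.

Lemma beta_closure t v : bdom t -> dm 1 (beta t) v -> closure U (fl 1 v (beta t)).
Proof.
move=> At dv; apply/closure_nmP => e e0.
have [r r0 hr] := fl_jcont eF hd (psi_F t hk) At dv e0.
have [s sr [Ls E]] := beta_approx At r0.
exists (fl 1 v (fl d s (psi t (h + kap)))).
  by rewrite E (psi_flow eF t v Ls); exists (t + v), (h + kap + s).
by apply: hr; rewrite ?subrr ?normr0 // opprK.
Qed.

Lemma beta_out t : bdom t -> ~ U (beta t).
Proof.
move=> At [t' [s' [Ls' E]]]; apply: (hom_beta At); rewrite E; exact: L_hom.
Qed.

Lemma beta_F t : bdom t -> F (beta t) != 0.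
Proof. by move=> At; apply: (fl_neq eF nd _ At); exact: psi_F. Qed.

Lemma boundary_sheet : boundary U = [set a] `|` beta @` bdom.
Proof.
have oU : open U := @sheet_set_open _ _ eF _ Fa _ hd z0.
rewrite /boundary (interior_id _).1 //; apply/seteqP; split=> q.
  move=> [cq nq]; have [->|qa] := pselect (q = a); [by left|right].
  by have [t At <-] := beta_surj cq nq qa; exists t.
move=> [->|[t At <-]]; last first.
  split; last exact: beta_out.
  by have := beta_closure At (dm0 eF _ n1); rewrite fl0.
split; last exact: sheet_set_a.
apply/closure_nmP => e e0; have [M hM] := psi_tail eF Fa hd L0 L0 e0.
exists (psi `|M| 0); first by exists `|M|, 0.
by apply: hM; rewrite ?lexx // normr_id ler_norm.
Qed.

Lemma bdom_open t : bdom t -> exists2 e : R, 0 < e & forall u, `|u - t| < e -> bdom u.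
Proof.
move=> At; pose p := psi t (h + kap).
have At' : dm d (fl 1 0 p) (- kap) by rewrite fl0.
have Fq : F (fl d (- kap) (fl 1 0 p)) != 0 by rewrite fl0 //; exact: beta_F.
have [rho [d' [T [chi bx]]]] := box_exists eF Fq.
have [e e0 K] := box_psi eF nd n1 (psi_F t hk) (dm0 eF p n1) At' bx.
exists e => // u ut; have [|_ + _] := K (u - t) 0 ut; first by rewrite normr0.
rewrite add0r addr0 (psi_flow eF t _ hk).
by rewrite addrC subrK.
Qed.

(** Commutation over the strip below level [h + kap], as far as it is filled without a gap. It
    identifies the parameter of [beta] with real time along the boundary orbit. *)
Lemma beta_flow t u : bdom t -> (forall w : R, betw w u -> bdom (t + w)) ->
  dm 1 (beta t) u /\ fl 1 u (beta t) = beta (t + u).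
Proof.
move=> At Au; rewrite /beta -(psi_flow eF t u hk).
have hy := L_hom eF Fa t hk; have [_ dy _] := hy.
apply: (comm_strip eF (I := [set v : R | forall w : R, betw w v -> bdom (t + w)])) => //.
- apply/open_R => v Av.
  have [e e0 he] := bdom_open (Av _ (betw_refl v)).
  have [e' e'0 he'] := bdom_open At.
  exists (Num.min e e'); first by rewrite lt_min e0.
  move=> s; rewrite lt_min => /andP[se se'] w ws.
  have [wv|wv] := pselect (betw w v); first exact: Av.
  have [wv'|wv'] := pselect (`|w - v| < e); first by apply: he; rewrite opprD addrACA subrr add0r.
  apply: he'; rewrite addrC addKr.
  move: se se' wv wv' ws; rewrite /betw !ltr_norml => /andP[k1 k2] /andP[k3 k4] wv wv' ws.
  have wv2 : ~ (- e < w - v /\ w - v < e) by move=> [k5 k6]; apply: wv'; rewrite k5.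
  exfalso; case: ws => /andP[k5 k6].
  + have [wv3|wv3] := lerP w v; first by apply: wv; left; rewrite k5.
    by apply: wv2; split; lra.
  + have [wv3|wv3] := lerP v w; first by apply: wv; right; rewrite wv3.
    by apply: wv2; split; lra.
- move=> u1 v1 A1 A2 w1 /andP[k1 k2] w [/andP[k3 k4]|/andP[k3 k4]].
    by apply: A2; left; rewrite k3 (le_trans k4).
  by apply: A1; right; rewrite (le_trans k1 k3) k4.
- move=> w; rewrite /betw => ww; have -> : w = 0 by case: ww => /andP[? ?]; lra.
  by rewrite addr0.
- by move=> v /(_ v (betw_refl v)); rewrite (psi_flow eF t v hk).
Qed.

(** The orbit of [beta t] consists of boundary points other than [a], so by [beta_surj] each of them
    can be raised by [kap]. The strip above this orbit is then filled, and commutation puts the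
    raised point at parameter [t + v] of level [h + kap], from where it can be lowered again. *)
Lemma beta_dom t v : bdom t -> dm 1 (beta t) v -> bdom (t + v).
Proof.
move=> At dv.
have K u : dm 1 (beta t) u -> dm d (fl 1 u (beta t)) kap.
  move=> du; have [||t' At' <-] := beta_surj (beta_closure At du).
  - move=> [t' [s' [Ls' E]]]; apply: (beta_out At).
    exists (t' - u), s'; split=> //.
    by rewrite -(psi_flow eF t' (- u) Ls') -E; have [_ ->] := fl_inv eF n1 du.
  - by move=> E; have := fl_neq eF n1 (beta_F At) du; rewrite E Fa eqxx.
  by have [] := fl_inv eF nd At'; rewrite opprK.
have [oI iI I0 _ _] := fl_sol eF (beta t) n1.
have [_ E] := comm_strip eF n1 nd oI iI I0 (fun _ => id) K dv.
have [_ Ek] := fl_inv eF nd At; rewrite opprK -/(beta t) in Ek.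
rewrite Ek (psi_flow eF t v hk) in E.
by have [] := fl_inv eF nd (K _ dv); rewrite -E.
Qed.

Lemma beta_dom_betw t v (w : R) : bdom t -> dm 1 (beta t) v -> betw w v -> bdom (t + w).
Proof.
move=> At dv wv; apply: beta_dom => //; case: wv => wv.
  exact: (dm_itv eF n1 (dm0 eF _ n1) dv).
exact: (dm_itv eF n1 dv (dm0 eF _ n1)).
Qed.

Lemma beta_inj t t' : bdom t -> bdom t' -> beta t = beta t' -> t = t'.
Proof.
move=> At At' E; have [_ E1] := fl_inv eF nd At; have [_ E2] := fl_inv eF nd At'.
by have [] := psi_inj eF Fa hd hz0 hk hk (etrans (esym E1) (etrans (congr1 (fl d (- - kap)) E) E2)).
Qed.

Lemma beta_orbit t q : bdom t -> flow_orbit F (beta t) q ->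
  exists u, [/\ bdom (t + u), forall w : R, betw w u -> bdom (t + w) & q = beta (t + u)].
Proof.
move=> At /orbitP[u du <-]; have Aw (w : R) := beta_dom_betw At du (w := w).
exists u; split=> //; first exact/Aw/betw_refl.
by have [] := beta_flow At Aw.
Qed.

Lemma beta_in_orbit t u : bdom t -> (forall w : R, betw w u -> bdom (t + w)) ->
  flow_orbit F (beta t) (beta (t + u)).
Proof. by move=> At /(beta_flow At)[du <-]; apply/orbitP; exists u. Qed.

Hypothesis kap_tail : exists2 r : R, 0 < r & forall c x (s e : R), nm c <= 1 -> `|s| <= kap -> e <= r ->
  nm (x - a) < e / 2 -> dm c x s /\ nm (fl c s x - a) < e.

Lemma beta_tail (e : R) : 0 < e -> exists M : R, forall t, M <= `|t| -> bdom t /\ nm (beta t - a) < e.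
Proof.
move=> e0; have [r r0 H] := kap_tail.
have m0 : 0 < Num.min e r / 2 by rewrite divr_gt0 // lt_min e0.
have [M hM] := psi_tail eF Fa hd hk hk m0.
exists M => t Mt; have [|||h1 h2] := H d (psi t (h + kap)) (- kap) (Num.min e r) nd.
- by rewrite normrN ger0_norm // ltW.
- by rewrite ge_min lexx orbT.
- by apply: hM; rewrite ?lexx.
by split=> //; move: h2; rewrite lt_min => /andP[].
Qed.

Lemma bdom_not_all : exists t, ~ bdom t.
Proof.
apply: contrapT => nA; have A t : bdom t by apply: contrapT => k; apply: nA; exists t.
apply: (hom_beta (A 0)); split; first exact: beta_F.
  by move=> t; have [] := @beta_flow 0 t (A 0) (fun (w : R) _ => A _).
move=> e e0; have [M hM] := beta_tail e0; exists M => t /hM[_].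
by have [_ ->] := @beta_flow 0 t (A 0) (fun (w : R) _ => A _); rewrite add0r.
Qed.

Lemma sheet_boundary_separatrices :
  exists (G1 G2 : set C) (Q : set nat) (Cn : nat -> set C),
    [/\ [/\ separatrix F G1, separatrix F G2, G1 <> G2,
            omega_neg F G1 = [set a] & omega_pos F G2 = [set a]],
        forall n, Q n -> separatrix F (Cn n) /\ Cn n `<=` boundary U,
        boundary U = [set a] `|` G1 `|` G2 `|` \bigcup_(n in Q) Cn n,
        positive_separatrix F G1 /\ negative_separatrix F G2 &
        forall n, Q n -> double_sided_separatrix F (Cn n)].
Proof.
have [N0 hN0] := beta_tail ltr01.
have [N N_gt0 N0N] : exists2 N : R, 0 < N & N0 <= N.
  by exists (`|N0| + 1); [rewrite ltr_wpDl|have := ler_norm N0; lra].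
have AN t : N <= `|t| -> bdom t.
  by move=> Nt; have [] := hN0 t; first exact: le_trans Nt.
have [ts nts] := bdom_not_all.
have /andP[ts1 ts2] : - N < ts < N.
  by rewrite -ltr_norml ltNge; apply/negP => /AN.
have Am t : t <= - N -> bdom t by move=> tN; apply: AN; rewrite ler0_norm; lra.
have Ap t : N <= t -> bdom t by move=> tN; apply: AN; rewrite ger0_norm; lra.
have eN : - N + (ts + N) = ts by ring.
have A1 := Am _ (lexx _); have A2 := Ap _ (lexx _).
have f1 u : u <= 0 -> dm 1 (beta (- N)) u /\ fl 1 u (beta (- N)) = beta (- N + u).
  by move=> u0; apply: beta_flow => // w wu; apply: Am; case: wu => /andP[? ?]; lra.
have f2 u : 0 <= u -> dm 1 (beta N) u /\ fl 1 u (beta N) = beta (N + u).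
  by move=> u0; apply: beta_flow => // w wu; apply: Ap; case: wu => /andP[? ?]; lra.
have b1 u : dm 1 (beta (- N)) u -> u < ts + N.
  move=> du; rewrite ltNge; apply/negP => k; apply: nts.
  have := beta_dom_betw A1 du (w := ts + N); rewrite eN; apply; left; apply/andP; split; lra.
have b2 u : dm 1 (beta N) u -> ts - N < u.
  move=> du; rewrite ltNge; apply/negP => k; apply: nts.
  have := beta_dom_betw A2 du (w := ts - N); rewrite subrKC; apply; right; apply/andP; split; lra.
pose G1 := flow_orbit F (beta (- N)); pose G2 := flow_orbit F (beta N).
(* The points of the bounded components of [bdom]: there is a gap on either side. *)
pose inner (t : R) := [/\ bdom t, exists2 t1, t1 < t & ~ bdom t1 & exists2 t2, t < t2 & ~ bdom t2].
(* All rationals are enumerated. A number that codes no rational is read as 0, which is harmless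
   because [Q] keeps only inner points. One orbit may be listed many times. *)
pose num (n : nat) : R := ratr (odflt 0 (unpickle n : option rat)).
pose Q := [set n | inner (num n)]; pose Cn n := flow_orbit F (beta (num n)).
have pG1 : positive_separatrix F G1.
  exists (beta (- N)); split=> //; apply/bddR_boundedP; exists (ts + N) => t [/=].
  by rewrite Imax_dm => /b1 h1 h2; rewrite ger0_norm // ltW.
have nG2 : negative_separatrix F G2.
  exists (beta N); split=> //; apply/bddR_boundedP; exists (N - ts) => t [/=].
  by rewrite Imax_dm => /b2 h1 h2; rewrite ler0_norm //; lra.
have dC n : Q n -> double_sided_separatrix F (Cn n).
  move=> [An [t1 t1n nt1] [t2 nt2 nt2']]; exists (beta (num n)); split=> //; apply/bddR_boundedP.
  exists (t2 - t1) => t; rewrite Imax_dm => dt.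
  have h1 : t1 - num n < t.
    rewrite ltNge; apply/negP => k; apply: nt1.
    have := beta_dom_betw An dt (w := t1 - num n); rewrite subrKC; apply; right; apply/andP; split; lra.
  have h2 : t < t2 - num n.
    rewrite ltNge; apply/negP => k; apply: nt2'.
    have := beta_dom_betw An dt (w := t2 - num n); rewrite subrKC; apply; left; apply/andP; split; lra.
  by rewrite ler_norml; apply/andP; split; lra.
have sub t : bdom t -> flow_orbit F (beta t) `<=` boundary U.
  by move=> At q /(beta_orbit At)[u [Au _ ->]]; rewrite boundary_sheet; right; exists (t + u).
exists G1, G2, Q, Cn; split=> //.
- split; [by left|by right| | |].
  + move=> E; have : G1 (beta N) by rewrite E; exact: orbit_refl.
    move=> /(beta_orbit A1)[u [Au Aw E']].
    have uE : N = - N + u by exact: beta_inj E'.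
    apply: nts; have := Aw (ts + N); rewrite eN; apply; left; apply/andP; split; lra.
  + apply: (omega_neg_tail eF); split; first by exists 0 => t /f1[].
    move=> e e0; have [M hM] := beta_tail e0; exists (- `|M|) => t tM.
    have t0 : t <= 0 by have := normr_ge0 M; lra.
    have [_ ->] := f1 _ t0; apply: (hM _ _).2; rewrite ler0_norm; have := ler_norm M; lra.
  apply: (omega_pos_tail eF); split; first by exists 0 => t /f2[].
  move=> e e0; have [M hM] := beta_tail e0; exists `|M| => t tM.
  have t0 : 0 <= t by have := normr_ge0 M; lra.
  have [_ ->] := f2 _ t0; apply: (hM _ _).2; rewrite ger0_norm; have := ler_norm M; lra.
- move=> n Qn; split; last by apply: sub; case: Qn.
  have [x [E [M bM]]] := dC _ Qn; left; exists x; split=> //.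
  apply/bddR_boundedP; have /bddR_boundedP[M' hM'] : bounded_set (Imax F x) by exists M.
  by exists M' => t [/hM'].
apply/seteqP; split=> [q|q [[[->|]|]|[n [An _ _]]]]; last first.
- exact: sub.
- exact: sub.
- exact: sub.
- by rewrite boundary_sheet; left.
rewrite boundary_sheet => -[->|[t At <-]]; first by left; left; left.
(* Without a gap below, [t] lies in the component of [- N] and hence on [G1]; without a gap above,
   on [G2]. In the remaining case the component is bounded. *)
have [l1|l1] := pselect (forall w : R, w <= t -> bdom w).
  left; left; right; have -> : t = - N + (t + N) by ring.
  apply: beta_in_orbit => // w wt; have [w0|w0] := lerP w 0; first by apply: Am; lra.
  by apply: l1; case: wt => /andP[? ?]; lra.
have [l2|l2] := pselect (forall w : R, t <= w -> bdom w).
  left; right; have -> : t = N + (t - N) by rewrite subrKC.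
  apply: beta_in_orbit => // w wt; have [w0|w0] := lerP 0 w; first by apply: Ap; lra.
  by apply: l2; case: wt => /andP[? ?]; lra.
right; have [e e0 he] := bdom_open At.
have [t1 t1t nt1] : exists2 t1, t1 <= t & ~ bdom t1.
  by apply: contrapT => k; apply: l1 => w wt; apply: contrapT => k'; apply: k; exists w.
have [t2 t2t nt2] : exists2 t2, t <= t2 & ~ bdom t2.
  by apply: contrapT => k; apply: l2 => w wt; apply: contrapT => k'; apply: k; exists w.
have te : t < t + e by rewrite ltrDl.
(* The rational lies so close to the right of [t] that no gap separates them, so both parametrise
   the same orbit. *)
have [r] := rat_in_itvoo te; rewrite in_itv /= => /andP[r1 r2].
have nE : num (pickle r) = ratr r by rewrite /num pickleK.
have Ar u : t <= u <= ratr r -> bdom u.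
  move=> /andP[u1 u2]; apply: he; rewrite ltr_distl (le_lt_trans u2 r2) andbT.
  by rewrite (lt_le_trans _ u1) // gtrBl.
have rt2 : ratr r < t2.
  by rewrite ltNge; apply/negP => k; apply: nt2; apply: Ar; rewrite t2t.
have Arr : bdom (ratr r) by apply: Ar; rewrite lexx ltW.
exists (pickle r).
  rewrite /Q /inner /= nE; split=> //; [exists t1 => //; exact: le_lt_trans r1|by exists t2].
rewrite /Cn nE; have -> : t = ratr r + (t - ratr r) by rewrite subrKC.
by apply: beta_in_orbit => // w wt; apply/Ar/betw_sub => //; exact: ltW.
Qed.

End SheetBoundary.

Theorem theorem4p17 (R : realType) (F : Cplx R -> Cplx R) (a : Cplx R) (m : nat)
    (Xi : set (Cplx R))
    (F_entire : entire F) (F_neq0 : exists z, F z <> 0)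
    (a_eq : equilibrium F a) (a_order : zero_of_order F a m) (m_neq1 : m <> 1%N)
    (Xi_sector : sector_forming F a Xi) :
  exists (G1 G2 : set (Cplx R)) (Q : set nat) (Cn : nat -> set (Cplx R)),
    [/\ [/\ separatrix F G1, separatrix F G2, G1 <> G2,
            omega_neg F G1 = [set a] & omega_pos F G2 = [set a]],
        forall n, Q n -> separatrix F (Cn n) /\
          Cn n `<=` boundary (global_elliptic_sector F a Xi),
        boundary (global_elliptic_sector F a Xi) =
          [set a] `|` G1 `|` G2 `|` \bigcup_(n in Q) Cn n,
        positive_separatrix F G1 /\ negative_separatrix F G2 &
        forall n, Q n -> double_sided_separatrix F (Cn n)].
Proof.
(* The cofactor [g] does not vanish near [a]. The resulting zero-free punctured disc is what rules
   out a sheet with all levels. *)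
have F_isol : exists2 r : R, 0 < r & forall z, nm (z - a) < r -> z <> a -> F z != 0.
  have [g [eg ga Fg]] := a_order; have [l hl] := derivable_hol (eg a).
  have ga0 : 0 < nm (g a) by rewrite nm_gt0.
  have [r r0 hr] := hol_cont hl ga0; exists r => // z /hr zr za.
  rewrite Fg mulf_neq0 ?expf_neq0 ?subr_eq0 //; first exact/eqP.
  by apply/eqP => gz; move: zr; rewrite gz sub0r nmN ltxx.
have [hXi hInt] := Xi_sector; have [z0 XiE hz0] := homoclinic_orbit F_entire a_eq hXi.
have [d hd [v v0 [Lv bv]]] := orient F_entire a_eq hz0.
have hInt' z : Int (flow_orbit F z0 `|` [set a]) z -> hom F a z.
  by rewrite -XiE => /hInt/(homP F_entire a_eq).
rewrite XiE (sector_eq F_entire a_eq hd hz0 F_isol v0 Lv bv hInt').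
have [h hL] := lower_end F_entire a_eq hd hz0 F_isol v0 Lv bv hInt'.
(* [tau] is taken as [kap]: points near [a] can be moved for this time and stay near [a], so both
   ends of the parameter line belong to [bdom]. *)
have [tau tau0 Htau] := near_eq_flow F_entire a_eq.
apply: (sheet_boundary_separatrices F_entire a_eq hd hz0 hL _ tau0 Htau).
exact: (upper_closed F_entire a_eq hd hz0 v0 Lv bv hInt').
Qed.
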